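(* Let $\mu$ be a free regular infinitely divisible probability measure, with free cumulant transform $$C_{\mu}(z)=\eta' z+\int_{\mathbb{R}^+}\Big(\frac{1}{1-zt}-1\Big)d\nu(t),\qquad z\in\mathbb{C}^-,$$ where $\eta'\ge 0$ and $\nu$ is the (free) L\'evy measure of $\mu$. Let $\alpha\ge0$. Then the following are equivalent: (1) $\mu$ has regularly varying tail of index $-\alpha$; (2) $\nu$ has regularly varying tail of index $-\alpha$. If $\mu$ or $\nu$ has regularly varying tail of index $-\alpha$, then $\mu(x,\infty)\sim\nu(x,\infty)$ as $x\to\infty$.
   Context: Notation: $\mathbb{R}^+=[0,\infty)$, $\mathbb{C}^+$ and $\mathbb{C}^-$ are the open upper and lower half-planes. Regular variation: a measurable $f$ on $[0,\infty)$ (defined and positive for large arguments) is regularly varying (at infinity) of index $\beta$ if $f(tx)/f(x)\to t^{\beta}$ as $x\to\infty$ for every $t>0$. A measure $\lambda$ (finite on $(x,\infty)$ for $x>0$) has regularly varying tail of index $-\alpha$ if $x\mapsto\lambda(x,\infty)$ is regularly varying of index $-\alpha$. $f\sim g$ means $f/g\to1$. Transforms: for a probability measure $\mu$ on $\mathbb{R}$, $G_\mu(z)=\int\frac{1}{z-t}d\mu(t)$ and $F_\mu=1/G_\mu$ on $\mathbb{C}^+$. The free cumulant transform is $C_\mu(z)=zF_\mu^{-1}(1/z)-1$, defined for $z\in\mathbb{C}^-$ with $1/z$ in a truncated cone $\{w\in\mathbb{C}^+:|\Re w|<\eta\,\Im w,\ |w|>M\}$ where $F_\mu^{-1}$ is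 defined. Free additive convolution $\boxplus$ is characterized by $C_{\mu_1\boxplus\mu_2}=C_{\mu_1}+C_{\mu_2}$; $\mu$ is free infinitely divisible if for each $n$ it is the $n$-fold $\boxplus$-power of some probability measure. Free regular: $\mu$ is free regular infinitely divisible if $C_\mu$ has the representation $C_{\mu}(z)=\eta' z+\int_{\mathbb{R}^+}\big(\frac{1}{1-zt}-1\big)d\nu(t)$, $z\in\mathbb{C}^-$, with $\eta'\ge0$ and $\nu$ a L\'evy measure with $\nu((-\infty,0])=0$ and $\int_{\mathbb{R}^+}\min(1,t)\,d\nu(t)<\infty$ (so $\nu$ may be an infinite measure, but $\nu(x,\infty)<\infty$ for all $x>0$). *)

(* Defs.v *)
From HB Require Import structures.
From mathcomp Require Export all_boot all_order all_algebra.
From mathcomp Require Export all_classical all_reals all_analysis.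
From mathcomp Require Export complex.

Set Implicit Arguments.
Unset Strict Implicit.
Unset Printing Implicit Defensive.

Import Order.TTheory GRing.Theory Num.Theory.
Import numFieldNormedType.Exports.

Local Open Scope classical_set_scope.
Local Open Scope ring_scope.
Local Open Scope complex_scope.

Definition regularly_varying (R : realType) (f : R -> R) (beta : R) : Prop :=
  [/\ measurable_fun (`[0%R, +oo[ : set R) f,
      \forall x \near +oo, 0 < f x
    & forall t : R, 0 < t -> f (t * x) / f x @[x --> +oo] --> t `^ beta].

Definition asymp_equiv (R : realType) (f g : R -> R) : Prop :=
  f x / g x @[x --> +oo] --> (1 : R).

(* x |-> lam (x, +oo), real-valued: fine maps +oo to 0, hence the finiteness
   clause in regularly_varying_tail. *)
Definition tail (R : realType)
    (lam : {measure set (measurableTypeR R) -> \bar R}) (x : R) : R :=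
  fine (lam `]x, +oo[%classic).

Definition regularly_varying_tail (R : realType)
    (lam : {measure set (measurableTypeR R) -> \bar R}) (beta : R) : Prop :=
  (forall x : R, 0 < x -> (lam `]x, +oo[%classic < +oo)%E) /\
  regularly_varying (tail lam) beta.

Definition cintegral (R : realType)
    (m : {measure set (measurableTypeR R) -> \bar R}) (D : set R)
    (f : R -> R[i]) : R[i] :=
  Rintegral m D (fun t => complex.Re (f t))
    +i* Rintegral m D (fun t => complex.Im (f t)).

Definition upper_half_plane (R : realType) : set R[i] :=
  [set z | 0 < complex.Im z].

Definition lower_half_plane (R : realType) : set R[i] :=
  [set z | complex.Im z < 0].

Definition truncated_cone (R : realType) (eta M : R) : set R[i] :=
  [set w | [/\ upper_half_plane w,
               `|complex.Re w| < eta * complex.Im w & M%:C < `|w| ]].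

Definition cauchy_transform (R : realType)
    (mu : probability (measurableTypeR R) R) (z : R[i]) : R[i] :=
  cintegral mu setT (fun t => 1 / (z - t%:C)).

Definition reciprocal_cauchy_transform (R : realType)
    (mu : probability (measurableTypeR R) R) (z : R[i]) : R[i] :=
  1 / cauchy_transform mu z.

(* F_mu^-1 is the inverse of the restriction of F_mu to the truncated cone
   (a, b); it is defined on the truncated cone (eta, M) when F_mu is injective
   on the former and its image contains the latter.  On the cones (eta, M), its
   values do not depend on (a, b): any two such inverses are analytic and agree
   near infinity. *)
Definition reciprocal_cauchy_inverse (R : realType)
    (mu : probability (measurableTypeR R) R) (a b : R) : R[i] -> R[i] :=
  'pinv_(fun=> 0) (truncated_cone a b) (reciprocal_cauchy_transform mu).

Definition inverse_defined_on_cone (R : realType)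
    (mu : probability (measurableTypeR R) R) (a b eta M : R) : Prop :=
  [/\ 0 < a, 0 < b, 0 < eta & 0 < M] /\
  set_inj (truncated_cone a b) (reciprocal_cauchy_transform mu) /\
  truncated_cone eta M `<=`
    reciprocal_cauchy_transform mu @` truncated_cone a b.

Definition free_cumulant_transform (R : realType)
    (mu : probability (measurableTypeR R) R) (a b : R) (z : R[i]) : R[i] :=
  z * reciprocal_cauchy_inverse mu a b (1 / z) - 1.

(* C : C^- -> C is the free cumulant transform of mu, given by its defining
   formula for 1 / z in a truncated cone.  For C analytic on C^-, the choice of
   the cone is irrelevant by analytic continuation. *)
Definition has_free_cumulant_transform (R : realType)
    (mu : probability (measurableTypeR R) R) (C : R[i] -> R[i]) : Prop :=
  exists a b eta M : R, inverse_defined_on_cone mu a b eta M /\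
    forall z : R[i], lower_half_plane z -> truncated_cone eta M (1 / z) ->
      free_cumulant_transform mu a b z = C z.

Definition levy_measure (R : realType)
    (nu : {measure set (measurableTypeR R) -> \bar R}) : Prop :=
  nu [set 0] = 0%E /\
  (\int[nu]_t (Num.min 1 (t ^+ 2))%:E < +oo)%E.

Definition free_regular_cumulant (R : realType) (eta' : R)
    (nu : {measure set (measurableTypeR R) -> \bar R}) (z : R[i]) : R[i] :=
  eta'%:C * z + cintegral nu `[0, +oo[ (fun t => 1 / (1 - z * t%:C) - 1).

Definition free_regular_representation (R : realType)
    (mu : probability (measurableTypeR R) R) (eta' : R)
    (nu : {measure set (measurableTypeR R) -> \bar R}) : Prop :=
  [/\ 0 <= eta',
      levy_measure nu,
      nu `]-oo, 0%R]%classic = 0%E,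
      (\int[nu]_(t in `[0%R, +oo[) (Num.min 1 t)%:E < +oo)%E
    & has_free_cumulant_transform mu (free_regular_cumulant eta' nu)].

(* Main.v *)
(* Write G for the Cauchy transform of mu and F = 1/G. At G(z), the cumulant
   representation says that M(z) = int s/(s-z) dmu(s) = 1 - z G(z) equals
   - eta' G(z) + int t/(t-F(z)) dnu(t). Divided differences in z turn this into an
   identity for the integrals of the products P_Z(s) = prod_(z in Z) s/(s-z) over
   distinct nodes z on the imaginary axis with x <= |z| <= 2x. As F(z)/z tends to
   1, t/(t-F(z)) is a perturbation of t/(t-z), and the errors are controlled by
   the moments of min(1,|s|/x): when one of the two tails varies regularly and Z
   is long, the integrals of P_Z against mu and nu differ by a negligible
   fraction of that tail at x. For pairs of nodes close to +-ix, P_Z(s) is close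
   to a power of u = s^2/(s^2+x^2), so the integrals of all high powers of u
   agree asymptotically; Stone's polynomials 1-(1-u^n)^(2^n) then recover the
   tails. That mu has no mass on the negative half-line follows from the
   positivity of the Pick forms of G and of 1/(F-t) for t >= 0. *)

Require Import Defs.
From mathcomp Require Import measurable_realfun.
From mathcomp Require Import ring lra.

Set Implicit Arguments.
Unset Strict Implicit.
Unset Printing Implicit Defensive.

Import Order.TTheory GRing.Theory Num.Theory.
Import numFieldNormedType.Exports.

Local Open Scope classical_set_scope.
Local Open Scope ring_scope.
Local Open Scope complex_scope.

(** When alpha is large the tail is hidden behind the low moments: comparing the integrals of a
    single factor s/(s-z) leaves an error that can be far larger than the tail at x. A product of n
    factors vanishes to order n at s = 0, so its integral does not see these moments and, once n is
    large compared with alpha, is bounded by a multiple of the tail. This plays the role of a Taylor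
    remainder and treats all alpha >= 0 alike. The price is that t/(t-F(z)) is no partial fraction
    in z, so its divided differences are not products. They are computed from the equation that
    links 1 - z/(F(z)-t) to M, by a Leibniz rule whose corrections all carry a moment of mu and are
    split by Young's inequality. What remains is a small factor times a moment of mu of order one
    too low: harmless when the tail of mu is the known one, whereas otherwise it has to be traded
    for moments of the right order of both measures. The support of mu matters because the products
    over conjugate pairs of nodes depend on s^2 only, and would count the left tail of mu together
    with the right one. *)

Section ComplexModulus.
Variable R : realType.
Implicit Types z w : R[i].

(* The l^1 modulus is only submultiplicative, but it turns bounds on the real
   and imaginary parts of an integral into a bound on the integral with no
   loss of constant. *)
Definition cmod z : R := `|complex.Re z| + `|complex.Im z|.

Lemma cmod_ge0 z : 0 <= cmod z. Proof. exact: addr_ge0. Qed.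
Lemma cReD z w : complex.Re (z + w) = complex.Re z + complex.Re w.
Proof. by case: z; case: w. Qed.
Lemma cImD z w : complex.Im (z + w) = complex.Im z + complex.Im w.
Proof. by case: z; case: w. Qed.
Lemma cReN z : complex.Re (- z) = - complex.Re z. Proof. by case: z. Qed.
Lemma cImN z : complex.Im (- z) = - complex.Im z. Proof. by case: z. Qed.
Lemma cReM z w : complex.Re (z * w)
  = complex.Re z * complex.Re w - complex.Im z * complex.Im w.
Proof. by case: z; case: w. Qed.
Lemma cImM z w : complex.Im (z * w)
  = complex.Re z * complex.Im w + complex.Im z * complex.Re w.
Proof. by case: z => a b; case: w => c d /=. Qed.
Lemma complex_ext z w : complex.Re z = complex.Re w ->
  complex.Im z = complex.Im w -> z = w.
Proof. by case: z => a b; case: w => c d /= -> ->. Qed.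

Lemma conjcM z w : conjc (z * w) = conjc z * conjc w.
Proof. exact: (rmorphM (@conjc R)). Qed.
Lemma conjcD z w : conjc (z + w) = conjc z + conjc w.
Proof. exact: (rmorphD (@conjc R)). Qed.
Lemma conjcN z : conjc (- z) = - conjc z.
Proof. exact: (rmorphN (@conjc R)). Qed.
Lemma conjcV z : conjc z^-1 = (conjc z)^-1.
Proof. exact: (fmorphV (@conjc R)). Qed.
Lemma conjcR (r : R) : conjc r%:C = r%:C.
Proof. by apply: complex_ext => //=; rewrite oppr0. Qed.

Lemma cmod0 : cmod 0 = 0. Proof. by rewrite /cmod /= normr0 addr0. Qed.
Lemma cmodN z : cmod (- z) = cmod z.
Proof. by rewrite /cmod cReN cImN !normrN. Qed.
Lemma cmodD z w : cmod (z + w) <= cmod z + cmod w.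
Proof.
rewrite /cmod cReD cImD; have := ler_normD (complex.Re z) (complex.Re w).
by have := ler_normD (complex.Im z) (complex.Im w); lra.
Qed.
Lemma cmodB z w : cmod (z - w) <= cmod z + cmod w.
Proof. by rewrite -(cmodN w); exact: cmodD. Qed.
Lemma cmodM z w : cmod (z * w) <= cmod z * cmod w.
Proof.
rewrite /cmod cReM cImM mulrDl !mulrDr -!normrM.
have := ler_normB (complex.Re z * complex.Re w) (complex.Im z * complex.Im w).
have := ler_normD (complex.Re z * complex.Im w) (complex.Im z * complex.Re w).
lra.
Qed.
Lemma cmod_real (r : R) : cmod r%:C = `|r|.
Proof. by rewrite /cmod /= normr0 addr0. Qed.
Lemma cmod1 : cmod 1 = 1. Proof. by rewrite cmod_real normr1. Qed.
Lemma Re_le_cmod z : `|complex.Re z| <= cmod z. Proof. by rewrite lerDl. Qed.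
Lemma Im_le_cmod z : `|complex.Im z| <= cmod z. Proof. by rewrite lerDr. Qed.
End ComplexModulus.

(** * Complex-valued integrals *)

Section ComplexIntegral.
Variables (R : realType) (m : {measure set (measurableTypeR R) -> \bar R}).
Variable D : set R.
Hypothesis mD : measurable (D : set (measurableTypeR R)).
Implicit Types (f g : R -> R[i]) (h l : R -> R).

Definition integr (h : R -> R) := m.-integrable D (EFin \o h).

Definition cmeas f := measurable_fun D (fun t => complex.Re (f t)) /\
  measurable_fun D (fun t => complex.Im (f t)).

Definition cintegr f := integr (fun t => complex.Re (f t)) /\
  integr (fun t => complex.Im (f t)).

Lemma integr_le h l : measurable_fun D h -> integr l ->
  (forall t, D t -> `|h t| <= l t) -> integr h.
Proof.
move=> mh il hl; apply: le_integrable il => //; first exact/measurable_EFinP.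
move=> t Dt /=; rewrite lee_fin; exact: le_trans (hl t Dt) (ler_norm _).
Qed.

Lemma integrD h l : integr h -> integr l -> integr (fun t => h t + l t).
Proof. by move=> ih il; apply: eq_integrable (integrableD mD ih il). Qed.

Lemma integrN h : integr h -> integr (fun t => - h t).
Proof. by move=> ih; apply: eq_integrable (integrableN ih). Qed.

Lemma integrB h l : integr h -> integr l -> integr (fun t => h t - l t).
Proof. by move=> ih il; exact: integrD (integrN il). Qed.

Lemma integrZ k h : integr h -> integr (fun t => k * h t).
Proof. by move=> ih; apply: eq_integrable (integrableZl mD k ih). Qed.

Lemma eq_integr h l : (forall t, D t -> h t = l t) -> integr h -> integr l.
Proof.
by move=> hl; apply: eq_integrable => // t /set_mem Dt /=; rewrite hl.
Qed.

Lemma eq_cintegr f g : (forall t, D t -> f t = g t) -> cintegr f -> cintegr g.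
Proof.
by move=> fg [h1 h2]; split; [move: h1|move: h2]; apply: eq_integr => t /fg ->.
Qed.

Lemma cmeasM f g : cmeas f -> cmeas g -> cmeas (fun t => f t * g t).
Proof.
move=> [f1 f2] [g1 g2]; split.
  under eq_fun do rewrite cReM.
  by apply: measurable_funB; apply: measurable_funM.
under eq_fun do rewrite cImM.
by apply: measurable_funD; apply: measurable_funM.
Qed.

Lemma cmeasN f : cmeas f -> cmeas (fun t => - f t).
Proof.
move=> [f1 f2]; split.
  by under eq_fun do rewrite cReN; apply: measurable_funN.
by under eq_fun do rewrite cImN; apply: measurable_funN.
Qed.

Lemma cmeas_cst (k : R[i]) : cmeas (fun=> k). Proof. by split. Qed.

Lemma cintegr_le f l : cmeas f -> integr l ->
  (forall t, D t -> cmod (f t) <= l t) -> cintegr f.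
Proof.
move=> [f1 f2] ig fg; split; apply: integr_le ig _ => // t /fg; apply: le_trans.
- exact: Re_le_cmod.
- exact: Im_le_cmod.
Qed.

Lemma cintegrD f g : cintegr f -> cintegr g -> cintegr (fun t => f t + g t).
Proof.
move=> [f1 f2] [g1 g2]; split.
  by under eq_fun do rewrite cReD; apply: integrD.
by under eq_fun do rewrite cImD; apply: integrD.
Qed.

Lemma cintegrZ (k : R[i]) f : cintegr f -> cintegr (fun t => k * f t).
Proof.
move=> [f1 f2]; split.
  by under eq_fun do rewrite cReM; apply: integrB; apply: integrZ.
by under eq_fun do rewrite cImM; apply: integrD; apply: integrZ.
Qed.

Lemma cintegrN f : cintegr f -> cintegr (fun t => - f t).
Proof.
move=> [f1 f2]; split.
  by under eq_fun do rewrite cReN; apply: integrN.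
by under eq_fun do rewrite cImN; apply: integrN.
Qed.

Lemma cintegrB f g : cintegr f -> cintegr g -> cintegr (fun t => f t - g t).
Proof. by move=> hf hg; apply: cintegrD => //; apply: cintegrN. Qed.

Lemma eq_cintegral f g : (forall t, D t -> f t = g t) ->
  cintegral m D f = cintegral m D g.
Proof.
by move=> fg; rewrite /cintegral; congr (_ +i* _);
  apply: eq_Rintegral => t /set_mem Dt; rewrite fg.
Qed.

Lemma cintegralD f g : cintegr f -> cintegr g ->
  cintegral m D (fun t => f t + g t) = cintegral m D f + cintegral m D g.
Proof.
move=> [f1 f2] [g1 g2]; rewrite /cintegral; apply: complex_ext => /=.
  by under eq_Rintegral do rewrite cReD; rewrite RintegralD.
by under eq_Rintegral do rewrite cImD; rewrite RintegralD.
Qed.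

Lemma cintegralZ (k : R[i]) f : cintegr f ->
  cintegral m D (fun t => k * f t) = k * cintegral m D f.
Proof.
move=> [f1 f2]; apply: complex_ext; rewrite ?cReM ?cImM /=.
  under eq_Rintegral do rewrite cReM.
  by rewrite RintegralB ?RintegralZl//; apply: integrZ.
under eq_Rintegral do rewrite cImM.
by rewrite RintegralD ?RintegralZl//; apply: integrZ.
Qed.

Lemma cintegralN f : cintegr f ->
  cintegral m D (fun t => - f t) = - cintegral m D f.
Proof.
move=> hf; rewrite -mulN1r -cintegralZ //.
by apply: eq_cintegral => t _; rewrite mulN1r.
Qed.

Lemma cintegralB f g : cintegr f -> cintegr g ->
  cintegral m D (fun t => f t - g t) = cintegral m D f - cintegral m D g.
Proof.
by move=> hf hg; rewrite cintegralD ?cintegralN//; apply: cintegrN.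
Qed.

Lemma cintegralJ f : cintegr f ->
  cintegral m D (fun t => conjc (f t)) = conjc (cintegral m D f).
Proof.
move=> [f1 f2]; rewrite /cintegral; apply: complex_ext => /=.
  by apply: eq_Rintegral => t _; case: (f t).
rewrite -[RHS]mulN1r -RintegralZl //.
by apply: eq_Rintegral => t _; case: (f t) => a b /=; rewrite mulN1r.
Qed.

Lemma cmod_cintegral f l : cintegr f -> integr l ->
  (forall t, D t -> cmod (f t) <= l t) ->
  cmod (cintegral m D f) <= Rintegral m D l.
Proof.
move=> [f1 f2] ig fg; rewrite /cmod /=.
apply: (@le_trans _ _ (Rintegral m D (fun t => `|complex.Re (f t)|) +
   Rintegral m D (fun t => `|complex.Im (f t)|))).
  by apply: lerD; apply: le_normr_Rintegral.
have n1 : integr (fun t => `|complex.Re (f t)|) by exact: integrable_norm f1.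
have n2 : integr (fun t => `|complex.Im (f t)|) by exact: integrable_norm f2.
rewrite -RintegralD //; apply: le_Rintegral => //; exact: integrD.
Qed.

End ComplexIntegral.

(** * Clipped moments *)

Section Moments.
Variables (R : realType) (m : {measure set (measurableTypeR R) -> \bar R}).
Variable D : set R.
Hypothesis mD : measurable (D : set (measurableTypeR R)).
Implicit Types (x s : R) (n k : nat).

Definition clip x s : R := Num.min 1 (`|s| / x).

Lemma clip_ge0 x s : 0 < x -> 0 <= clip x s.
Proof. by move=> x0; rewrite le_min ler01 divr_ge0 // ltW. Qed.
Lemma clip_le1 x s : clip x s <= 1. Proof. by rewrite ge_min lexx. Qed.
Lemma clip_le x s : clip x s <= `|s| / x.
Proof. by rewrite ge_min lexx orbT. Qed.
Lemma clip1 s : clip 1 s = Num.min 1 `|s|.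
Proof. by rewrite /clip divr1. Qed.

Lemma clip_anti x y s : 0 < x -> x <= y -> clip y s <= clip x s.
Proof.
move=> x0 xy; rewrite le_min clip_le1 (le_trans (clip_le _ _)) //.
by rewrite ler_wpM2l // lef_pV2 ?posrE // (lt_le_trans x0).
Qed.

Lemma measurable_clip x : measurable_fun D (clip x).
Proof.
apply: measurable_minr => //; apply: measurable_funM => //.
Qed.

Lemma clipX_le x s n k : 0 < x -> (n <= k)%N -> clip x s ^+ k <= clip x s ^+ n.
Proof. by move=> x0 nk; rewrite ler_wiXn2l ?clip_ge0 ?clip_le1. Qed.

Definition mom n x := Rintegral m D (fun s => clip x s ^+ n).

Hypothesis hm : integr m D (clip 1).

Lemma integr_clip n x : (0 < n)%N -> 1 <= x -> integr m D (fun s => clip x s ^+ n).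
Proof.
move=> n0 x1; have x0 : 0 < x by exact: lt_le_trans x1.
apply: integr_le hm _ => //; first by apply: measurable_funX; exact: measurable_clip.
move=> s _; rewrite ger0_norm ?exprn_ge0 ?clip_ge0 //.
by rewrite (le_trans _ (clip_anti _ ltr01 x1)) // -[leRHS]expr1 clipX_le.
Qed.

Lemma mom_ge0 n x : 0 < x -> 0 <= mom n x.
Proof. by move=> x0; apply: Rintegral_ge0 => s _; rewrite exprn_ge0 ?clip_ge0. Qed.

Lemma mom_le n k x : (0 < n)%N -> (n <= k)%N -> 1 <= x -> mom k x <= mom n x.
Proof.
move=> n0 nk x1; apply: le_Rintegral => //.
- by apply: integr_clip => //; exact: leq_trans nk.
- exact: integr_clip.
- by move=> s _; apply: clipX_le => //; exact: lt_le_trans x1.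
Qed.

Lemma mom_anti n x y : (0 < n)%N -> 1 <= x -> x <= y -> mom n y <= mom n x.
Proof.
move=> n0 x1 xy; have x0 : 0 < x by exact: lt_le_trans x1.
have y0 : 0 < y by exact: lt_le_trans xy.
apply: le_Rintegral => //.
- by apply: integr_clip => //; exact: le_trans xy.
- exact: integr_clip.
- by move=> s _; apply: lerXn2r; rewrite ?nnegrE ?clip_ge0 ?clip_anti.
Qed.

(** Dominated convergence along the integers, with [clip 1] as dominating function, then
    monotonicity in [x]. For [mu] this makes F(z)/z close to 1; for [nu] it is the vanishing factor
    in the error terms. *)
Lemma mom1_cvg0 e : 0 < e -> exists2 X, 1 <= X & forall x, X <= x -> mom 1 x <= e.
Proof.
move=> e0.
have mf n : measurable_fun D (fun s => (clip n.+1%:R s)%:E).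
  by apply/measurable_EFinP; exact: measurable_clip.
have cv s : (clip n.+1%:R s)%:E @[n --> \oo] --> (0 : R)%:E.
  apply: cvg_EFin; first by near=> n.
  apply: (@squeeze_cvgr _ _ _ _ (cst 0) (fun n => `|s| * n.+1%:R^-1)).
  - by apply: nearW => n /=; rewrite clip_ge0 // clip_le.
  - exact: cvg_cst.
  - by rewrite -[X in _ --> X](mulr0 `|s|); apply: cvgM; [exact: cvg_cst|exact: cvg_harmonic].
have fg s n : D s -> (`|(clip n.+1%:R s)%:E| <= (EFin \o clip 1) s)%E.
  move=> _ /=; rewrite lee_fin ger0_norm ?clip_ge0 //.
  by apply: clip_anti; rewrite ?ler1n.
have ae1 : {ae m, forall s, D s ->
    (clip n.+1%:R s)%:E @[n --> \oo] --> (cst 0%E s : \bar R)}.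
  by apply: aeW => s _; exact: cv.
have ae2 : {ae m, forall s n, D s -> (`|(clip n.+1%:R s)%:E| <= (EFin \o clip 1) s)%E}.
  by apply: aeW => s n; exact: fg.
have [_ _] := @dominated_convergence _ _ R m D mD
  (fun n s => (clip n.+1%:R s)%:E) (cst 0%E) (EFin \o clip 1)
  mf (measurable_cst _) ae1 hm ae2.
rewrite integral0 => /fine_cvg /cvgrPdist_le /(_ _ e0) [N _ hN].
exists N.+1%:R; first by rewrite ler1n.
move=> x Nx; apply: (le_trans (mom_anti _ _ Nx)) => //; first by rewrite ler1n.
have := hN N (leqnn N); rewrite /= sub0r normrN; apply: le_trans.
by rewrite (le_trans _ (ler_norm _)) // /mom; under eq_Rintegral do rewrite expr1.
Unshelve. all: by end_near.
Qed.

End Moments.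

(** * Divided differences and their Leibniz rule *)

Section NodeProducts.
Variable F : fieldType.
Implicit Types (z s t : F) (W Z U : seq F) (Psi M l : F -> F).

Definition pfac z s : F := s / (s - z).

(* If [Psi z] is the value of a linear functional at [s / (s - z)], then
   [node_ext Psi Z] is its value at the product of the [s / (s - z)] over the
   distinct nodes [z] of [Z], through
   [(z - z') pfac z pfac z' = z pfac z - z' pfac z']. *)
Fixpoint node_rec Psi W z : F :=
  if W is z' :: W' then
    (z * node_rec Psi W' z - z' * node_rec Psi W' z') / (z - z')
  else Psi z.

Definition node_ext Psi Z : F := if Z is z :: W then node_rec Psi W z else 1.

Lemma node_ext2 Psi z z' W : node_ext Psi (z :: z' :: W) =
  (z * node_ext Psi (z :: W) - z' * node_ext Psi (z' :: W)) / (z - z').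
Proof. by []. Qed.

(** The recursion of [node_rec] drops either of the first two nodes, so an induction step needs both
    shortened lists. *)
Lemma node_ind (P : seq F -> Prop) :
  (forall z, P [:: z]) ->
  (forall z z' W, P (z :: W) -> P (z' :: W) -> P (z :: z' :: W)) ->
  forall z W, P (z :: W).
Proof.
move=> P1 P2 z W; elim: W z => [//|z' W IH] z; exact: P2.
Qed.

Lemma node_ext_pfac s z W : uniq (z :: W) -> s \notin z :: W ->
  node_ext (pfac^~ s) (z :: W) = \prod_(x <- z :: W) pfac x s.
Proof.
move: z W; apply: (@node_ind (fun Z => uniq Z -> s \notin Z ->
  node_ext (pfac^~ s) Z = \prod_(x <- Z) pfac x s)) => [z _ _|z z' W IH1 IH2 uZ sZ].
  by rewrite big_seq1.
rewrite /= !inE !negb_or in uZ sZ.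
case/andP: uZ => /andP[zz' zW] /andP[z'W uW]; case/and3P: sZ => sz sz' sW.
rewrite node_ext2 IH1; last by rewrite !inE negb_or sz.
  rewrite IH2; last by rewrite !inE negb_or sz'.
    rewrite !big_cons /pfac; set P := \prod_(_ <- W) _.
    by field; rewrite !subr_eq0 sz sz' zz'.
  by rewrite /= z'W.
by rewrite /= zW.
Qed.

Lemma node_extD Psi M l z W : {in z :: W, forall y, Psi y = M y + l y} ->
  node_ext Psi (z :: W) = node_ext M (z :: W) + node_ext l (z :: W).
Proof.
move: z W; apply: (@node_ind (fun Z => {in Z, forall y, Psi y = M y + l y} ->
    node_ext Psi Z = node_ext M Z + node_ext l Z)) => [z h|z z' W IH1 IH2 h].
  by rewrite /= h ?mem_head.
rewrite !node_ext2 IH1 ?IH2; first by ring.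
  by move=> y yZ; apply: h; rewrite inE yZ orbT.
by move=> y; rewrite inE => /orP[|] yZ; apply: h; rewrite !inE yZ ?orbT.
Qed.

Section Leibniz.
Variables (t : F) (M l : F -> F).

(* When [l z = 1 - z / (w - t)], [kap [:: z]] is [t / (t - w)], that is
   [pfac z t] with [z] displaced to [w]. *)
Definition kap Z : F :=
  if Z is z :: W then - (t / z) * (node_ext l W - node_ext l (z :: W)) else 1.

(* Correction term of the Leibniz rule for divided differences, after
   summation by parts. *)
Fixpoint corr (a : seq F -> F) Z : F :=
  if Z is z :: W then
    a [:: z] * (kap W - kap (z :: W)) + corr (fun U => a (z :: U)) W
  else 0.

Lemma corr_lin a b c d e W : (forall U, c U = d * a U + e * b U) ->
  corr c W = d * corr a W + e * corr b W.
Proof.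
elim: W a b c => [|z W IH] a b c hc /=; first by rewrite !mulr0 addr0.
rewrite (IH (fun U => a (z :: U)) (fun U => b (z :: U))) ?hc; first by ring.
by move=> U; rewrite hc.
Qed.

(** The hypothesis on [l] reads [l z = kap [:: z] + M z * (1 - kap [:: z])]. Divided differences of
    the product are distributed over prefixes for [M] and suffixes for [kap]. *)
Lemma node_ext_leibniz z W : uniq (z :: W) -> 0 \notin z :: W ->
  (forall x, x \in z :: W -> l x = M x - t / x * (1 - M x) * (1 - l x)) ->
  node_ext l (z :: W) = kap (z :: W) + corr (node_ext M) (z :: W).
Proof.
move: z W; apply: (@node_ind (fun Z => uniq Z -> 0 \notin Z ->
    (forall x, x \in Z -> l x = M x - t / x * (1 - M x) * (1 - l x)) ->
    node_ext l Z = kap Z + corr (node_ext M) Z))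
  => [z _ _ h|z z' W IH1 IH2 uZ nZ h].
  rewrite [kap _]/= [corr _ _]/= [node_ext l [:: z]]/= {1}h ?mem_head //=; ring.
rewrite /= !inE !negb_or !(eq_sym 0) in uZ nZ.
case/andP: uZ => /andP[zz' zW] /andP[z'W uW]; case/and3P: nZ => z0 z'0 nW.
have e1 : node_ext l (z :: W) = kap (z :: W) + corr (node_ext M) (z :: W).
  apply: IH1; rewrite /= ?zW ?inE ?negb_or ?(eq_sym 0) ?z0 //.
  by move=> x xZ; apply: h; move: xZ; rewrite !inE => /orP[->|->]; rewrite ?orbT.
have e2 : node_ext l (z' :: W) = kap (z' :: W) + corr (node_ext M) (z' :: W).
  apply: IH2; rewrite /= ?z'W ?inE ?negb_or ?(eq_sym 0) ?z'0 //.
  by move=> x xZ; apply: h; rewrite inE xZ orbT.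
have e3 : corr (fun U => node_ext M (z :: z' :: U)) W =
    z / (z - z') * corr (fun U => node_ext M (z :: U)) W -
    z' / (z - z') * corr (fun U => node_ext M (z' :: U)) W.
  rewrite -mulNr; apply: corr_lin => U; rewrite node_ext2; field.
  by rewrite subr_eq0.
have e4 : kap (z :: z' :: W) = - (t / z) *
    (node_ext l (z' :: W) - node_ext l (z :: z' :: W)) by [].
have e5 : corr (node_ext M) (z :: z' :: W) =
    M z * (kap (z' :: W) - kap (z :: z' :: W)) +
    ((z * M z - z' * M z') / (z - z') * (kap W - kap (z' :: W)) +
     corr (fun U => node_ext M (z :: z' :: U)) W) by [].
have e6 : corr (node_ext M) (z :: W) =
    M z * (kap W - kap (z :: W)) + corr (fun U => node_ext M (z :: U)) W by [].
have e7 : corr (node_ext M) (z' :: W) =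
    M z' * (kap W - kap (z' :: W)) + corr (fun U => node_ext M (z' :: U)) W by [].
have k1 : kap (z :: W) = - (t / z) * (node_ext l W - node_ext l (z :: W)) by [].
have k2 : kap (z' :: W) = - (t / z') * (node_ext l W - node_ext l (z' :: W)) by [].
rewrite e5 e3 e4 node_ext2.
have c1 : corr (fun U => node_ext M (z :: U)) W =
  node_ext l (z :: W) - kap (z :: W) - M z * (kap W - kap (z :: W)).
  by rewrite e1 e6; ring.
have c2 : corr (fun U => node_ext M (z' :: U)) W =
  node_ext l (z' :: W) - kap (z' :: W) - M z' * (kap W - kap (z' :: W)).
  by rewrite e2 e7; ring.
rewrite c1 c2 k1 k2.
move: (node_ext l _) (node_ext l _) (node_ext l _) (kap W) => a1 a2 a3 k.
by field; rewrite z0 z'0 subr_eq0 zz'.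
Qed.

(** The definition of [kap (z :: W)] involves [node_ext l (z :: W)], which by the Leibniz rule
    contains [kap (z :: W)] itself. Solving this linear equation turns the factor [- (t / z)] into
    [pfac z t]: up to corrections, every node contributes its undisplaced factor. *)
Lemma kap_rec z W : uniq (z :: W) -> 0 \notin z :: W -> t != z ->
  (forall x, x \in z :: W -> l x = M x - t / x * (1 - M x) * (1 - l x)) ->
  kap (z :: W) = pfac z t *
    (kap W + corr (node_ext M) W - corr (node_ext M) (z :: W)).
Proof.
move=> uZ nZ tz h; have e1 := node_ext_leibniz uZ nZ h.
have e2 : node_ext l W = kap W + corr (node_ext M) W.
  case: W uZ nZ h {e1} => [|y W] uZ nZ h; first by rewrite /= addr0.
  apply: node_ext_leibniz; first by case/andP: uZ.
    by move: nZ; rewrite inE negb_or => /andP[].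
  by move=> x xW; apply: h; rewrite inE xW orbT.
have z0 : z != 0 by move: nZ; rewrite inE negb_or eq_sym => /andP[].
rewrite -e2; have -> : corr (node_ext M) (z :: W) =
  node_ext l (z :: W) - kap (z :: W) by rewrite e1 addrAC subrr add0r.
set k := kap (z :: W); have kE : k = - (t / z) * (node_ext l W - node_ext l (z :: W)) by [].
have zk : z * k = - t * (node_ext l W - node_ext l (z :: W)).
  by rewrite kE; field.
have tz0 : t - z != 0 by rewrite subr_eq0.
apply: (mulfI tz0); rewrite mulrBl zk /pfac.
by field.
Qed.

(** Since [kap] is itself a divided difference, it can be exchanged with the integral over [t]. No
    equation for [l] is assumed, so this also covers the drift term, where [t] is [eta] and [l] is
    [pint]. *)
Lemma kap_node_ext z W : uniq (z :: W) -> 0 \notin z :: W ->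
  kap (z :: W) = node_ext (fun y => kap [:: y]) (z :: W).
Proof.
move: z W; apply: (@node_ind (fun Z => uniq Z -> 0 \notin Z ->
    kap Z = node_ext (fun y => kap [:: y]) Z)) => [//|z z' W IH1 IH2 uZ nZ].
rewrite /= !inE !negb_or !(eq_sym 0) in uZ nZ.
case/andP: uZ => /andP[zz' zW] /andP[z'W uW]; case/and3P: nZ => z0 z'0 nW.
rewrite node_ext2 -IH1 -?IH2; last 4 first.
- by rewrite /= z'W.
- by rewrite inE negb_or eq_sym z'0.
- by rewrite /= zW.
- by rewrite inE negb_or eq_sym z0.
have -> : kap (z :: z' :: W) = - (t / z) *
    (node_ext l (z' :: W) - node_ext l (z :: z' :: W)) by [].
rewrite node_ext2.
have -> : kap (z :: W) = - (t / z) * (node_ext l W - node_ext l (z :: W)) by [].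
have -> : kap (z' :: W) = - (t / z') * (node_ext l W - node_ext l (z' :: W)) by [].
move: (node_ext l _) (node_ext l _) (node_ext l _) => a1 a2 a3.
by field; rewrite z0 z'0 subr_eq0 zz'.
Qed.

End Leibniz.
End NodeProducts.

(** * Estimates of the displaced products, uniform in the scale and in [t] *)

Section KappaEstimates.
Variable R : realType.
Implicit Types (a b c e zeta : R) (n j k K : nat) (mm : nat -> R).
Implicit Types (M l : R[i] -> R[i]) (ad : pred R[i]) (t z : R[i]) (Z W : seq R[i]).

(** If [zeta * a <= b], the powers of [a] become powers of [b] at the cost of [zeta ^- j]; otherwise
    a single factor [b < zeta * a] already yields the small constant, whence [0 < k]. *)
Lemma young_pt a b zeta k j K : 0 <= a <= 1 -> 0 <= b <= 1 -> 0 < zeta <= 1 ->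
  (0 < k)%N -> (K <= k + j)%N ->
  b ^+ k * a ^+ j <= zeta ^- j * b ^+ K + zeta * a ^+ K.
Proof.
move=> /andP[a0 a1] /andP[b0 b1] /andP[z0 z1] k0 Kkj.
have [ab|ba] := leP (zeta * a) b.
  apply: ler_wpDr; first by rewrite mulr_ge0 ?exprn_ge0 // ?(ltW z0).
  apply: (@le_trans _ _ (zeta ^- j * b ^+ (k + j))).
    rewrite exprD mulrCA ler_wpM2l ?exprn_ge0 // mulrC ler_pdivlMr ?exprn_gt0 //.
    by rewrite mulrC -exprMn lerXn2r ?nnegrE // mulr_ge0 // ?(ltW z0).
  by rewrite ler_wpM2l ?invr_ge0 ?exprn_ge0 ?(ltW z0) // ler_wiXn2l.
apply: ler_wpDl; first by rewrite mulr_ge0 ?invr_ge0 ?exprn_ge0 // ?(ltW z0).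
apply: (@le_trans _ _ (zeta * a ^+ (k + j))).
  rewrite exprD mulrA ler_wpM2r ?exprn_ge0 //.
  apply: (@le_trans _ _ ((zeta * a) ^+ k)).
    by rewrite lerXn2r ?nnegrE ?mulr_ge0 ?(ltW z0) ?(ltW ba).
  by rewrite exprMn ler_wpM2r ?exprn_ge0 // -[leRHS]expr1 ler_wiXn2l // ?(ltW z0).
by rewrite ler_wpM2l ?(ltW z0) // ler_wiXn2l.
Qed.

(* [mm n] stands for the n-th clipped moment of mu, and [a] for the clipped
   value of [t]. *)
Record kappa_setting mm a t M l ad : Prop := KappaSetting {
  ks_a : 0 <= a <= 1;
  ks_mm0 : mm 0 = 1;
  ks_mm_ge0 : forall n, 0 <= mm n;
  ks_mm_anti : forall n k, (n <= k)%N -> mm k <= mm n;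
  ks_young : forall zeta k j K, 0 < zeta <= 1 -> (0 < k)%N -> (K <= k + j)%N ->
    mm k * a ^+ j <= zeta ^- j * mm K + zeta * a ^+ K;
  ks_mmM : forall k j, mm k * mm j <= 2 * mm (k + j)%N;
  ks_M : forall Z, uniq Z -> all ad Z ->
    cmod (node_ext M Z) <= 2 ^+ size Z * mm (size Z);
  ks_pfac : forall z, ad z -> cmod (pfac z t) <= 2 * a;
  ks_l : forall z, ad z ->
    [/\ 0 != z, t != z & l z = M z - t / z * (1 - M z) * (1 - l z)] }.

(** The expected size of [kap] on [n] nodes: that of the product, plus that of the corrections. The
    latter retain one factor [a], which makes them integrable even against a Levy measure of
    infinite mass. *)
Definition kbound mm a n := a ^+ n + (if n is n'.+1 then a * mm n' else 0).

Section Setting.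
Variables (mm : nat -> R) (a : R) (t : R[i]) (M l : R[i] -> R[i]).
Variable ad : pred R[i].
Hypothesis ks : kappa_setting mm a t M l ad.

Let a0 : 0 <= a. Proof. by case/andP: (ks_a ks). Qed.
Let a1 : a <= 1. Proof. by case/andP: (ks_a ks). Qed.

Lemma kbound_ge0 n : 0 <= kbound mm a n.
Proof.
rewrite addr_ge0 ?exprn_ge0 //; case: n => // n.
by rewrite mulr_ge0 // (ks_mm_ge0 ks).
Qed.

Lemma mm_kbound zeta k j K : 0 < zeta <= 1 -> (0 < k)%N -> (K <= k + j)%N ->
  mm k * kbound mm a j <= 3 * zeta ^- j.+1 * mm K + 3 * zeta * a ^+ K.
Proof.
move=> hz k0 Kkj; have /andP[z0 z1] := hz.
have zV i : 1 <= zeta ^- i by rewrite invf_ge1 ?exprn_gt0 // exprn_ile1 ?(ltW z0).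
have mK := ks_mm_ge0 ks K; have aK : 0 <= zeta * a ^+ K.
  by rewrite mulr_ge0 ?exprn_ge0 ?(ltW z0).
have h1 : mm k * a ^+ j <= zeta ^- j.+1 * mm K + zeta * a ^+ K.
  apply: (le_trans (ks_young ks hz k0 Kkj)); rewrite lerD2r ler_wpM2r //.
  by rewrite lef_pV2 ?posrE ?exprn_gt0 // ler_wiXn2l // ?(ltW z0).
have hzm : 0 <= zeta ^- j.+1 * mm K by rewrite mulr_ge0 // (le_trans ler01).
rewrite /kbound mulrDr; case: j Kkj h1 hzm => [|j] Kkj h1 hzm.
  by rewrite mulr0 addr0; lra.
have h2 : mm k * (a * mm j) <= 2 * (zeta ^- j.+2 * mm K + zeta * a ^+ K).
  rewrite mulrCA mulrC; apply: (@le_trans _ _ (2 * mm (k + j)%N * a)).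
    by rewrite ler_wpM2r // (ks_mmM ks).
  rewrite -mulrA ler_wpM2l // -{1}(expr1 a).
  have kj0 : (0 < k + j)%N by rewrite addn_gt0 k0.
  have Kkj1 : (K <= k + j + 1)%N by rewrite addn1 -addnS.
  apply: (le_trans (ks_young ks hz kj0 Kkj1)).
  by rewrite lerD2r ler_wpM2r // lef_pV2 ?posrE ?exprn_gt0 // ler_wiXn2l // ltW.
by lra.
Qed.

Lemma corr_le c (aa : seq R[i] -> R[i]) Z :
  (forall k, (k < size Z)%N -> cmod (aa (take k.+1 Z)) *
    (cmod (kap t l (drop k.+1 Z)) + cmod (kap t l (drop k Z))) <= c) ->
  cmod (corr t l aa Z) <= (size Z)%:R * c.
Proof.
elim: Z aa => [|z W IH] aa h; first by rewrite /= mul0r cmod0.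
rewrite [corr _ _ _ _]/= -natr1 mulrDl mul1r addrC.
apply: (le_trans (cmodD _ _)); apply: lerD; last first.
  apply: (le_trans (cmodM _ _)); apply: le_trans (h 0%N _) => //=.
  by rewrite take0 drop0; apply: ler_wpM2l; [exact: cmod_ge0|exact: cmodB].
by apply: IH => k kW; have := h k.+1 kW.
Qed.

Lemma corr_kbound zeta G C K (aa : seq R[i] -> R[i]) Z : 0 < zeta <= 1 ->
  0 <= G -> 0 <= C -> (K <= size Z)%N ->
  (forall k, (k < size Z)%N -> cmod (aa (take k.+1 Z)) <= G * mm k.+1) ->
  (forall k, (k <= size Z)%N ->
     cmod (kap t l (drop k Z)) <= C * kbound mm a (size Z - k)) ->
  cmod (corr t l aa Z) <= (size Z)%:R *
    (6 * G * C * (zeta ^- (size Z).+1 * mm K + zeta * a ^+ K)).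
Proof.
move=> hz G0 C0 KZ hG hC; have /andP[z0 z1] := hz; apply: corr_le => k kZ.
have mono j : (j <= size Z)%N -> (K <= k.+1 + j)%N -> mm k.+1 * kbound mm a j <=
    3 * (zeta ^- (size Z).+1 * mm K + zeta * a ^+ K).
  move=> jZ Kj; apply: (le_trans (mm_kbound hz _ Kj)) => //.
  rewrite mulrDr !mulrA lerD2r ler_wpM2r ?(ks_mm_ge0 ks) // ler_wpM2l //.
  by rewrite lef_pV2 ?posrE ?exprn_gt0 // ler_wiXn2l // ?(ltW z0).
apply: (@le_trans _ _ (G * mm k.+1 * (C * kbound mm a (size Z - k.+1) +
    C * kbound mm a (size Z - k)))).
  apply: ler_pM; rewrite ?addr_ge0 ?cmod_ge0 ?hG //.
  by apply: lerD; apply: hC => //; exact: ltnW.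
have := mono (size Z - k.+1)%N (leq_subr _ _).
rewrite subnKC // => /(_ KZ) h1.
have := mono (size Z - k)%N (leq_subr _ _).
rewrite addSn subnKC ?(ltnW kZ) // => /(_ (leqW KZ)) h2.
set q := zeta ^- _ * _ + _ in h1 h2 *.
have -> : 6 * G * C * q = G * C * (3 * q + 3 * q) by ring.
rewrite -mulrDr mulrACA -!mulrA ler_wpM2l // ler_wpM2l // mulrDr.
exact: lerD.
Qed.

Hypothesis mm1 : mm 1 <= 8^-1.

Lemma kap_setting z W : uniq (z :: W) -> all ad (z :: W) ->
  kap t l (z :: W) = pfac z t *
    (kap t l W + corr t l (node_ext M) W - corr t l (node_ext M) (z :: W)).
Proof.
move=> uZ aZ; have aP := allP aZ; apply: kap_rec => //.
- apply/negP => /aP /(ks_l ks)[]; by rewrite eqxx.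
- by have [] := ks_l ks (aP z (mem_head _ _)).
- by move=> x /aP /(ks_l ks)[].
Qed.

(** The correction on [z :: W] contains the unknown again, as [M z * kap (z :: W)]. As
    [mm 1 <= 8^-1], its coefficient [pfac z t * M z] has modulus at most 1/2, and the term is
    absorbed on the left. *)
Lemma kap_step c z W : uniq (z :: W) -> all ad (z :: W) ->
  cmod (kap t l W) <= c -> cmod (corr t l (node_ext M) W) <= c ->
  cmod (corr t l (fun U => node_ext M (z :: U)) W) <= c ->
  cmod (kap t l (z :: W)) <= 16 * a * c.
Proof.
move: (a1) (mm1) => a1' mm1' uZ aZ h1 h2 h3; have az : ad z by case/andP: aZ.
have hp := ks_pfac ks az; have := kap_setting uZ aZ.
have hM : cmod (M z) <= 2 * mm 1.
  by have := ks_M ks (Z := [:: z]) isT; rewrite /= az expr1; apply.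
set k := kap t l (z :: W) => kE.
have c0 : 0 <= c by apply: le_trans h1; exact: cmod_ge0.
have {}kE : k = pfac z t * (kap t l W + corr t l (node_ext M) W -
    M z * kap t l W - corr t l (fun U => node_ext M (z :: U)) W) +
    pfac z t * (M z * k).
  have e : corr t l (node_ext M) (z :: W) = M z * (kap t l W - k) +
    corr t l (fun U => node_ext M (z :: U)) W by [].
  by rewrite {1}kE e; ring.
have m0 := ks_mm_ge0 ks 1.
have M4 : cmod (M z) <= 4^-1.
  by apply: (le_trans hM); lra.
have e1 : cmod (pfac z t * (M z * k)) <= 2^-1 * cmod k.
  apply: (le_trans (cmodM _ _)).
  have -> : 2^-1 * cmod k = 2 * (4^-1 * cmod k) by field.
  apply: ler_pM; rewrite ?cmod_ge0 //; first by apply: (le_trans hp); lra.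
  apply: (le_trans (cmodM _ _)); apply: ler_wpM2r => //; exact: cmod_ge0.
have e2 : cmod (pfac z t * (kap t l W + corr t l (node_ext M) W -
    M z * kap t l W - corr t l (fun U => node_ext M (z :: U)) W)) <= 2 * a * (4 * c).
  apply: (le_trans (cmodM _ _)); apply: ler_pM; rewrite ?cmod_ge0 //.
  apply: (le_trans (cmodB _ _)).
  have -> : 4 * c = c + c + c + c by ring.
  apply: lerD => //; apply: (le_trans (cmodB _ _)); apply: lerD.
    by apply: (le_trans (cmodD _ _)); apply: lerD.
  apply: (le_trans (cmodM _ _)); apply: (@le_trans _ _ (1 * c)); last by rewrite mul1r.
  by apply: ler_pM; rewrite ?cmod_ge0 //; lra.
have e3 : cmod k <= 2 * a * (4 * c) + 2^-1 * cmod k.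
  by rewrite {1}kE; apply: (le_trans (cmodD _ _)); apply: lerD.
have -> : 16 * a * c = 2 * (2 * a * (4 * c)) by ring.
by lra.
Qed.

End Setting.

Lemma kbound_le mm a t M l ad n : kappa_setting mm a t M l ad ->
  kbound mm a n <= 2 * (mm n + a ^+ n).
Proof.
move=> ks; have /andP[a0 a1] := ks_a ks; have m0 := ks_mm_ge0 ks n.
have an : 0 <= a ^+ n by rewrite exprn_ge0.
case: n => [|n] in m0 an *; rewrite /kbound.
  by rewrite (ks_mm0 ks) expr0; lra.
case: n => [|n] in m0 an *; first by rewrite (ks_mm0 ks) expr1 mulr1; lra.
have := @ks_young _ _ _ _ _ _ ks 1 n.+1 1 n.+2; rewrite !expr1n invr1 expr1 !mul1r.
by rewrite ltr01 lexx addn1 => /(_ isT isT (leqnn _)); rewrite mulrC; lra.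
Qed.

Lemma ks_M_take mm a t M l ad k n Z : kappa_setting mm a t M l ad ->
  uniq Z -> all ad Z -> (k <= size Z)%N -> (size Z <= n)%N ->
  cmod (node_ext M (take k Z)) <= 2 ^+ n * mm k.
Proof.
move=> ks uZ aZ kZ Zn; apply: (le_trans (ks_M ks (take_uniq _ uZ) _)).
  by apply/allP => x /mem_take /(allP aZ).
rewrite size_takel //; apply: ler_wpM2r; first exact: ks_mm_ge0 ks _.
by rewrite ler_weXn2l ?ler1n // (leq_trans kZ).
Qed.

(** Induction on the number of nodes: [kap_step] gains a factor [a] and leaves only values of [kap]
    at suffixes of [W]. The constant depends on [n] alone, so it serves all [x] and [t] at once. *)
Lemma kap_le n : exists2 C, 1 <= C & forall mm a t M l ad,
  kappa_setting mm a t M l ad -> mm 1 <= 8^-1 ->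
  forall Z, uniq Z -> all ad Z -> (size Z <= n)%N ->
  cmod (kap t l Z) <= C * kbound mm a (size Z).
Proof.
elim: n => [|n [C C1 hC]].
  exists 1 => // mm a t M l ad ks m1 [|//] _ _ _ /=.
  by rewrite /kbound expr0 addr0 mulr1 cmod1.
have C0 : 0 <= C by apply: le_trans C1.
(* [2 * C] pays for [kap W] through [kbound_le]; the other summand pays for each of the two [corr]
   terms, with parameter 1 in Young's inequality. *)
pose C2 := 2 * C + n%:R * (6 * 2 ^+ n.+1 * C).
have C2C : C <= C2.
  have : 0 <= n%:R * (6 * 2 ^+ n.+1 * C) by rewrite !mulr_ge0 ?exprn_ge0.
  by rewrite /C2; lra.
exists (16 * C2) => [|mm a t M l ad ks m1 Z uZ aZ]; first by lra.
rewrite leq_eqVlt => /orP[/eqP sZ|]; last first.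
  rewrite ltnS => /(hC _ _ _ _ _ _ ks m1 _ uZ aZ) /le_trans; apply.
  by apply: ler_wpM2r; [exact: kbound_ge0 ks _|lra].
case: Z sZ uZ aZ => [//|z W] [sW] uZ aZ.
have uW : uniq W by case/andP: uZ.
have aW : all ad W by case/andP: aZ.
have /andP[a0 a1] := ks_a ks; have m0 := ks_mm_ge0 ks n.
have an : 0 <= a ^+ n by rewrite exprn_ge0.
have -> : 16 * C2 * kbound mm a (size (z :: W)) =
    16 * a * (C2 * (mm n + a ^+ n)) by rewrite /= sW /kbound exprS; ring.
have kd k : (k <= size W)%N ->
    cmod (kap t l (drop k W)) <= C * kbound mm a (size W - k).
  move=> kW; rewrite -size_drop; apply: (hC _ _ _ _ _ _ ks m1).
  - exact: drop_uniq.
  - by apply/allP => x /mem_drop /(allP aW).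
  - by rewrite size_drop sW leq_subr.
have G0 : 0 <= 2 ^+ n.+1 :> R by rewrite exprn_ge0.
have one : 0 < (1 : R) <= 1 by rewrite ltr01 lexx.
have last c : c <= n%:R * (6 * 2 ^+ n.+1 * C * (1 ^- n.+1 * mm n + 1 * a ^+ n)) ->
    c <= C2 * (mm n + a ^+ n).
  move=> /le_trans; apply; rewrite expr1n invr1 !mul1r /C2 mulrDl.
  have h : 0 <= 2 * C * (mm n + a ^+ n) by rewrite mulr_ge0 ?addr_ge0 ?mulr_ge0.
  by rewrite -subr_ge0 (le_trans h) // le_eqVlt; apply/orP; left; apply/eqP; ring.
apply: (kap_step ks m1) => //.
- apply: (le_trans (hC _ _ _ _ _ _ ks m1 _ uW aW _)); first by rewrite sW.
  rewrite sW; apply: (@le_trans _ _ (C * (2 * (mm n + a ^+ n)))).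
    by rewrite ler_wpM2l // (kbound_le _ ks).
  rewrite mulrA ler_wpM2r ?addr_ge0 // /C2 mulrC lerDl.
  by rewrite !mulr_ge0 ?exprn_ge0.
- apply: last; rewrite -{1 3}sW.
  apply: (corr_kbound (K := n) ks one G0 C0 _ _ kd) => [|k kW]; first by rewrite sW.
  by apply: (ks_M_take ks) => //; rewrite sW.
- apply: last; rewrite -{1 3}sW.
  apply: (corr_kbound (K := n) ks one G0 C0 _ _ kd) => [|k kW]; first by rewrite sW.
  apply: (@le_trans _ _ (2 ^+ n.+1 * mm k.+2)).
    by apply: (ks_M_take ks (k := k.+2) uZ) => //=; rewrite sW.
  by rewrite ler_wpM2l // (ks_mm_anti ks).
Qed.

(** The parameter of Young's inequality is now taken small in terms of [zeta]: the moment gets a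
    large constant, the power of [a] an arbitrarily small one. *)
Lemma corr_small n zeta : 0 < zeta -> exists2 C, 0 <= C & forall mm a t M l ad,
  kappa_setting mm a t M l ad -> mm 1 <= 8^-1 ->
  forall Z K, uniq Z -> all ad Z -> (K <= size Z <= n)%N ->
  cmod (corr t l (node_ext M) Z) <= C * mm K + zeta * a ^+ K.
Proof.
move=> z0; have [C C1 hC] := kap_le n; have C0 : 0 <= C by apply: le_trans C1.
pose B := n%:R * (6 * 2 ^+ n * C) + 1.
have B0 : 0 <= n%:R * (6 * 2 ^+ n * C) by rewrite !mulr_ge0 ?exprn_ge0.
have Bp : 0 < B by rewrite /B; lra.
pose zt := Num.min 1 (zeta / B).
have zt0 : 0 < zt by rewrite lt_min ltr01 divr_gt0.
have zt1 : 0 < zt <= 1 by rewrite zt0 ge_min lexx.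
exists (B * zt ^- n.+1); first by rewrite mulr_ge0 ?invr_ge0 ?exprn_ge0 // ltW.
move=> mm a t M l ad ks m1 Z K uZ aZ /andP[KZ Zn].
have /andP[a0 a1] := ks_a ks; have m0 := ks_mm_ge0 ks K.
have aK : 0 <= a ^+ K by rewrite exprn_ge0.
have hG k : (k < size Z)%N -> cmod (node_ext M (take k.+1 Z)) <= 2 ^+ n * mm k.+1.
  by move=> kZ; apply: (ks_M_take ks).
have kd k : (k <= size Z)%N ->
    cmod (kap t l (drop k Z)) <= C * kbound mm a (size Z - k).
  move=> kZ; rewrite -size_drop; apply: (hC _ _ _ _ _ _ ks m1).
  - exact: drop_uniq.
  - by apply/allP => x /mem_drop /(allP aZ).
  - by rewrite size_drop (leq_trans (leq_subr _ _)).
have G0 : 0 <= 2 ^+ n :> R by rewrite exprn_ge0.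
apply: (le_trans (corr_kbound ks zt1 G0 C0 KZ hG kd)).
apply: (@le_trans _ _ (B * (zt ^- n.+1 * mm K + zt * a ^+ K))).
  rewrite mulrA; apply: ler_pM.
  - by rewrite !mulr_ge0.
  - by rewrite addr_ge0 // mulr_ge0 // ?invr_ge0 ?exprn_ge0 // ltW.
  - apply: (@le_trans _ _ (n%:R * (6 * 2 ^+ n * C))); last by rewrite /B; lra.
    by rewrite ler_wpM2r ?mulr_ge0 // ler_nat.
  - rewrite lerD2r ler_wpM2r // lef_pV2 ?posrE ?exprn_gt0 //.
    by rewrite ler_wiXn2l ?(ltW zt0) //; case/andP: zt1.
have h : zt * B <= zeta by rewrite -ler_pdivlMr // ge_min lexx orbT.
have -> : B * (zt ^- n.+1 * mm K + zt * a ^+ K) =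
  B * zt ^- n.+1 * mm K + zt * B * a ^+ K by ring.
by rewrite lerD2l ler_wpM2r.
Qed.

(** Induction through [kap_rec]. For a single node the moment [mm 0 = 1] would give an error that is
    not small, so there the error must be [zeta * a] alone; this is what requires [mm 1 <= d] with
    [d] depending on [zeta]. *)
Lemma kap_pfac n zeta : 0 < zeta -> exists C d, [/\ 0 <= C, 0 < d <= 8^-1 &
  forall mm a t M l ad, kappa_setting mm a t M l ad -> mm 1 <= d ->
  forall Z, uniq Z -> all ad Z -> size Z = n.+1 ->
  cmod (kap t l Z - \prod_(z <- Z) pfac z t) <=
    C * a * (if n is 0 then 0 else mm n) + zeta * a ^+ n.+1].
Proof.
elim: n zeta => [|n IH] zeta z0.
  have [C C1 hC] := kap_le 1.
  (* [1 + 2 * C] bounds [1 - kap t l [:: z]], and 4 is the product of the constants in the bounds of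
     [pfac z t] and [M z]. *)
  pose d := Num.min 8^-1 (zeta / (4 * (1 + 2 * C))).
  exists 0, d; split => //.
    rewrite ge_min lexx andbT lt_min divr_gt0 ?mulr_gt0 //; last by lra.
    by rewrite andbT invr_gt0.
  move=> mm a t M l ad ks m1 [//|z [|//]] uZ aZ _; rewrite mulr0 add0r big_seq1 expr1.
  have m8 : mm 1 <= 8^-1 by apply: le_trans m1 _; rewrite ge_min lexx.
  have /andP[a0 a1] := ks_a ks; have m0 := ks_mm_ge0 ks 1.
  have az : ad z by case/andP: aZ.
  rewrite (kap_setting ks uZ aZ).
  have -> : pfac z t * (kap t l [::] + corr t l (node_ext M) [::] -
    corr t l (node_ext M) [:: z]) - pfac z t = - (pfac z t * (M z * (1 - kap t l [:: z]))).
    rewrite /=; ring.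
  have hk := hC _ _ _ _ _ _ ks m8 [:: z] uZ aZ isT.
  have hM : cmod (M z) <= 2 * mm 1.
    by have := ks_M ks (Z := [:: z]) isT; rewrite /= az expr1; apply.
  rewrite cmodN; apply: (le_trans (cmodM _ _)).
  apply: (@le_trans _ _ (2 * a * (2 * mm 1 * (1 + 2 * C)))).
    apply: ler_pM; rewrite ?cmod_ge0 ?(ks_pfac ks) //.
    apply: (le_trans (cmodM _ _)); apply: ler_pM; rewrite ?cmod_ge0 //.
    apply: (le_trans (cmodB _ _)); rewrite cmod1 lerD2l (le_trans hk) //.
    rewrite mulrC ler_wpM2r //; first by lra.
    by rewrite /kbound /= (ks_mm0 ks) expr1; lra.
  have : mm 1 * (4 * (1 + 2 * C)) <= zeta.
    rewrite -ler_pdivlMr; last by lra.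
    by apply: le_trans m1 _; rewrite ge_min lexx orbT.
  move=> /(ler_wpM2r a0); apply: le_trans; rewrite le_eqVlt; apply/orP; left.
  by apply/eqP; ring.
(* The coefficients of [a ^+ n.+1] add up to at most [5 * z1], and the outer [pfac z t] brings a
   factor 2. *)
pose z1 := zeta / 10; have z10 : 0 < z1 by rewrite divr_gt0.
have [C1 [d [C10 /andP[d0 d8] h1]]] := IH _ z10.
have [C2 C20 h2] := corr_small n.+2 z10.
pose z2 := Num.min 1 (z1 / (C1 + 1)).
have z20 : 0 < z2 by rewrite lt_min ltr01 divr_gt0 //; lra.
have z21 : 0 < z2 <= 1 by rewrite z20 ge_min lexx.
have C1z2 : C1 * z2 <= z1.
  apply: (@le_trans _ _ ((C1 + 1) * z2)); first by rewrite ler_wpM2r ?(ltW z20) //; lra.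
  rewrite mulrC -ler_pdivlMr; last by lra.
  by rewrite ge_min lexx orbT.
exists (2 * (C1 * z2 ^- 1 + C2 + C2)), d; split; last 1 first.
- move=> mm a t M l ad ks m1 [//|z W] uZ aZ [sW].
  have m8 : mm 1 <= 8^-1 by apply: le_trans m1 _.
  have uW : uniq W by case/andP: uZ.
  have aW : all ad W by case/andP: aZ.
  have az : ad z by case/andP: aZ.
  have /andP[a0 a1] := ks_a ks; have m0 := ks_mm_ge0 ks n.+1.
  have an : 0 <= a ^+ n.+1 by rewrite exprn_ge0.
  rewrite big_cons (kap_setting ks uZ aZ) -mulrBr addrAC (addrAC (kap _ _ _)).
  apply: (le_trans (cmodM _ _)).
  have e1 : cmod (kap t l W - \prod_(z <- W) pfac z t) <=
      C1 * z2 ^- 1 * mm n.+1 + 2 * z1 * a ^+ n.+1.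
    apply: (le_trans (h1 _ _ _ _ _ _ ks m1 W uW aW sW)).
    have -> : 2 * z1 * a ^+ n.+1 = z1 * a ^+ n.+1 + z1 * a ^+ n.+1 by ring.
    rewrite addrA lerD2r; case: n sW m0 an {IH h1 h2} => [|n] sW m0 an.
      rewrite mulr0; apply: addr_ge0; apply: mulr_ge0 => //; last exact: ltW.
      by apply: mulr_ge0 => //; rewrite invr_ge0 exprn_ge0 // ltW.
    (* The factor [a] in the inductive error is spent on raising the order of the moment by one. *)
    have := ks_young ks (K := n.+2) (k := n.+1) (j := 1) z21 isT.
    rewrite addn1 => /(_ (leqnn _)) /(ler_wpM2l C10) h.
    have -> : C1 * a * mm n.+1 = C1 * (mm n.+1 * a ^+ 1) by rewrite expr1; ring.
    apply: (le_trans h); rewrite mulrDr (mulrA C1) lerD2l (mulrA C1).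
    exact: (ler_wpM2r an C1z2).
  have e2 := h2 _ _ _ _ _ _ ks m8 W n.+1 uW aW.
  rewrite sW leqnn leqnSn in e2; have {}e2 := e2 isT.
  have e3 := h2 _ _ _ _ _ _ ks m8 (z :: W) n.+1 uZ aZ.
  rewrite [size _]/= sW leqnn leqnSn in e3; have {}e3 := e3 isT.
  apply: (@le_trans _ _ (2 * a * ((C1 * z2 ^- 1 + C2 + C2) * mm n.+1 + 5 * z1 * a ^+ n.+1))).
    apply: ler_pM; rewrite ?cmod_ge0 ?(ks_pfac ks) //.
    apply: (le_trans (cmodB _ _)); apply: (@le_trans _ _ (
      (C1 * z2 ^- 1 * mm n.+1 + 2 * z1 * a ^+ n.+1) + (C2 * mm n.+1 + z1 * a ^+ n.+1)
      + (C2 * mm n.+1 + z1 * a ^+ n.+1))).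
      by apply: lerD => //; apply: (le_trans (cmodD _ _)); apply: lerD.
    have h0 : 0 <= z1 * a ^+ n.+1 by rewrite mulr_ge0 // ltW.
    lra.
  set q := C1 * _ + _ + _; rewrite le_eqVlt; apply/orP; left; apply/eqP.
  by rewrite (exprS a n.+1) /z1; field.
- by rewrite !mulr_ge0 // !addr_ge0 // mulr_ge0 // invr_ge0 exprn_ge0 // ltW.
- by rewrite d0.
Qed.

End KappaEstimates.

(** * Nodes on the imaginary axis and integrals of products over them *)

Section ImaginaryNodes.
Variable R : realType.
Implicit Types (x s y : R) (z : R[i]) (Z W : seq R[i]).

Definition node x z : bool :=
  (complex.Re z == 0) && (x <= `|complex.Im z| <= 2 * x).

Lemma node_neq0 x z : 0 < x -> node x z -> complex.Im z != 0.
Proof.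
move=> x0 /andP[_ /andP[h _]]; rewrite -normr_gt0; exact: lt_le_trans h.
Qed.

Lemma real_neq_node x z s : 0 < x -> node x z -> s%:C != z.
Proof.
move=> x0 /(node_neq0 x0) h; apply/eqP => e; move: h; rewrite -e /=.
by rewrite eqxx.
Qed.

Lemma cmod_node_inv x z : 0 < x -> node x z -> cmod z^-1 <= x^-1.
Proof.
move=> x0 nz; have := node_neq0 x0 nz; case/andP: nz => /eqP.
case: z => a y /= -> /andP[xy _] y0.
have z0 : (0 +i* y) != 0 by rewrite eq_complex /= negb_and y0 orbT.
have -> : (0 +i* y)^-1 = 0 -i* y^-1.
  by apply: (mulIf z0); rewrite mulVf //; apply: complex_ext => /=; field.
rewrite /cmod /= normr0 add0r normrN normfV lef_pV2 ?posrE //.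
exact: lt_le_trans xy.
Qed.

Lemma pfacE z s : complex.Re z = 0 -> complex.Im z != 0 ->
  pfac z s%:C = (s ^+ 2 / (s ^+ 2 + complex.Im z ^+ 2)) +i*
                (s * complex.Im z / (s ^+ 2 + complex.Im z ^+ 2)).
Proof.
case: z => a y /= -> y0.
have d0 : s ^+ 2 + y ^+ 2 != 0.
  by rewrite paddr_eq0 ?sqr_ge0 // !expf_eq0 /= negb_and y0 orbT.
have n0 : s%:C - (0 +i* y) != 0.
  by rewrite eq_complex /= negb_and sub0r oppr_eq0 y0 orbT.
apply: (mulIf n0); rewrite /pfac divfK //; apply: complex_ext.
  by rewrite cReM /=; field.
by rewrite cImM /=; field.
Qed.

Lemma cmod_pfac x z s : 0 < x -> node x z -> cmod (pfac z s%:C) <= 2 * clip x s.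
Proof.
move=> x0 nz; have y0 := node_neq0 x0 nz; move: nz => /andP[/eqP rz /andP[h _]].
rewrite pfacE // /cmod /=; set y := complex.Im z in h y0 *.
have d0 : 0 < s ^+ 2 + y ^+ 2.
  by rewrite ltr_wpDl ?sqr_ge0 // lt_def sqrf_eq0 y0 sqr_ge0.
have hs : `|s| ^+ 2 = s ^+ 2 by rewrite real_normK ?num_real.
have hy : `|y| ^+ 2 = y ^+ 2 by rewrite real_normK ?num_real.
have -> : `|s ^+ 2 / (s ^+ 2 + y ^+ 2)| = `|s| ^+ 2 / (`|s| ^+ 2 + `|y| ^+ 2).
  by rewrite hs hy ger0_norm // divr_ge0 ?sqr_ge0 // ltW.
have -> : `|s * y / (s ^+ 2 + y ^+ 2)| = `|s| * `|y| / (`|s| ^+ 2 + `|y| ^+ 2).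
  by rewrite hs hy normrM normfV (gtr0_norm d0) normrM.
have s0 := normr_ge0 s; rewrite -hs -hy in d0.
set a := `|s| in s0 d0 *; set b := `|y| in h d0 *.
have sq := sqr_ge0 (a - b); rewrite sqrrB in sq.
have -> : 2 * clip x s = clip x s + clip x s by ring.
apply: lerD; rewrite le_min -/a; apply/andP; split.
- by rewrite ler_pdivrMr // mul1r lerDl sqr_ge0.
- rewrite ler_pdivrMr // mulrAC ler_pdivlMr // expr2 -mulrA ler_wpM2l //.
  by nra.
- by rewrite ler_pdivrMr // mul1r; nra.
- rewrite ler_pdivrMr // mulrAC ler_pdivlMr // -mulrA ler_wpM2l //.
  by nra.
Qed.

Definition pfac_at s z : R[i] := pfac z s%:C.

Section Integrals.
Variables (m : {measure set (measurableTypeR R) -> \bar R}) (D : set R).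
Hypothesis mD : measurable (D : set (measurableTypeR R)).
Hypothesis hm : integr m D (clip 1).

Lemma measurable_quad_inv (y : R) : y != 0 ->
  measurable_fun D (fun s : R => (s ^+ 2 + y ^+ 2)^-1).
Proof.
move=> y0; apply: measurable_funTS; apply: continuous_measurable_fun => s.
apply: cvgV.
  by rewrite paddr_eq0 ?sqr_ge0 // !expf_eq0 /= negb_and y0 orbT.
by apply: cvgD; [exact: exprn_continuous|exact: cvg_cst].
Qed.

Lemma cmeas_pfac z : complex.Re z = 0 -> complex.Im z != 0 ->
  cmeas D (fun s => pfac z s%:C).
Proof.
move=> rz iz; split; under eq_fun do rewrite pfacE //=.
  apply: measurable_funM; last exact: measurable_quad_inv.
  exact: measurable_funX.
apply: measurable_funM; last exact: measurable_quad_inv.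
exact: measurable_funM.
Qed.

Definition pint z : R[i] := cintegral m D (fun s => pfac z s%:C).

Lemma cintegr_pfac x z : 1 <= x -> node x z -> cintegr m D (fun s => pfac z s%:C).
Proof.
move=> x1 nz; have x0 : 0 < x by exact: lt_le_trans x1.
apply: (@cintegr_le _ _ _ mD _ (fun s => 2 * clip x s)).
- by apply: cmeas_pfac; [case/andP: nz => /eqP|exact: node_neq0 nz].
- have := integrZ mD 2 (integr_clip mD hm (isT : (0 < 1)%N) x1).
  by apply: (eq_integr mD) => s _; rewrite expr1.
- by move=> s _; exact: cmod_pfac.
Qed.

Lemma node_ext_cintegral (f : R -> R[i] -> R[i]) (q : pred R[i]) z W :
  (forall z, q z -> cintegr m D (f^~ z)) -> all q (z :: W) ->
  cintegr m D (fun s => node_ext (f s) (z :: W)) /\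
  node_ext (fun z => cintegral m D (f^~ z)) (z :: W) =
    cintegral m D (fun s => node_ext (f s) (z :: W)).
Proof.
move=> fq; move: z W; apply: (@node_ind _ (fun Z => all q Z ->
  cintegr m D (fun s => node_ext (f s) Z) /\
  node_ext (fun z => cintegral m D (f^~ z)) Z =
    cintegral m D (fun s => node_ext (f s) Z)))
  => [z /= /andP[nz _]|z z' W IH1 IH2 /= /and3P[nz nz' nW]].
  by split => //; exact: fq.
set g := fun z => cintegral m D (f^~ z).
have [i1 e1] : cintegr m D (fun s => node_ext (f s) (z :: W)) /\
    node_ext g (z :: W) = cintegral m D (fun s => node_ext (f s) (z :: W)).
  by apply: IH1; rewrite /= nz.
have [i2 e2] : cintegr m D (fun s => node_ext (f s) (z' :: W)) /\
    node_ext g (z' :: W) = cintegral m D (fun s => node_ext (f s) (z' :: W)).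
  by apply: IH2; rewrite /= nz'.
have j1 := cintegrZ mD (z / (z - z')) i1.
have j2 := cintegrZ mD (z' / (z - z')) i2.
have E s : z / (z - z') * node_ext (f s) (z :: W) -
    z' / (z - z') * node_ext (f s) (z' :: W) =
    node_ext (f s) (z :: z' :: W) by rewrite node_ext2; ring.
split; first by apply: (eq_cintegr mD _ (cintegrB mD j1 j2)) => s _; exact: E.
rewrite -[LHS]/(node_ext g (z :: z' :: W)) node_ext2 e1 e2.
transitivity (cintegral m D (fun s => z / (z - z') * node_ext (f s) (z :: W) -
    z' / (z - z') * node_ext (f s) (z' :: W))).
  by rewrite cintegralB // !cintegralZ //; ring.
by apply: eq_cintegral => s _; exact: E.
Qed.

Lemma node_ext_pint x z W : 1 <= x -> all (node x) (z :: W) ->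
  cintegr m D (fun s => node_ext (pfac_at s) (z :: W)) /\
  node_ext pint (z :: W) = cintegral m D (fun s => node_ext (pfac_at s) (z :: W)).
Proof. by move=> x1; apply: node_ext_cintegral => y; exact: cintegr_pfac. Qed.

Definition node_prod Z s : R[i] := \prod_(z <- Z) pfac z s%:C.

Lemma node_prodE x Z s : 0 < x -> Z != [::] -> uniq Z -> all (node x) Z ->
  node_ext (pfac_at s) Z = node_prod Z s.
Proof.
case: Z => // z W x0 _ uZ /allP nZ; apply: (node_ext_pfac (s := s%:C)) => //.
by apply/negP => /nZ /(real_neq_node s x0); rewrite eqxx.
Qed.

Lemma cintegr_node_prod x Z : 1 <= x -> Z != [::] -> uniq Z -> all (node x) Z ->
  cintegr m D (node_prod Z).
Proof.
case: Z => // z W x1 Z0 uZ nZ; have x0 : 0 < x by exact: lt_le_trans x1.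
have [h _] := node_ext_pint x1 nZ.
by apply: (eq_cintegr mD _ h) => s _; exact: node_prodE nZ.
Qed.

Lemma node_ext_pintE x Z : 1 <= x -> Z != [::] -> uniq Z -> all (node x) Z ->
  node_ext pint Z = cintegral m D (node_prod Z).
Proof.
case: Z => // z W x1 Z0 uZ nZ; have x0 : 0 < x by exact: lt_le_trans x1.
have [_ ->] := node_ext_pint x1 nZ.
by apply: eq_cintegral => s _; exact: node_prodE nZ.
Qed.

Lemma cmod_node_prod x Z s : 0 < x -> all (node x) Z ->
  cmod (node_prod Z s) <= 2 ^+ size Z * clip x s ^+ size Z.
Proof.
move=> x0; rewrite /node_prod -exprMn; elim: Z => [_|z W IH /andP[nz nW]].
  by rewrite big_nil expr0 cmod1.
rewrite big_cons exprS; apply: (le_trans (cmodM _ _)).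
by apply: ler_pM; rewrite ?cmod_ge0 ?cmod_pfac ?IH.
Qed.

Lemma cmod_node_ext_pint x Z : 1 <= x -> Z != [::] -> uniq Z -> all (node x) Z ->
  cmod (node_ext pint Z) <= 2 ^+ size Z * mom m D (size Z) x.
Proof.
move=> x1 Z0 uZ nZ; have x0 : 0 < x by exact: lt_le_trans x1.
have s0 : (0 < size Z)%N by rewrite lt0n size_eq0.
have ic := integr_clip mD hm s0 x1.
rewrite (node_ext_pintE x1) // /mom -RintegralZl //.
apply: cmod_cintegral => //; first exact: cintegr_node_prod x1 _ _ _.
  exact: integrZ.
by move=> s _; exact: cmod_node_prod.
Qed.

End Integrals.

End ImaginaryNodes.

(** * The abstract estimates instantiated at a probability measure *)

Section ProbabilitySetting.
Variables (R : realType) (P : probability (measurableTypeR R) R).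
Implicit Types (x s : R) (z : R[i]) (Z W : seq R[i]).

Lemma integr_cst (k : R) : integr P setT (fun=> k).
Proof. exact: finite_measure_integrable_cst. Qed.

Lemma integr_clipP n x : 0 < x -> integr P setT (fun s => clip x s ^+ n).
Proof.
move=> x0; apply: (integr_le measurableT _ (integr_cst 1)).
  by apply: measurable_funX; exact: measurable_clip.
by move=> s _; rewrite ger0_norm ?exprn_ge0 ?clip_ge0 // exprn_ile1 ?clip_ge0 ?clip_le1.
Qed.

Lemma integr_clip1P : integr P setT (clip 1).
Proof.
by have := integr_clipP 1 ltr01; apply: (eq_integr measurableT) => s _; rewrite expr1.
Qed.

Lemma Rintegral_cstP (k : R) : Rintegral P setT (fun=> k) = k.
Proof.
rewrite Rintegral_cst // -[RHS]mulr1; congr (_ * _).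
rewrite -[RHS]/(fine (1 : R)%:E); congr fine; exact: probability_setT.
Qed.

Local Notation mm x := (fun k => mom P setT k x).

Lemma momP0 x : mom P setT 0 x = 1.
Proof.
rewrite /mom -[RHS](Rintegral_cstP 1); apply: eq_Rintegral => s _.
by rewrite expr0.
Qed.

Lemma momP_anti x n k : 0 < x -> (n <= k)%N -> mom P setT k x <= mom P setT n x.
Proof.
move=> x0 nk; apply: le_Rintegral => //; try exact: integr_clipP.
by move=> s _; exact: clipX_le.
Qed.

Lemma momP_young x a zeta k j K : 0 < x -> 0 <= a <= 1 -> 0 < zeta <= 1 ->
  (0 < k)%N -> (K <= k + j)%N ->
  mom P setT k x * a ^+ j <= zeta ^- j * mom P setT K x + zeta * a ^+ K.
Proof.
move=> x0 ha hz k0 Kkj; have iK := integr_clipP K x0; have ik := integr_clipP k x0.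
rewrite /mom -RintegralZr // -RintegralZl // -[X in _ + X]Rintegral_cstP -RintegralD //.
- apply: le_Rintegral => //.
  + by apply: (eq_integr measurableT) (integrZ measurableT (a ^+ j) ik) => s _; rewrite mulrC.
  + by apply: integrD => //; [exact: integrZ|exact: integr_cst].
  + by move=> s _; apply: young_pt => //; rewrite clip_ge0 ?clip_le1.
- exact: integrZ.
- exact: integr_cst.
Qed.

(** Young's inequality with parameter 1 bounds [mom P setT k x * clip x s ^+ j] by two terms, each
    of which integrates over [s] to the moment of order [k + j]. *)
Lemma momP_mul x k j : 0 < x ->
  mom P setT k x * mom P setT j x <= 2 * mom P setT (k + j) x.
Proof.
move=> x0; have m0 n : 0 <= mom P setT n x by exact: mom_ge0.
case: k => [|k]; first by rewrite momP0 add0n; have := m0 j; lra.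
have one : 0 < (1 : R) <= 1 by rewrite ltr01 lexx.
have i n := integr_clipP n x0.
rewrite {2}/mom -RintegralZl //; last exact: i.
have -> : 2 * mom P setT (k.+1 + j) x =
    Rintegral P setT (fun s => mom P setT (k.+1 + j) x + clip x s ^+ (k.+1 + j)).
  by rewrite RintegralD ?Rintegral_cstP //;
    [rewrite -/(mom _ _ _ _); ring|exact: integr_cst|exact: i].
apply: le_Rintegral => //.
- exact: integrZ.
- by apply: integrD => //; exact: integr_cst.
- move=> s _; have hs : 0 <= clip x s <= 1 by rewrite clip_ge0 ?clip_le1.
  have := momP_young x0 hs one (ltn0Sn k) (leqnn (k.+1 + j)).
  by rewrite expr1n invr1 !mul1r.
Qed.

(* With [G] the Cauchy transform of [P] and [F = 1 / G], this is
   [1 - z / (F z - t)], so that [kap t (ell t) [:: z] = t / (t - F z)]. *)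
Definition ell (t z : R[i]) : R[i] :=
  1 - z * (1 - pint P setT z) / (z - t * (1 - pint P setT z)).

(** As [z] is imaginary, [t] real and the real part of [pint P setT z] at most 1/4, a vanishing real
    part forces [t = 0], and then the imaginary part forces [z = 0]. *)
Lemma ell_den x z (t : R) : 1 <= x -> mom P setT 1 x <= 8^-1 ->
  node x z -> z - t%:C * (1 - pint P setT z) != 0.
Proof.
move=> x1 m1 nz; have x0 : 0 < x by exact: lt_le_trans x1.
have hM : cmod (pint P setT z) <= 2 * mom P setT 1 x.
  have := cmod_node_ext_pint (Z := [:: z]) measurableT integr_clip1P x1 isT isT.
  by rewrite /= nz expr1; apply.
have hr := Re_le_cmod (pint P setT z).
move: (pint P setT z) hM hr => M hM hr; apply/eqP => e.
have rz : complex.Re z = 0 by case/andP: nz => /eqP.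
have zi := node_neq0 x0 nz.
have := congr1 (@complex.Re R) e; have := congr1 (@complex.Im R) e.
rewrite cReD cReN cReM cReD cReN cImD cImN cImM cReD cReN cImD cImN /= rz.
rewrite !mul0r !subr0 !addr0 !sub0r => im re.
have r1 : complex.Re M <= 4^-1 by have := ler_norm (complex.Re M); lra.
have : t * (1 - complex.Re M) = 0 by lra.
move=> /eqP; rewrite mulf_eq0 => /orP[/eqP t00|/eqP]; last by lra.
by move/eqP: zi; apply; move: im; rewrite t00; lra.
Qed.

Lemma mu_setting x (t : R) : 1 <= x -> mom P setT 1 x <= 8^-1 -> 0 <= t ->
  kappa_setting (mm x) (clip x t) t%:C (pint P setT) (ell t%:C) (node x).
Proof.
move=> x1 m1 t0; have x0 : 0 < x by exact: lt_le_trans x1.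
have ct : 0 <= clip x t <= 1 by rewrite clip_ge0 ?clip_le1.
split => //.
- exact: momP0.
- by move=> n; exact: mom_ge0.
- by move=> n k; exact: momP_anti.
- by move=> zeta k j K; exact: momP_young.
- by move=> k j; exact: momP_mul.
- move=> [|z W] uZ nZ; first by rewrite /= cmod1 expr0 momP0 mul1r.
  exact: (cmod_node_ext_pint (Z := z :: W) measurableT integr_clip1P x1 isT uZ nZ).
- by move=> z; exact: cmod_pfac.
- move=> z nz; have n0 := real_neq_node 0 x0 nz.
  split; [exact: n0|exact: real_neq_node nz|].
  have z0 : z != 0 by rewrite eq_sym; exact: n0.
  by rewrite /ell; field; rewrite z0 (ell_den t x1 m1 nz).
Qed.

End ProbabilitySetting.

(** * Comparison of the two measures on products over nodes *)

Section Comparison.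
Variables (R : realType) (P : probability (measurableTypeR R) R).
Variables (nu : {measure set (measurableTypeR R) -> \bar R}) (eta Y : R).
Local Notation D := (`[0%R, +oo[%classic : set R).
Hypothesis eta0 : 0 <= eta.
Hypothesis hnu : integr nu D (clip 1).
Let kp (z : R[i]) (t : R) := kap t%:C (ell P t%:C) [:: z].
Hypothesis node_id : forall x z, Y <= x -> node x z -> cintegr nu D (kp z) /\
  pint P setT z = kap eta%:C (pint P setT) [:: z] + cintegral nu D (kp z).

Let mD : measurable (D : set (measurableTypeR R)). Proof. exact: measurable_itv. Qed.

(** Divided differences of [node_id] express the integral against [P] through [kap], and [kap_pfac]
    replaces [kap] by the product under the integral over [t]. The factor [clip x t] kept in its
    error integrates to [mom nu D 1 x]; the drift contributes [x^-1], which bounds [z^-1] at the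
    nodes. *)
Lemma node_comparison n zeta : 0 < zeta -> exists C X, [/\ 0 <= C, 1 <= X &
  forall x, X <= x -> forall Z, uniq Z -> all (node x) Z -> size Z = n.+1 ->
  cmod (cintegral P setT (node_prod Z) - cintegral nu D (node_prod Z)) <=
    C * (mom nu D 1 x + x^-1) * mom P setT n x + zeta * mom nu D n.+1 x].
Proof.
move=> z0; have [C [d [C0 /andP[d0 d8] hC]]] := kap_pfac n z0.
have [X X1 hX] := mom1_cvg0 measurableT (integr_clip1P P) d0.
exists (C + eta * 2 ^+ n.+2), (Num.max X Y).
have e20 : 0 <= eta * 2 ^+ n.+2 by rewrite mulr_ge0 // exprn_ge0.
split; [by rewrite addr_ge0|by rewrite le_max X1|].
move=> x; rewrite ge_max => /andP[Xx Yx] Z uZ nZ sZ.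
have x1 : 1 <= x by exact: le_trans Xx.
have x0 : 0 < x by exact: lt_le_trans x1.
have m1d := hX x Xx; have m18 := le_trans m1d d8.
have Z0 : Z != [::] by rewrite -size_eq0 sZ.
rewrite -(node_ext_pintE measurableT (integr_clip1P P) x1) //.
have mx := mom_ge0 P setT n x0; have nx := mom_ge0 nu D 1 x0.
have nx1 := mom_ge0 nu D n.+1 x0.
have nN : 0 \notin Z.
  by apply/negP => /(allP nZ) h; have := real_neq_node 0 x0 h; rewrite eqxx.
case: Z sZ uZ nZ Z0 nN => // z W sZ uZ nZ _ nN.
have ik x' : node x x' -> cintegr nu D (kp x').
  by move=> nx'; case: (node_id Yx nx').
have [i1 e1] := node_ext_cintegral mD (f := fun t z => kp z t) ik nZ.
have kE (t : R) : 0 <= t -> node_ext (fun y => kp y t) (z :: W) =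
    kap t%:C (ell P t%:C) (z :: W) by move=> t0; rewrite kap_node_ext.
have Me : node_ext (pint P setT) (z :: W) =
    kap eta%:C (pint P setT) (z :: W) +
    cintegral nu D (fun t => kap t%:C (ell P t%:C) (z :: W)).
  rewrite kap_node_ext // -(eq_cintegral nu (f := fun t => node_ext (fun y => kp y t) (z :: W))).
    rewrite -e1; apply: node_extD => y yZ.
    by have [_] := node_id Yx (allP nZ _ yZ).
  by move=> t; rewrite /= in_itv /= andbT => t0; exact: kE.
have i2 : cintegr nu D (fun t => kap t%:C (ell P t%:C) (z :: W)).
  apply: (eq_cintegr mD _ i1) => t; rewrite /= in_itv /= andbT => t0; exact: kE.
have i3 := cintegr_node_prod (Z := z :: W) mD hnu x1 isT uZ nZ.
rewrite Me -addrA -cintegralB //; apply: (le_trans (cmodD _ _)).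
have nz : node x z by case/andP: nZ.
have b1 : cmod (kap eta%:C (pint P setT) (z :: W)) <=
    eta * 2 ^+ n.+2 * x^-1 * mom P setT n x.
  have ks := mu_setting x1 m18 (lexx 0).
  have uW : uniq W by case/andP: uZ.
  have nW : all (node x) W by case/andP: nZ.
  have h1 := ks_M ks uW nW; have h2 := ks_M ks uZ nZ.
  rewrite sZ in h2; case: (sZ) => sW; rewrite sW in h1.
  apply: (le_trans (cmodM _ _)); rewrite cmodN.
  have -> : eta * 2 ^+ n.+2 * x^-1 * mom P setT n x =
    eta * x^-1 * (2 ^+ n.+2 * mom P setT n x) by ring.
  apply: ler_pM; rewrite ?cmod_ge0 //.
    apply: (le_trans (cmodM _ _)); rewrite cmod_real (ger0_norm eta0).
    by apply: ler_wpM2l => //; exact: cmod_node_inv.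
  apply: (le_trans (cmodB _ _)); apply: (@le_trans _ _
    (2 ^+ n * mom P setT n x + 2 ^+ n.+1 * mom P setT n x)).
    apply: lerD => //; apply: (le_trans h2).
    by rewrite ler_wpM2l ?exprn_ge0 // momP_anti.
  rewrite -mulrDl ler_wpM2r // !exprS.
  have : 0 <= 2 ^+ n :> R by rewrite exprn_ge0.
  lra.
have b2 : cmod (cintegral nu D (fun t => kap t%:C (ell P t%:C) (z :: W) -
    node_prod (z :: W) t)) <= C * mom nu D 1 x * mom P setT n x + zeta * mom nu D n.+1 x.
  have j1 := integrZ mD (C * mom P setT n x) (integr_clip mD hnu (isT : (0 < 1)%N) x1).
  have j2 := integrZ mD zeta (integr_clip mD hnu (isT : (0 < n.+1)%N) x1).
  have -> : C * mom nu D 1 x * mom P setT n x + zeta * mom nu D n.+1 x =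
      Rintegral nu D (fun t => C * mom P setT n x * clip x t ^+ 1 +
        zeta * clip x t ^+ n.+1).
    rewrite RintegralD // !RintegralZl //; first by rewrite /mom; ring.
    - exact: integr_clip.
    - exact: integr_clip.
  apply: cmod_cintegral => //; [exact: cintegrB|exact: integrD|].
  move=> t; rewrite /= in_itv /= andbT => t0.
  apply: (le_trans (hC _ _ _ _ _ _ (mu_setting x1 m18 t0) m1d _ uZ nZ sZ)).
  rewrite lerD2r expr1 -mulrA [X in _ <= X]mulrAC -mulrA ler_wpM2l //.
  rewrite ler_wpM2l ?clip_ge0 //; case: (n) => // ; exact: mom_ge0.
have : 0 <= C * x^-1 * mom P setT n x by rewrite !mulr_ge0 // invr_ge0 ltW.
have : 0 <= eta * 2 ^+ n.+2 * mom nu D 1 x * mom P setT n x by rewrite mulr_ge0 // mulr_ge0.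
lra.
Qed.

End Comparison.

(** * The cumulant representation as an identity at the nodes *)

Section CumulantIdentity.
Variables (R : realType) (P : probability (measurableTypeR R) R).
Variables (nu : {measure set (measurableTypeR R) -> \bar R}) (eta : R).
Local Notation D := (`[0%R, +oo[%classic : set R).
Local Notation kp := (fun (z : R[i]) (t : R) => kap t%:C (ell P t%:C) [:: z]).

Implicit Types (x : R) (z : R[i]).

Let mD : measurable (D : set (measurableTypeR R)). Proof. exact: measurable_itv. Qed.

Lemma kap1E x z (t : R) : 1 <= x -> mom P setT 1 x <= 8^-1 -> node x z ->
  kp z t = - (t%:C * (1 - pint P setT z) / (z - t%:C * (1 - pint P setT z))).
Proof.
move=> x1 m1 nz; have x0 : 0 < x by exact: lt_le_trans x1.
have d0 := ell_den t x1 m1 nz.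
have z0 : z != 0 by rewrite eq_sym; exact: (real_neq_node 0 x0 nz).
by rewrite /= /ell; field; rewrite z0 d0.
Qed.

Lemma cmod_pint_le x z : 1 <= x -> node x z ->
  cmod (pint P setT z) <= 2 * mom P setT 1 x.
Proof.
move=> x1 nz.
have := cmod_node_ext_pint (Z := [:: z]) measurableT (integr_clip1P P) x1 isT isT.
by rewrite /= nz expr1; apply.
Qed.

Lemma cmeas_div_affine (z c : R[i]) : (forall t : R, z - t%:C * c != 0) ->
  cmeas D (fun t => t%:C * c / (z - t%:C * c)).
Proof.
move=> h; pose q (t : R) := complex.Re (z - t%:C * c) ^+ 2 +
  complex.Im (z - t%:C * c) ^+ 2.
have q0 t : q t != 0.
  apply/negP; rewrite /q paddr_eq0 ?sqr_ge0 // !expf_eq0 /= => /andP[/eqP e1 /eqP e2].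
  by move: (h t) => /eqP; apply; apply: complex_ext; rewrite ?e1 ?e2.
have vE (t : R) : (z - t%:C * c)^-1 = (complex.Re (z - t%:C * c) / q t) +i*
   (- complex.Im (z - t%:C * c) / q t).
  apply: (mulIf (h t)); rewrite mulVf //.
  move: (q0 t); rewrite /q; case: (z - t%:C * c) => u v /= uv.
  by apply: complex_ext => /=; field.
have qE t : q t = (complex.Re z - t * complex.Re c) ^+ 2 +
    (complex.Im z - t * complex.Im c) ^+ 2.
  rewrite /q !cReD !cImD !cReN !cImN !cReM !cImM /= !mul0r subr0 addr0 //.
have mlin (u v : R) : measurable_fun D (fun t : R => u - t * v).
  by apply: measurable_funB => //; exact: measurable_funM.
have mq : measurable_fun D (fun t => (q t)^-1).
  apply: measurable_funTS; apply: continuous_measurable_fun => t.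
  apply: cvgV; first exact: q0.
  rewrite (funext qE).
  have cl (u v : R) : (u - s * v) @[s --> t] --> (u - t * v).
    by apply: cvgB; [exact: cvg_cst|apply: cvgM => //; exact: cvg_cst].
  by apply: cvgD; apply: cvgM.
have m1 : cmeas D (fun t : R => t%:C * c).
  apply: cmeasM; last exact: cmeas_cst.
  by split; [exact: measurable_id|exact: measurable_cst].
have mRe : measurable_fun D (fun t : R => complex.Re (z - t%:C * c)).
  rewrite (_ : (fun t => _) = fun t => complex.Re z - t * complex.Re c) //.
  by apply/funext => t; rewrite cReD cReN cReM /= mul0r subr0.
have mIm : measurable_fun D (fun t : R => complex.Im (z - t%:C * c)).
  rewrite (_ : (fun t => _) = fun t => complex.Im z - t * complex.Im c) //.
  by apply/funext => t; rewrite cImD cImN cImM /= mul0r addr0.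
apply: cmeasM => //; rewrite (funext vE); split.
  exact: (measurable_funM mRe mq).
exact: (measurable_funM (measurable_funN mIm) mq).
Qed.

Lemma cintegr_kap1 x z : integr nu D (clip 1) -> 1 <= x ->
  mom P setT 1 x <= 8^-1 -> node x z -> cintegr nu D (kp z).
Proof.
move=> hnu x1 m1 nz; have x0 : 0 < x by exact: lt_le_trans x1.
have [C C1 hC] := kap_le R 1.
have h1 := integr_clip mD hnu (isT : (0 < 1)%N) x1.
apply: (@cintegr_le _ _ _ mD _ (fun t => 2 * C * clip x t ^+ 1)).
- have [z0 m] : complex.Im z != 0 /\ complex.Re z = 0.
    by split; [exact: node_neq0 nz|case/andP: nz => /eqP].
  have h : forall t : R, z - t%:C * (1 - pint P setT z) != 0.
    by move=> t; exact: ell_den nz.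
  have [m1' m2'] := cmeasN (cmeas_div_affine h).
  have e t : D t -> kp z t =
      - (t%:C * (1 - pint P setT z) / (z - t%:C * (1 - pint P setT z))).
    by move=> _; exact: kap1E nz.
  split; [apply: eq_measurable_fun m1'|apply: eq_measurable_fun m2'];
    by move=> t /set_mem /e ->.
- exact: integrZ.
- move=> t; rewrite /= in_itv /= andbT => t0.
  have := hC _ _ _ _ _ _ (mu_setting x1 m1 t0) m1 [:: z] isT.
  rewrite /= nz => /(_ isT isT); rewrite /kbound /= momP0 mulr1 !expr1.
  by move=> /le_trans; apply; rewrite le_eqVlt; apply/orP; left; apply/eqP; ring.
Qed.

Lemma cauchy_transformE x z : 1 <= x -> node x z ->
  cauchy_transform P z = (1 - pint P setT z) / z.
Proof.
move=> x1 nz; have x0 : 0 < x by exact: lt_le_trans x1.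
have z0 : z != 0 by rewrite eq_sym; exact: (real_neq_node 0 x0 nz).
have i1 : cintegr P setT (fun=> 1 : R[i]) by split; exact: integr_cst.
have i2 := cintegr_pfac measurableT (integr_clip1P P) x1 nz.
have e1 : cintegral P setT (fun=> 1 : R[i]) = 1.
  by rewrite /cintegral !Rintegral_cstP.
rewrite mulrC -[X in X - _]e1 -cintegralB // -cintegralZ //; last exact: cintegrB.
apply: eq_cintegral => t _; have := real_neq_node t x0 nz => tz.
by rewrite /pfac; field; rewrite z0 !subr_eq0 (eq_sym z) tz.
Qed.

Lemma pintJ x z : 1 <= x -> node x z ->
  pint P setT (conjc z) = conjc (pint P setT z).
Proof.
move=> x1 nz; rewrite /pint.
rewrite -(cintegralJ measurableT (cintegr_pfac measurableT (integr_clip1P P) x1 nz)).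
apply: eq_cintegral => t _.
by rewrite /pfac conjcM conjcV conjcD conjcN conjcR.
Qed.

Lemma kap1J x z (t : R) : 1 <= x -> node x z -> kp (conjc z) t = conjc (kp z t).
Proof.
move=> x1 nz; rewrite /= /ell (pintJ x1 nz).
by rewrite !(conjcM, conjcD, conjcN, conjcV, conjc1, conjcR).
Qed.

Lemma free_regular_integr : free_regular_representation P eta nu ->
  integr nu D (clip 1).
Proof.
case=> _ _ _ h _; apply/integrableP; split.
  by apply/measurable_EFinP; exact: measurable_clip.
apply: le_lt_trans h; rewrite le_eqVlt; apply/orP; left; apply/eqP.
apply: eq_integral => t /set_mem; rewrite /= in_itv /= andbT => t0.
by rewrite ger0_norm ?clip_ge0 // clip1 ger0_norm.
Qed.

Lemma normc_gt (M : R) (w : R[i]) : 0 <= M -> M < `|complex.Im w| -> M%:C < `|w|.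
Proof.
move=> M0 h; rewrite normc_def ltcR; apply: (lt_le_trans h).
rewrite -sqrtr_sqr ler_sqrt ?lerDr ?sqr_ge0 //.
by rewrite addr_ge0 ?sqr_ge0.
Qed.

(** The cumulant formula is evaluated at G(z). As [pint P setT z] is small, F(z) is close to [z] and
    falls into the cone ([eta1], [M]), while injectivity on the cone ([a], [b]) that contains [z]
    gives back [z] as the inverse image. The integrand of the representation becomes t/(F(z)-t),
    that is, minus [kp z t]. *)
Lemma upper_node_identity (y a b eta1 M : R) : free_regular_representation P eta nu ->
  inverse_defined_on_cone P a b eta1 M ->
  (forall z : R[i], lower_half_plane z -> truncated_cone eta1 M (1 / z) ->
     free_cumulant_transform P a b z = free_regular_cumulant eta nu z) ->
  1 <= y -> b < y -> 4 * M < y -> mom P setT 1 y <= 8^-1 ->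
  4 * mom P setT 1 y < eta1 ->
  pint P setT (0 +i* y) = kap eta%:C (pint P setT) [:: 0 +i* y] +
    cintegral nu D (kp (0 +i* y)).
Proof.
move=> hmu [[a0 b0 eta10 M0] [Finj _]] hC y1 yb yM m1 meta.
have y0 : 0 < y by exact: lt_le_trans y1.
have hnu := free_regular_integr hmu.
set z := 0 +i* y.
have nz : node y z by rewrite /node /= eqxx /= ger0_norm ?(ltW y0) // lexx /=; lra.
have z0 : z != 0 by rewrite eq_sym; exact: (real_neq_node 0 y0 nz).
have hc := cmod_pint_le y1 nz.
have GE := cauchy_transformE y1 nz.
have kE t := kap1E t y1 m1 nz.
have ik := cintegr_kap1 hnu y1 m1 nz.
have den t := ell_den t y1 m1 nz.
have mge := mom_ge0 P setT 1 y0.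
have [p pE] : exists p, p = pint P setT z by exists (pint P setT z).
have {}kE t := etrans (kE t)
  (congr1 (fun q => - (t%:C * (1 - q) / (z - t%:C * (1 - q)))) (esym pE)).
rewrite -pE in hc GE.
have {}den t : z - t%:C * (1 - p) != 0 by rewrite pE; exact: den.
have hr := Re_le_cmod p; have hi := Im_le_cmod p.
have [r1 r2] : `|complex.Re p| <= 4^-1 /\ `|complex.Im p| <= 4^-1 by split; lra.
have i2 : `|complex.Im p| <= 2 * mom P setT 1 y by lra.
move: r1 r2 i2; rewrite !ler_norml => /andP[r1 r1'] /andP[r2 r2'] /andP[r3 r3'].
pose n2 := (1 - complex.Re p) ^+ 2 + complex.Im p ^+ 2.
have n20 : 0 < n2 by rewrite ltr_pwDl ?sqr_ge0 // exprn_gt0 //; lra.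
have n2le : n2 <= 2 by rewrite /n2; nra.
have c0 : 1 - p != 0.
  apply/eqP => /(congr1 (@complex.Re R)); rewrite cReD cReN /= => e; lra.
have GE' : cauchy_transform P z = (- complex.Im p / y) -i* ((1 - complex.Re p) / y).
  rewrite GE; apply: (mulIf z0); rewrite divfK //; rewrite /z; case: (p) => u v.
  by apply: complex_ext => /=; field; rewrite gt_eqF.
have FE : 1 / cauchy_transform P z =
    (- y * complex.Im p / n2) +i* (y * (1 - complex.Re p) / n2).
  rewrite GE div1r invf_div; apply: (mulIf c0); rewrite divfK //.
  move: n20; rewrite /z /n2; case: (p) => u v /= h.
  by apply: complex_ext => /=; field; rewrite gt_eqF.
(* Together with [4 * M < y] this lifts F(z) above the height [M]. *)
have imF : y / 4 < y * (1 - complex.Re p) / n2.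
  rewrite ltr_pdivlMr //; nra.
have lG : lower_half_plane (cauchy_transform P z).
  change (complex.Im (cauchy_transform P z) < 0).
  rewrite GE' /= oppr_lt0 divr_gt0 //; lra.
have cz : truncated_cone a b z.
  split; first by rewrite /upper_half_plane /=.
    by rewrite /= normr0 mulr_gt0.
  by apply: normc_gt; [exact: ltW|rewrite /= gtr0_norm].
have cF : truncated_cone eta1 M (1 / cauchy_transform P z).
  rewrite FE; split => /=.
  - by rewrite /upper_half_plane /=; lra.
  - rewrite !normrM normfV (gtr0_norm n20) normrN (gtr0_norm y0) mulrA.
    rewrite ltr_pM2r ?invr_gt0 // mulrCA ltr_pM2l //.
    apply: (@le_lt_trans _ _ (2 * mom P setT 1 y)); first by rewrite ler_norml r3.
    by nra.
  - apply: normc_gt; first exact: ltW.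
    by rewrite /= gtr0_norm; lra.
have := hC _ lG cF; rewrite /free_cumulant_transform /reciprocal_cauchy_inverse.
rewrite -[1 / cauchy_transform P z]/(reciprocal_cauchy_transform P z).
rewrite pinvKV; [|exact: Finj|exact: mem_set].
rewrite /free_regular_cumulant.
have -> : cintegral nu D (fun t => 1 / (1 - cauchy_transform P z * t%:C) - 1) =
    - cintegral nu D (kp z).
  rewrite -cintegralN //; apply: eq_cintegral => t _.
  by rewrite kE opprK GE; field; rewrite z0 (den t).
rewrite GE divfK // => e.
have -> : kap eta%:C (pint P setT) [:: z] = - (eta%:C * ((1 - p) / z)).
  by rewrite /= -pE; field.
rewrite -pE; apply: oppr_inj; rewrite opprD opprK -e; ring.
Qed.

(** The representation only reaches nodes in the upper half-plane. Those in the lower one, needed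
    for conjugate pairs, follow by complex conjugation. *)
Lemma node_identity : free_regular_representation P eta nu ->
  exists2 Y, 1 <= Y & mom P setT 1 Y <= 8^-1 /\
    forall x z, Y <= x -> node x z -> cintegr nu D (kp z) /\
    pint P setT z = kap eta%:C (pint P setT) [:: z] + cintegral nu D (kp z).
Proof.
move=> hmu; have hnu := free_regular_integr hmu.
have [_ _ _ _ [a [b [eta1 [M [hinv hC]]]]]] := hmu.
have eta10 : 0 < eta1 by case: hinv => [[]].
have e0 : 0 < Num.min 8^-1 (eta1 / 8) by rewrite lt_min invr_gt0 ltr0n divr_gt0.
have [X X1 hX] := mom1_cvg0 measurableT (integr_clip1P P) e0.
pose Y := X + `|b| + 4 * `|M|.
have b0 := normr_ge0 b; have M0 := normr_ge0 M.
have XY : X <= Y by rewrite /Y; lra.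
have Y1 : 1 <= Y by exact: le_trans XY.
have hX8 x : X <= x -> mom P setT 1 x <= 8^-1.
  by move=> /hX; rewrite le_min => /andP[].
exists (Y + 1); first by lra.
split=> [|x z Yx nz]; first by apply: hX8; lra.
have x1 : 1 <= x by lra.
have x0 : 0 < x by lra.
have m1 : mom P setT 1 x <= 8^-1 by apply: hX8; lra.
have ik := cintegr_kap1 hnu x1 m1 nz; split=> //.
have key y : Y + 1 <= y -> pint P setT (0 +i* y) =
    kap eta%:C (pint P setT) [:: 0 +i* y] + cintegral nu D (kp (0 +i* y)).
  move=> Yy; have hb := ler_norm b; have hM := ler_norm M.
  apply: (upper_node_identity hmu hinv hC); rewrite /Y in Yy; try lra.
    by apply: hX8; lra.
  have : X <= y by lra.
  by move=> /hX; rewrite le_min => /andP[_ h]; lra.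
case: (z) nz ik => u y nz ik; have /andP[/eqP /= u0 /andP[xy _]] := nz.
subst u; have [y0|y0] := lerP 0 y.
  by apply: key; rewrite ger0_norm // in xy; lra.
have {}key := key (- y); rewrite ler0_norm ?(ltW y0) // in xy.
have {key} key := key (le_trans Yx xy).
have nw : node x (0 +i* - y) by move: nz; rewrite /node /= normrN.
have e : 0 +i* y = conjc (0 +i* - y) :> R[i] by rewrite /= opprK.
have ikw := cintegr_kap1 hnu x1 m1 nw.
rewrite e; apply: (etrans (pintJ x1 nw)); rewrite [in LHS]key conjcD; congr (_ + _).
  have kk u : kap eta%:C (pint P setT) [:: u] =
    - (eta%:C / u) * (1 - pint P setT u) by [].
  by rewrite !kk (pintJ x1 nw) !(conjcM, conjcD, conjcN, conjcV, conjc1, conjcR).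
rewrite -(cintegralJ mD ikw); apply: eq_cintegral => t _.
exact: (esym (kap1J t x1 nw)).
Qed.

End CumulantIdentity.

(** * Pick forms and their integrals *)

Section SumIntegral.
Variables (R : realType) (m : {measure set (measurableTypeR R) -> \bar R}).
Variable D : set R.
Hypothesis mD : measurable (D : set (measurableTypeR R)).

Lemma cintegral_sum (I : eqType) (r : seq I) (f : I -> R -> R[i]) :
  (forall i, i \in r -> cintegr m D (f i)) ->
  cintegr m D (fun t => \sum_(i <- r) f i t) /\
  cintegral m D (fun t => \sum_(i <- r) f i t) = \sum_(i <- r) cintegral m D (f i).
Proof.
elim: r => [_|i r IH h].
  split.
    by apply: (@eq_cintegr _ _ _ mD (fun=> 0)) => [t _|];
      [rewrite big_nil|split; exact: integrable0].
  rewrite (eq_cintegral m (g := fun=> 0)) ?big_nil; last by move=> t _; rewrite big_nil.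
  by rewrite /cintegral /Rintegral /= integral0.
have [i1 e1] : cintegr m D (fun t => \sum_(i <- r) f i t) /\
  cintegral m D (fun t => \sum_(i <- r) f i t) = \sum_(i <- r) cintegral m D (f i).
  by apply: IH => j jr; apply: h; rewrite inE jr orbT.
have hi : cintegr m D (f i) by apply: h; rewrite mem_head.
split.
  by apply: (eq_cintegr mD _ (cintegrD mD hi i1)) => t _; rewrite big_cons.
rewrite big_cons -e1 -cintegralD //.
by apply: eq_cintegral => t _; rewrite big_cons.
Qed.

End SumIntegral.

Section PickForm.
Variable R : realType.
Implicit Types (l : seq (R[i] * R[i])) (g psi : R[i] -> R[i]) (s : R) (z : R[i]).

(* For a list of pairs (coefficient, pole), the Hermitian form of the Pick
   kernel of [g] at these poles. *)
Definition pick_form l g : R[i] :=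
  \sum_(u <- l) \sum_(v <- l)
    u.1 * conjc v.1 / (conjc v.2 - u.2) * (g u.2 - conjc (g v.2)).

Definition pole_sum l s : R[i] := \sum_(u <- l) u.1 / (u.2 - s%:C).

Definition upper_list l := all (fun u => 0 < complex.Im u.2) l.

Lemma conj_sub_neq0 (z w : R[i]) : 0 < complex.Im z -> 0 < complex.Im w ->
  conjc w - z != 0.
Proof.
case: z => a b; case: w => c d /= b0 d0; rewrite eq_complex /= negb_and.
by apply/orP; right; rewrite lt_eqF //; lra.
Qed.

Lemma upper_sub_neq0 (z : R[i]) s : 0 < complex.Im z -> z - s%:C != 0.
Proof.
case: z => a b /= b0; rewrite eq_complex /= negb_and oppr0 addr0.
by rewrite (gt_eqF b0) orbT.
Qed.

Lemma upper_sub_conj_neq0 (z : R[i]) s : 0 < complex.Im z -> conjc z - s%:C != 0.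
Proof.
case: z => a b /= b0; rewrite eq_complex /= negb_and oppr0 addr0 oppr_eq0.
by rewrite (gt_eqF b0) orbT.
Qed.

Lemma eq_pick_form l g psi : {in [seq u.2 | u <- l], g =1 psi} ->
  pick_form l g = pick_form l psi.
Proof.
move=> h; apply: eq_big_seq => u ul; apply: eq_big_seq => v vl.
by rewrite !h ?map_f.
Qed.

(** The resolvent identity: the Pick kernel of the function 1/(z-s) has rank one. *)
Lemma pick_form_resolvent l s : upper_list l ->
  pick_form l (fun z => (z - s%:C)^-1) = pole_sum l s * conjc (pole_sum l s).
Proof.
move=> /allP hl.
have -> : conjc (pole_sum l s) = \sum_(v <- l) conjc v.1 / (conjc v.2 - s%:C).
  rewrite /pole_sum; elim: l {hl} => [|v l IH]; first by rewrite !big_nil conjc0.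
  by rewrite !big_cons conjcD IH conjcM conjcV conjcD conjcN conjcR.
rewrite /pole_sum big_distrl /=; apply: eq_big_seq => u /hl u0.
rewrite big_distrr /=; apply: eq_big_seq => v /hl v0.
have n1 := conj_sub_neq0 u0 v0; have n2 := upper_sub_neq0 s u0.
have n3 := upper_sub_conj_neq0 s v0.
by rewrite conjcV conjcD conjcN conjcR; field; rewrite n1 n2 n3.
Qed.

Lemma pick_form_scale l (k : R) g :
  pick_form l (fun z => k%:C * g z) = k%:C * pick_form l g.
Proof.
rewrite /pick_form big_distrr /=; apply: eq_bigr => u _.
rewrite big_distrr /=; apply: eq_bigr => v _; rewrite conjcM conjcR; ring.
Qed.

(** A real Moebius transformation of [g] only rescales the coefficients of the form. With [g] the
    Cauchy transform G, the new function is 1/(F-t), so positivity passes from G to it. *)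
Lemma pick_form_mobius l (t : R) g :
  {in [seq u.2 | u <- l], forall z, 1 - t%:C * g z != 0} ->
  pick_form l (fun z => g z / (1 - t%:C * g z)) =
  pick_form [seq (u.1 / (1 - t%:C * g u.2), u.2) | u <- l] g.
Proof.
move=> h; rewrite /pick_form big_map; apply: eq_big_seq => u ul.
rewrite big_map; apply: eq_big_seq => v vl /=.
have n1 := h _ (map_f _ ul); have n2 := h _ (map_f _ vl).
have cE : conjc (1 - t%:C * g v.2) = 1 - t%:C * conjc (g v.2).
  by rewrite conjcD conjcN conjcM conjcR conjc1.
have n3 : 1 - t%:C * conjc (g v.2) != 0 by rewrite -cE conjc_eq0.
rewrite !conjcM !conjcV !cE.
set q := (conjc v.2 - u.2)^-1; field.
by rewrite n1 n3.
Qed.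

Definition csq (z : R[i]) : R := complex.Re z ^+ 2 + complex.Im z ^+ 2.

Lemma Re_mul_conj z : complex.Re (z * conjc z) = csq z.
Proof. by case: z => a b /=; rewrite /csq /=; ring. Qed.

Lemma csqM z w : csq (z * w) = csq z * csq w.
Proof. by case: z => a b; case: w => c d; rewrite /csq /=; ring. Qed.

Lemma csq_ge0 z : 0 <= csq z. Proof. by rewrite addr_ge0 ?sqr_ge0. Qed.

Section Integral.
Variables (m : {measure set (measurableTypeR R) -> \bar R}) (D : set R).
Hypothesis mD : measurable (D : set (measurableTypeR R)).

Lemma cintegral_pick l (g : R[i] -> R -> R[i]) :
  {in [seq u.2 | u <- l], forall z, cintegr m D (g z)} ->
  cintegr m D (fun t => pick_form l (g^~ t)) /\
  cintegral m D (fun t => pick_form l (g^~ t)) =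
    pick_form l (fun z => cintegral m D (g z)).
Proof.
move=> h.
have hJ z : z \in [seq u.2 | u <- l] -> cintegr m D (fun t => conjc (g z t)).
  move=> /h [h1 h2]; split.
    by apply: (eq_integr mD _ h1) => t _; case: (g z t).
  by apply: (eq_integr mD _ (integrN mD h2)) => t _; case: (g z t).
have H u v : u \in l -> v \in l -> cintegr m D (fun t =>
    u.1 * conjc v.1 / (conjc v.2 - u.2) * (g u.2 t - conjc (g v.2 t))) /\
  cintegral m D (fun t => u.1 * conjc v.1 / (conjc v.2 - u.2) *
    (g u.2 t - conjc (g v.2 t))) =
  u.1 * conjc v.1 / (conjc v.2 - u.2) *
    (cintegral m D (g u.2) - conjc (cintegral m D (g v.2))).
  move=> ul vl; have i1 := h _ (map_f _ ul); have i2 := hJ _ (map_f _ vl).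
  have i3 := cintegrB mD i1 i2; split; first exact: cintegrZ.
  by rewrite cintegralZ // cintegralB // cintegralJ //; apply: h; exact: map_f.
have H2 u : u \in l -> cintegr m D (fun t => \sum_(v <- l)
    u.1 * conjc v.1 / (conjc v.2 - u.2) * (g u.2 t - conjc (g v.2 t))) /\
    cintegral m D (fun t => \sum_(v <- l) u.1 * conjc v.1 / (conjc v.2 - u.2) *
      (g u.2 t - conjc (g v.2 t))) =
    \sum_(v <- l) u.1 * conjc v.1 / (conjc v.2 - u.2) *
    (cintegral m D (g u.2) - conjc (cintegral m D (g v.2))).
  move=> ul.
  have [i1 e1] := cintegral_sum mD (r := l) (f := fun v t => u.1 * conjc v.1 /
    (conjc v.2 - u.2) * (g u.2 t - conjc (g v.2 t))) (fun v vl => (H u v ul vl).1).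
  split=> //; rewrite e1; apply: eq_big_seq => v vl; exact: (H u v ul vl).2.
have [i1 e1] := cintegral_sum mD (r := l) (f := fun u t => \sum_(v <- l)
  u.1 * conjc v.1 / (conjc v.2 - u.2) * (g u.2 t - conjc (g v.2 t)))
  (fun u ul => (H2 u ul).1).
split=> //; rewrite e1; apply: eq_big_seq => u ul; exact: (H2 u ul).2.
Qed.

End Integral.
End PickForm.

(** * Weights that grow on the negative half-line *)

Section Support.
Variable R : realType.
Implicit Types (l : seq (R[i] * R[i])) (s c : R) (z : R[i]).

(** Partial fractions: the product of a sum of simple poles with (s-c)/(z-s), which has a real zero
    and one new pole, is again a sum of simple poles. *)
Definition pole_mul c z l : seq (R[i] * R[i]) :=
  [seq (u.1 * ((z - c%:C) / (z - u.2) - 1), u.2) | u <- l] ++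
  [seq (- u.1 * (z - c%:C) / (z - u.2), z) | u <- l].

Lemma pole_sum_mul c z l s : upper_list l -> 0 < complex.Im z ->
  z \notin [seq u.2 | u <- l] ->
  pole_sum (pole_mul c z l) s = (s%:C - c%:C) / (z - s%:C) * pole_sum l s.
Proof.
move=> /allP hl z0 zl; rewrite /pole_sum big_cat /= !big_map -big_split /= big_distrr /=.
apply: eq_big_seq => u ul; have n1 := upper_sub_neq0 s (hl u ul).
have n2 := upper_sub_neq0 s z0.
have n3 : z - u.2 != 0.
  by rewrite subr_eq0; apply: contra zl => /eqP ->; exact: map_f.
by field; rewrite n1 n2 n3.
Qed.

Section Nodes.
Variable Y : R.
Hypothesis Y1 : 1 <= Y.
Let Y0 : 0 < Y. Proof. exact: lt_le_trans Y1. Qed.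

(** Infinitely many distinct heights between [Y] and [2 * Y], so that all poles are nodes at the
    single scale [Y]. *)
Definition sup_node (j : nat) : R := Y + Y / j.+1%:R.

Lemma sup_node_bound j : Y < sup_node j <= 2 * Y.
Proof.
have j0 : (0 : R) < j.+1%:R by rewrite ltr0n.
rewrite /sup_node ltrDl divr_gt0 //= mulr2n mulrDl mul1r lerD2l.
by rewrite ler_pdivrMr // ler_peMr ?(ltW Y0) // ler1n.
Qed.

Lemma sup_node_inj : injective sup_node.
Proof.
move=> i j /addrI /(mulfI (lt0r_neq0 Y0)) /invr_inj /eqP.
by rewrite eqr_nat => /eqP [].
Qed.

(** A pole at height [y] on the imaginary axis is paired with a zero at the real point [y]: the
    squared modulus of the factor is then [1 - 2 * y * s / (s ^+ 2 + y ^+ 2)], which detects the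
    sign of [s]. *)
Fixpoint sup_list (n : nat) : seq (R[i] * R[i]) :=
  if n is n'.+1 then pole_mul (sup_node n) (0 +i* sup_node n) (sup_list n')
  else [:: (1, 0 +i* sup_node 0)].

Lemma sup_list_node n u : u \in sup_list n ->
  exists2 j, (j <= n)%N & u.2 = 0 +i* sup_node j.
Proof.
elim: n u => [|n IH] u; first by rewrite inE => /eqP ->; exists 0%N.
rewrite /= mem_cat => /orP[|] /mapP[v /IH [j jn e] ->] /=.
  by exists j => //; exact: leqW.
by exists n.+1.
Qed.

Lemma sup_list_upper n : upper_list (sup_list n).
Proof.
apply/allP => u /sup_list_node [j _ ->] /=.
by have /andP[h _] := sup_node_bound j; exact: lt_trans h.
Qed.

Definition sup_weight n s : R := csq (pole_sum (sup_list n) s).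

Lemma csq_factor (y s : R) : 0 < y ->
  csq ((s%:C - y%:C) / ((0 +i* y) - s%:C)) = (s - y) ^+ 2 / (s ^+ 2 + y ^+ 2).
Proof.
move=> y0; have n0 : (0 +i* y) - s%:C != 0 by exact: upper_sub_neq0.
have q0 : s ^+ 2 + y ^+ 2 != 0.
  by rewrite paddr_eq0 ?sqr_ge0 // !expf_eq0 /= negb_and (gt_eqF y0) orbT.
have e : csq ((0 +i* y) - s%:C) = s ^+ 2 + y ^+ 2 by rewrite /csq /=; ring.
apply: (mulIf q0); rewrite divfK // -{1}e -csqM divfK // /csq /=; ring.
Qed.

Lemma sup_weightS n s : sup_weight n.+1 s =
  (s - sup_node n.+1) ^+ 2 / (s ^+ 2 + sup_node n.+1 ^+ 2) * sup_weight n s.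
Proof.
have y0 : 0 < sup_node n.+1.
  by have /andP[h _] := sup_node_bound n.+1; exact: lt_trans h.
rewrite /sup_weight -csq_factor // -csqM -pole_sum_mul //.
  exact: sup_list_upper.
apply/negP => /mapP[u /sup_list_node [j jn ->]] [] /sup_node_inj e.
by move: jn; rewrite -e ltnn.
Qed.

Lemma sup_weight0 s : sup_weight 0 s = (s ^+ 2 + sup_node 0 ^+ 2)^-1.
Proof.
have y0 : 0 < sup_node 0.
  by have /andP[h _] := sup_node_bound 0; exact: lt_trans h.
have n0 : (0 +i* sup_node 0) - s%:C != 0 by exact: upper_sub_neq0.
have q0 : s ^+ 2 + sup_node 0 ^+ 2 != 0.
  by rewrite paddr_eq0 ?sqr_ge0 // !expf_eq0 /= negb_and (gt_eqF y0) orbT.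
have e : csq ((0 +i* sup_node 0) - s%:C) = s ^+ 2 + sup_node 0 ^+ 2.
  by rewrite /csq /=; ring.
rewrite /sup_weight /pole_sum big_seq1 /=; apply: (mulIf q0).
by rewrite -{1}e -csqM mulfVK // /csq /= mulVf // expr1n expr0n addr0.
Qed.

Lemma sup_weight_pos n s : 0 <= s -> sup_weight n s <= (s ^+ 2 + sup_node 0 ^+ 2)^-1.
Proof.
move=> s0; elim: n => [|n IH]; first by rewrite sup_weight0.
have /andP[h _] := sup_node_bound n.+1; have y0 := lt_trans Y0 h.
rewrite sup_weightS; apply: le_trans IH; apply: ler_piMl; first exact: csq_ge0.
rewrite ler_pdivrMr; last by rewrite ltr_wpDl ?sqr_ge0 // exprn_gt0.
by rewrite mul1r sqrrB; have := mulr_ge0 s0 (ltW y0); lra.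
Qed.

(* For [s < 0], the additional node [y] multiplies [sup_weight] by
   [(s - y) ^+ 2 / (s ^+ 2 + y ^+ 2) >= 1 + sup_gain s], while this factor is at
   most 1 for [s >= 0]: the weights grow without bound on the negative half-line
   only. *)
Definition sup_gain s : R := 2 * Y * (- s) / (s ^+ 2 + 4 * Y ^+ 2).

Lemma sup_weight_neg n s : s < 0 ->
  (1 + n%:R * sup_gain s) / (s ^+ 2 + 4 * Y ^+ 2) <= sup_weight n s.
Proof.
move=> s0; have Yq : 0 < Y ^+ 2 by rewrite exprn_gt0.
have q0 : 0 < s ^+ 2 + 4 * Y ^+ 2 by have := sqr_ge0 s; lra.
have sq j : 0 < s ^+ 2 + sup_node j ^+ 2 <= s ^+ 2 + 4 * Y ^+ 2.
  have /andP[h1 h2] := sup_node_bound j; have y0 := lt_trans Y0 h1.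
  rewrite ltr_wpDl ?sqr_ge0 ?exprn_gt0 //= lerD2l.
  have -> : 4 * Y ^+ 2 = (2 * Y) ^+ 2 by ring.
  by rewrite lerXn2r ?nnegrE // ltW // mulr_gt0.
have w0 : 0 <= sup_gain s.
  by rewrite divr_ge0 ?(ltW q0) // !mulr_ge0 ?(ltW Y0) // oppr_ge0 ltW.
elim: n => [|n IH].
  rewrite mul0r addr0 div1r sup_weight0; have /andP[h1 h2] := sq 0%N.
  by rewrite lef_pV2.
rewrite sup_weightS; have /andP[h1 h2] := sq n.+1.
have /andP[h3 _] := sup_node_bound n.+1.
have f : 1 + sup_gain s <= (s - sup_node n.+1) ^+ 2 / (s ^+ 2 + sup_node n.+1 ^+ 2).
  have -> : (s - sup_node n.+1) ^+ 2 / (s ^+ 2 + sup_node n.+1 ^+ 2) =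
    1 + 2 * sup_node n.+1 * (- s) / (s ^+ 2 + sup_node n.+1 ^+ 2).
    by field; rewrite gt_eqF.
  rewrite lerD2l /sup_gain; apply: ler_pM.
  - by rewrite !mulr_ge0 ?(ltW Y0) // oppr_ge0 ltW.
  - by rewrite invr_ge0 ltW.
  - by rewrite ler_wpM2r ?oppr_ge0 ?(ltW s0) // ler_wpM2l // ltW.
  - by rewrite lef_pV2.
apply: (@le_trans _ _ ((1 + sup_gain s) * ((1 + n%:R * sup_gain s) /
    (s ^+ 2 + 4 * Y ^+ 2)))).
  rewrite mulrA ler_wpM2r ?invr_ge0 ?(ltW q0) //.
  rewrite -natr1; have := mulr_ge0 (ler0n R n) (sqr_ge0 (sup_gain s)); lra.
apply: ler_pM => //; first by rewrite addr_ge0.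
rewrite divr_ge0 ?(ltW q0) // addr_ge0 // mulr_ge0 //.
Qed.

(** For [s < 0] this is [- s * sup_gain s / (s ^+ 2 + 4 * Y ^+ 2)], the part of the weight that
    grows linearly with the number of nodes; elsewhere it is 0. *)
Definition sup_test s : R :=
  Num.max 0 (- s) * (2 * Y * Num.max 0 (- s)) / (s ^+ 2 + (2 * Y) ^+ 2) *
  (s ^+ 2 + (2 * Y) ^+ 2)^-1.

Lemma sup_weight_le (eta : R) n s : 0 <= eta ->
  (s - eta) * sup_weight n s <= 1 - n%:R * sup_test s.
Proof.
move=> eta0; have h0 := csq_ge0 (pole_sum (sup_list n) s).
apply: (@le_trans _ _ (s * sup_weight n s)).
  by rewrite ler_wpM2r // lerBlDr lerDl.
have [s0|s0] := leP 0 s.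
  have -> : sup_test s = 0.
    by rewrite /sup_test (max_idPl _) ?oppr_le0 // !mul0r.
  rewrite mulr0 subr0; apply: (le_trans (ler_wpM2l s0 (sup_weight_pos n s0))).
  have /andP[h _] := sup_node_bound 0; have y1 := le_lt_trans Y1 h.
  rewrite ler_pdivrMr; last by rewrite ltr_wpDl ?sqr_ge0 // exprn_gt0 //; lra.
  have hy : 1 <= sup_node 0 ^+ 2 by rewrite exprn_ege1 // ltW.
  have h1 := sqr_ge0 (s - 1); have h2 := sqr_ge0 s.
  by rewrite mul1r; lra.
have Yq : 0 < Y ^+ 2 by rewrite exprn_gt0.
have q0 : 0 < s ^+ 2 + 4 * Y ^+ 2 by have := sqr_ge0 s; lra.
have := sup_weight_neg n s0 => hh.
have -> : n%:R * sup_test s = - s * (n%:R * sup_gain s / (s ^+ 2 + 4 * Y ^+ 2)).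
  rewrite /sup_test /sup_gain (max_idPr _) ?oppr_ge0 ?(ltW s0) //.
  have e : (2 * Y) ^+ 2 = 4 * Y ^+ 2 by ring.
  by rewrite e; field; rewrite gt_eqF.
have : (n%:R * sup_gain s) / (s ^+ 2 + 4 * Y ^+ 2) <= sup_weight n s.
  apply: le_trans hh; rewrite ler_wpM2r ?invr_ge0 ?(ltW q0) //; lra.
set u := _ / _ => hu; nra.
Qed.

End Nodes.
End Support.

(** * Absence of mass on the negative half-line *)

Section Positivity.
Variables (R : realType) (P : probability (measurableTypeR R) R).
Variables (nu : {measure set (measurableTypeR R) -> \bar R}) (eta Y : R).
Local Notation D := (`[0%R, +oo[%classic : set R).
Local Notation kp := (fun (z : R[i]) (t : R) => kap t%:C (ell P t%:C) [:: z]).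
Hypothesis eta0 : 0 <= eta.
Hypothesis Y1 : 1 <= Y.
Hypothesis m8 : mom P setT 1 Y <= 8^-1.
Hypothesis node_id : forall x z, Y <= x -> node x z -> cintegr nu D (kp z) /\
  pint P setT z = kap eta%:C (pint P setT) [:: z] + cintegral nu D (kp z).

Let mD : measurable (D : set (measurableTypeR R)). Proof. exact: measurable_itv. Qed.
Let Y0 : 0 < Y. Proof. exact: lt_le_trans Y1. Qed.

Lemma pick_form_cauchy_ge0 l : upper_list l ->
  {in [seq u.2 | u <- l], forall z, node Y z} ->
  0 <= complex.Re (pick_form l (fun z => (1 - pint P setT z) / z)).
Proof.
move=> hl hn.
have hr z : z \in [seq u.2 | u <- l] ->
    cintegr P setT (fun s => (z - s%:C)^-1) /\
    cintegral P setT (fun s => (z - s%:C)^-1) = (1 - pint P setT z) / z.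
  move=> /hn nz; split; last first.
    rewrite -(cauchy_transformE P Y1 nz); apply: eq_cintegral => t _.
    by rewrite div1r.
  have i1 : cintegr P setT (fun=> 1 : R[i]) by split; exact: integr_cst.
  have i2 := cintegr_pfac measurableT (integr_clip1P P) Y1 nz.
  have i3 := cintegrZ measurableT z^-1 (cintegrB measurableT i1 i2).
  apply: (eq_cintegr measurableT _ i3) => t _.
  have z0 : z != 0 by rewrite eq_sym; exact: (real_neq_node 0 Y0 nz).
  have tz := real_neq_node t Y0 nz.
  by rewrite /pfac; field; rewrite z0 !subr_eq0 (eq_sym z) tz.
have [i1 e1] := cintegral_pick measurableT (g := fun z s => (z - s%:C)^-1)
  (fun z zl => (hr z zl).1).
rewrite (eq_pick_form (psi := fun z => cintegral P setT (fun s => (z - s%:C)^-1))).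
  rewrite -e1 /=; apply: Rintegral_ge0 => s _.
  by rewrite pick_form_resolvent // Re_mul_conj csq_ge0.
by move=> z /hr[_ ->].
Qed.

(** The integral is the Pick form of the function obtained by integrating (s-eta)/(z-s) against [P].
    By the node identity this function is the integral of t/(F(z)-t) against [nu], and its form is
    nonnegative because [t >= 0] and the form of 1/(F-t) is one of G. *)
Lemma sup_weight_integral_ge0 n :
  integr P setT (fun s => (s - eta) * sup_weight Y n s) /\
  0 <= Rintegral P setT (fun s => (s - eta) * sup_weight Y n s).
Proof.
set l := sup_list Y n.
have hl : upper_list l by exact: sup_list_upper.
have hn : {in [seq u.2 | u <- l], forall z, node Y z}.
  move=> _ /mapP[u ul ->]; have [j _ ->] := sup_list_node ul.
  have /andP[h1 h2] := sup_node_bound Y1 j.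
  rewrite /node /= eqxx /= ger0_norm ?(ltW h1) //.
  by apply: ltW; exact: lt_trans h1.
have m0 := mom_ge0 P setT 1 Y0.
have nz0 z : z \in [seq u.2 | u <- l] -> z != 0.
  by move=> /hn h; rewrite eq_sym; exact: (real_neq_node 0 Y0 h).
(* The integral of [f z] is [- pint P setT z] minus eta times G(z): removing the drift leaves the
   [nu]-part of the node identity, with opposite sign. *)
pose f z s : R[i] := - pfac z s%:C - eta%:C / z * (1 - pfac z s%:C).
have fE s z : z \in [seq u.2 | u <- l] -> f z s = (s - eta)%:C * (z - s%:C)^-1.
  move=> zl; have h1 := nz0 z zl; have h2 := real_neq_node s Y0 (hn z zl).
  have -> : (s - eta)%:C = s%:C - eta%:C by apply: complex_ext => //=; rewrite subr0.
  by rewrite /f /pfac; field; rewrite h1 !subr_eq0 (eq_sym z) h2.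
have hf z : z \in [seq u.2 | u <- l] -> cintegr P setT (f z) /\
    cintegral P setT (f z) = cintegral nu D (fun t => - kp z t).
  move=> zl; have nz := hn z zl; have [ik pE] := node_id (lexx Y) nz.
  have i1 : cintegr P setT (fun=> 1 : R[i]) by split; exact: integr_cst.
  have i2 := cintegr_pfac measurableT (integr_clip1P P) Y1 nz.
  have i3 := cintegrB measurableT i1 i2.
  have i4 := cintegrZ measurableT (eta%:C / z) i3.
  have i5 := cintegrN measurableT i2.
  split; first exact: (cintegrB measurableT i5 i4).
  rewrite (cintegralB measurableT i5 i4) cintegralN // cintegralZ // cintegralB //.
  have -> : cintegral P setT (fun=> 1 : R[i]) = 1.
    by rewrite /cintegral !Rintegral_cstP.
  rewrite -/(pint P setT z) cintegralN //.
  have kk : kap eta%:C (pint P setT) [:: z] =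
    - (eta%:C / z) * (1 - pint P setT z) by [].
  move: pE; rewrite kk; set K := cintegral nu D _; set q := pint P setT z => pE.
  have -> : K = q + eta%:C / z * (1 - q) by rewrite {1}pE; ring.
  ring.
have [i1 e1] := cintegral_pick measurableT (g := f) (fun z zl => (hf z zl).1).
have [i2 e2] := cintegral_pick mD (l := l) (g := fun z t => - kp z t)
  (fun z zl => cintegrN mD (node_id (lexx Y) (hn z zl)).1).
have wE s : complex.Re (pick_form l (f^~ s)) = (s - eta) * sup_weight Y n s.
  rewrite (eq_pick_form (psi := fun z => (s - eta)%:C * (z - s%:C)^-1)).
    rewrite pick_form_scale pick_form_resolvent // cReM /= mul0r subr0.
    by rewrite Re_mul_conj.
  by move=> z; exact: fE.
split.
  by apply: (eq_integr measurableT _ i1.1) => s _; exact: wE.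
have -> : Rintegral P setT (fun s => (s - eta) * sup_weight Y n s) =
    complex.Re (cintegral P setT (fun s => pick_form l (f^~ s))).
  by apply: eq_Rintegral => s _; rewrite wE.
rewrite e1 (eq_pick_form (psi := fun z => cintegral nu D (fun t => - kp z t))).
  rewrite -e2 /=; apply: Rintegral_ge0 => t; rewrite /= in_itv /= andbT => t0.
  pose g z := (1 - pint P setT z) / z.
  have gd z : z \in [seq u.2 | u <- l] -> 1 - t%:C * g z != 0.
    move=> zl; have h := ell_den t Y1 m8 (hn z zl); have h1 := nz0 z zl.
    have -> : 1 - t%:C * g z = (z - t%:C * (1 - pint P setT z)) / z.
      by rewrite /g; field.
    by rewrite mulf_neq0 // invr_neq0.
  rewrite (eq_pick_form (psi := fun z => t%:C * (g z / (1 - t%:C * g z)))).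
    rewrite pick_form_scale pick_form_mobius // cReM /= mul0r subr0.
    apply: mulr_ge0 => //; apply: pick_form_cauchy_ge0.
      by apply/allP => _ /mapP[u ul ->] /=; exact: (allP hl).
    by move=> z /mapP[_ /mapP[u ul ->] ->] /=; apply: hn; exact: map_f.
  move=> z zl; have h := ell_den t Y1 m8 (hn z zl); have h1 := nz0 z zl.
  have h2 := gd z zl.
  apply: (etrans (congr1 -%R (kap1E t Y1 m8 (hn z zl)))); rewrite opprK.
  move: h2; rewrite /g => h2.
  have -> : 1 - t%:C * ((1 - pint P setT z) / z) =
    (z - t%:C * (1 - pint P setT z)) / z by field.
  by field; rewrite h1 h.
by move=> z /hf[_ ->].
Qed.

Lemma sup_test_ge0 s : 0 <= sup_test Y s.
Proof.
have v0 : 0 <= Num.max 0 (- s) by rewrite le_max lexx.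
rewrite /sup_test; apply: mulr_ge0; last by rewrite invr_ge0 addr_ge0 ?sqr_ge0.
by rewrite divr_ge0 ?addr_ge0 ?sqr_ge0 // !mulr_ge0 // ltW.
Qed.

Lemma integr_sup_test : integr P setT (sup_test Y).
Proof.
have m2 : 2 * Y != 0 by rewrite mulf_neq0 // gt_eqF.
have mv : measurable_fun (setT : set R) (fun s : R => Num.max 0 (- s)).
  by apply: measurable_maxr => //; exact: measurable_funN.
have mq := measurable_quad_inv (D := setT) m2.
apply: (integr_le measurableT _ (integr_cst P (2 * Y))).
  by do ! apply: measurable_funM => //.
move=> s _; rewrite ger0_norm ?sup_test_ge0 // /sup_test.
have v0 : 0 <= Num.max 0 (- s) by rewrite le_max lexx.
have vs : Num.max 0 (- s) ^+ 2 <= s ^+ 2.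
  by case: (leP 0 (- s)) => h; rewrite ?sqrrN // expr0n sqr_ge0.
have q1 : 1 <= s ^+ 2 + (2 * Y) ^+ 2.
  rewrite (le_trans (y := (2 * Y) ^+ 2)) ?lerDr ?sqr_ge0 // exprn_ege1 //.
  by move: (Y1) => ?; lra.
have q0 : 0 < s ^+ 2 + (2 * Y) ^+ 2 by exact: lt_le_trans q1.
rewrite -[leRHS]mulr1; apply: ler_pM.
- by rewrite divr_ge0 ?(ltW q0) // !mulr_ge0 // ltW.
- by rewrite invr_ge0 ltW.
- rewrite ler_pdivrMr // mulrCA ler_wpM2l ?mulr_ge0 ?(ltW Y0) // -expr2.
  by rewrite (le_trans vs) // lerDl sqr_ge0.
- by rewrite invf_le1.
Qed.

(** The bound [n%:R * I <= 1] holds for all [n], so the integral of [sup_test Y], a function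
    positive on the whole negative half-line, vanishes. *)
Lemma support_ge0 : P `]-oo, 0%R[%classic = 0%E.
Proof.
pose I := Rintegral P setT (sup_test Y).
have I0 : 0 <= I by apply: Rintegral_ge0 => s _; exact: sup_test_ge0.
have nI n : n%:R * I <= 1.
  have [i1 p1] := sup_weight_integral_ge0 n.
  have i2 := integrZ measurableT n%:R integr_sup_test.
  have i3 := integrB measurableT (integr_cst P 1) i2.
  have := le_Rintegral measurableT i1 i3 (fun s _ => sup_weight_le Y1 n s eta0).
  rewrite RintegralB //; last exact: integr_cst.
  rewrite Rintegral_cstP RintegralZl //; last exact: integr_sup_test.
  by rewrite -/I; lra.
have IE : I = 0.
  apply/eqP; rewrite eq_le I0 andbT leNgt; apply/negP => Ip.
  have := nI (Num.bound (1 / I)); rewrite leNgt => /negP; apply.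
  rewrite -ltr_pdivrMr //; apply: archi_boundP.
  by rewrite divr_ge0.
have e0 : (\int[P]_(s in setT) `|(EFin \o sup_test Y) s| = 0)%E.
  have fi := integrable_fin_num measurableT integr_sup_test.
  transitivity (\int[P]_(s in setT) (EFin \o sup_test Y) s)%E.
    by apply: eq_integral => s _; rewrite /= ger0_norm ?sup_test_ge0.
  by rewrite -(fineK fi) -[fine _]/I IE.
have me : measurable_fun setT (EFin \o sup_test Y).
  exact: measurable_int integr_sup_test.
have /(ae_eq_integral_abs P measurableT me) [N [mN N0 hN]] := e0.
apply: (subset_measure0 _ mN _ N0); first exact: measurable_itv.
move=> s; rewrite /= in_itv /= => s0; apply: hN => /= h.
have := h Logic.I => -[] /eqP; apply/negP; apply: lt0r_neq0.
rewrite /sup_test (max_idPr _) ?oppr_ge0 ?(ltW s0) //.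
have q0 : 0 < s ^+ 2 + (2 * Y) ^+ 2.
  by rewrite ltr_wpDl ?sqr_ge0 // exprn_gt0 // mulr_gt0.
by rewrite mulr_gt0 ?invr_gt0 // divr_gt0 // !mulr_gt0 // ?oppr_gt0.
Qed.

End Positivity.

(** * Tails against clipped moments *)

Section Tails.
Variables (R : realType) (m : {measure set (measurableTypeR R) -> \bar R}).
Local Notation D := (`[0%R, +oo[%classic : set R).
Hypothesis hm : integr m D (clip 1).
Implicit Types (x s : R) (n k j : nat).

Let mD : measurable (D : set (measurableTypeR R)). Proof. exact: measurable_itv. Qed.

Definition ray x : R -> R := indic (`]x, +oo[%classic : set R).

Lemma rayE x s : ray x s = (x < s)%R%:R.
Proof.
rewrite /ray indicE; congr (nat_of_bool _)%:R.
by apply/idP/idP; rewrite inE /= in_itv /= andbT.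
Qed.

Lemma measurable_ray x : measurable_fun D (ray x).
Proof. by apply: measurable_indic; exact: measurable_itv. Qed.

Lemma ray_ge0 x s : 0 <= ray x s. Proof. by rewrite rayE ler0n. Qed.

Lemma integr_ray x : 0 < x -> integr m D (ray x).
Proof.
move=> x0; apply: (integr_le mD (measurable_ray x) (integrZ mD (1 + x^-1) hm)).
move=> s; rewrite /= in_itv /= andbT => s0; rewrite (ger0_norm (ray_ge0 _ _)).
rewrite rayE; have xv : 0 < x^-1 by rewrite invr_gt0.
case: ltP => xs; last by rewrite mulr_ge0 ?clip_ge0 //; lra.
rewrite (_ : (true%:R : R) = 1) // clip1 (ger0_norm s0) minEle.
case: ifP => _; first by rewrite mulr1; lra.
rewrite mulrDl mul1r -[1 in leLHS](mulVf (lt0r_neq0 x0)).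
have h : x^-1 * x <= x^-1 * s by rewrite ler_wpM2l // ltW.
lra.
Qed.

Lemma integral_ray x : 0 < x -> (\int[m]_(s in D) (ray x s)%:E)%E = m `]x, +oo[%classic.
Proof.
move=> x0; have mA : measurable (`]x, +oo[%classic : set (measurableTypeR R)).
  exact: measurable_itv.
transitivity (m (`]x, +oo[%classic `&` D)); first exact: integral_indic.
congr (m _); apply/seteqP; split => s /=; rewrite !in_itv /= !andbT; first by case.
by move=> xs; split => //; apply: ltW; exact: lt_trans xs.
Qed.

Lemma tail_finite x : 0 < x -> (m `]x, +oo[%classic < +oo)%E.
Proof.
move=> x0; rewrite -integral_ray //; exact: (integrable_lty mD (integr_ray x0)).
Qed.

Lemma tailE x : 0 < x -> tail m x = Rintegral m D (ray x).
Proof. by move=> x0; rewrite /tail -integral_ray. Qed.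

Lemma tail_ge0 x : 0 <= tail m x. Proof. exact: fine_ge0. Qed.

Lemma tail_anti x y : 0 < x -> x <= y -> tail m y <= tail m x.
Proof.
move=> x0 xy; rewrite !tailE //; last exact: lt_le_trans xy.
apply: le_Rintegral => //; try exact: integr_ray.
  by apply: integr_ray; exact: lt_le_trans xy.
move=> s _; rewrite -[leLHS]/(ray y s) -[leRHS]/(ray x s) !rayE ler_nat.
by case: ltP => // ys; rewrite (le_lt_trans xy).
Qed.

Lemma measurable_tail : measurable_fun D (tail m).
Proof.
have -> : D = [set 0] `|` `]0, +oo[%classic.
  apply/seteqP; split => s /=; rewrite !in_itv /= !andbT.
    by rewrite le_eqVlt => /orP[/eqP <-|]; [left|right].
  by case=> [->|/ltW].
apply/measurable_funU; [exact: measurable_set1|exact: measurable_itv|split].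
  exact: measurable_fun_set1.
(* Monotonicity may fail at 0, where [fine] sends an infinite mass to 0; keeping the argument away
   from 0 restores it. *)
pose f n x := tail m (Num.max x n.+1%:R^-1).
have mf n : measurable_fun (`]0, +oo[%classic : set R) (f n).
  apply: nonincreasing_measurable; first exact: measurable_itv.
  move=> x y xy; apply: tail_anti; first by rewrite lt_max invr_gt0 ltr0n orbT.
  by rewrite ge_max !le_max xy lexx orbT.
apply: (measurable_fun_cvg mf) => x; rewrite /= in_itv /= andbT => x0.
apply: cvg_near_cst; near=> n; rewrite /f (max_idPl _) //.
rewrite -[leRHS]invrK lef_pV2 ?posrE ?invr_gt0 ?ltr0n //.
apply: ltW; apply: (lt_le_trans (archi_boundP _)); first by rewrite invr_ge0 ltW.
by rewrite ler_nat; near: n; exact: nbhs_infty_ge.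
Unshelve. all: by end_near.
Qed.

Lemma mom_double n x : (0 < n)%N -> 1 <= x ->
  mom m D n (2 * x) <= 2 ^- n * mom m D n x + tail m x.
Proof.
move=> n0 x1; have x0 : 0 < x by exact: lt_le_trans x1.
have x2 : 1 <= 2 * x by lra.
have i1 := integr_clip mD hm n0 x1; have i2 := integr_ray x0.
rewrite tailE // -RintegralZl // -RintegralD //; last exact: integrZ.
apply: le_Rintegral => //.
- exact: integr_clip.
- by apply: integrD => //; exact: integrZ.
- move=> s; rewrite /= in_itv /= andbT => s0.
  rewrite -[X in _ <= _ + X]/(ray x s) rayE.
  case: ltP => xs.
    apply: (@le_trans _ _ 1); first by rewrite exprn_ile1 ?clip_ge0 ?clip_le1 // mulr_gt0.
    by rewrite lerDr mulr_ge0 ?invr_ge0 ?exprn_ge0 ?clip_ge0.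
  rewrite addr0 -exprVn -exprMn lerXn2r ?nnegrE ?mulr_ge0 ?invr_ge0 ?clip_ge0 ?mulr_gt0 //.
  have -> : clip x s = s / x.
    by rewrite /clip (ger0_norm s0); apply/min_idPr; rewrite ler_pdivrMr // mul1r.
  apply: (le_trans (clip_le _ _)); rewrite (ger0_norm s0) le_eqVlt; apply/orP; left.
  by apply/eqP; field; rewrite gt_eqF.
Qed.

(** Induction over dyadic scales for the order [a.+1]: by [mom_double] and the doubling hypothesis,
    one scale turns the constant [C] into [C / 2 + 2 ^+ a], which does not exceed [C] if
    [C >= 2 ^+ a.+1]. Higher moments are smaller. *)
Lemma mom_le_tail a X0 : 1 <= X0 -> (forall x, X0 <= x -> 0 < tail m x) ->
  (forall x, X0 <= x -> tail m x <= 2 ^+ a * tail m (2 * x)) ->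
  exists2 C, 0 < C & forall n x, (a < n)%N -> X0 <= x -> mom m D n x <= C * tail m x.
Proof.
move=> X01 Tpos Tdbl; have X00 : 0 < X0 by exact: lt_le_trans X01.
have t0 : 0 < tail m (2 * X0) by apply: Tpos; lra.
have p0 : 0 < 2 ^+ a.+1 :> R by rewrite exprn_gt0.
(* The first entry starts the induction between [X0] and [2 * X0], the second keeps the constant
   stable. *)
pose C := Num.max (mom m D a.+1 X0 / tail m (2 * X0)) (2 ^+ a.+1).
have C0 : 0 < C by rewrite lt_max p0 orbT.
exists C => // n x an Xx.
apply: (@le_trans _ _ (mom m D a.+1 x)); first by apply: mom_le => //; exact: le_trans Xx.
have key k y : X0 <= y -> y <= 2 ^+ k * (2 * X0) -> mom m D a.+1 y <= C * tail m y.
  elim: k y => [|k IH] y Xy yk.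
    have y2 : y <= 2 * X0 by rewrite expr0 mul1r in yk.
    apply: (le_trans (mom_anti mD hm (ltn0Sn a) X01 Xy)).
    apply: (@le_trans _ _ (C * tail m (2 * X0))).
      by rewrite -ler_pdivrMr // le_max lexx.
    rewrite ler_wpM2l ?(ltW C0) //; apply: tail_anti => //; exact: lt_le_trans Xy.
  have [yk'|yk'] := leP y (2 ^+ k * (2 * X0)); first exact: IH.
  pose z := y / 2; have yE : y = 2 * z by rewrite /z; field.
  have k1 : 1 <= 2 ^+ k :> R by rewrite exprn_ege1 // ler1n.
  have Xz : X0 <= z.
    have h : 1 * (2 * X0) <= 2 ^+ k * (2 * X0) by rewrite ler_wpM2r // mulr_ge0 // ltW.
    by rewrite /z; lra.
  have zk : z <= 2 ^+ k * (2 * X0) by rewrite exprS in yk; rewrite /z; lra.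
  have IHz := IH z Xz zk; have Tz := Tdbl z Xz.
  have z1 : 1 <= z by exact: le_trans Xz.
  have := mom_double (ltn0Sn a) z1; rewrite -yE => h.
  have Cp : 2 ^+ a.+1 <= C by rewrite le_max lexx orbT.
  have T2 := tail_ge0 y; rewrite -yE in Tz.
  apply: (le_trans h); apply: (@le_trans _ _ ((2 ^- a.+1 * C + 1) * (2 ^+ a * tail m y))).
    rewrite mulrDl mul1r; apply: lerD; last exact: Tz.
    rewrite -mulrA ler_wpM2l ?invr_ge0 ?exprn_ge0 //; apply: (le_trans IHz).
    by rewrite ler_wpM2l // ltW.
  rewrite mulrA ler_wpM2r //.
  have -> : (2 ^- a.+1 * C + 1) * 2 ^+ a = C / 2 + 2 ^+ a.
    by rewrite exprS; field; rewrite expf_neq0.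
  by rewrite exprS in Cp; lra.
have [k hk] : exists k, x <= 2 ^+ k * (2 * X0).
  exists (Num.bound x).
  have x0 : 0 <= x by apply: le_trans Xx; exact: ltW.
  apply: (@le_trans _ _ ((Num.bound x)%:R * 1)).
    by rewrite mulr1 ltW // archi_boundP.
  apply: ler_pM => //; last by lra.
  by rewrite -natrX ler_nat ltnW // ltn_expl.
exact: key hk.
Qed.

End Tails.

(** * Conjugate pairs of nodes and powers of [quad] *)

Section Quadratic.
Variable R : realType.
Implicit Types (x y s d w : R) (j : nat).

Definition quad x s : R := s ^+ 2 / (s ^+ 2 + x ^+ 2).

Lemma quad_den x s : 0 < x -> 0 < s ^+ 2 + x ^+ 2.
Proof. by move=> x0; rewrite ltr_wpDl ?sqr_ge0 // exprn_gt0. Qed.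

Lemma quad_ge0 x s : 0 < x -> 0 <= quad x s.
Proof. by move=> x0; rewrite divr_ge0 ?sqr_ge0 // ltW // quad_den. Qed.

Lemma quad_le1 x s : 0 < x -> quad x s <= 1.
Proof.
by move=> x0; rewrite ler_pdivrMr ?quad_den // mul1r lerDl sqr_ge0.
Qed.

Lemma quad_clip x s : 0 < x -> 0 <= s ->
  quad x s <= clip x s ^+ 2 /\ clip x s ^+ 2 <= 2 * quad x s.
Proof.
move=> x0 s0; have q0 := quad_den s x0; have x2 : 0 < x ^+ 2 by rewrite exprn_gt0.
rewrite /clip (ger0_norm s0) minEle; case: ifP => [h|/negbT h].
  rewrite expr1n quad_le1 //; split=> //.
  rewrite ler_pdivlMr // mul1r in h.
  have h2 : x ^+ 2 <= s ^+ 2 by rewrite lerXn2r ?nnegrE // ltW.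
  by rewrite /quad mulrA ler_pdivlMr //; lra.
rewrite -ltNge ltr_pdivrMr // mul1r in h.
have h2 : s ^+ 2 <= x ^+ 2 by rewrite lerXn2r ?nnegrE ?(ltW h) ?(ltW x0).
rewrite expr_div_n /quad; split.
  by rewrite ler_wpM2l ?sqr_ge0 // lef_pV2 ?posrE // lerDr sqr_ge0.
rewrite mulrCA ler_wpM2l ?sqr_ge0 // -[leLHS]mul1r ler_pdivrMr //.
rewrite mulrAC ler_pdivlMr //; lra.
Qed.

Lemma quad_scale x s (c : R) : 0 < x -> 1 <= c ->
  c ^- 2 * quad x s <= quad (c * x) s <= quad x s.
Proof.
move=> x0 c1; have c0 : 0 < c by exact: lt_le_trans c1.
have q0 := quad_den s x0; have q1 := quad_den s (mulr_gt0 c0 x0).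
have c2 : 1 <= c ^+ 2 by rewrite exprn_ege1.
have c20 : 0 < c ^+ 2 by rewrite exprn_gt0.
have s2 := sqr_ge0 s; have x2 := sqr_ge0 x.
rewrite /quad mulrCA; apply/andP; split; rewrite ler_wpM2l ?sqr_ge0 //.
  rewrite -invfM lef_pV2 ?posrE ?mulr_gt0 // exprMn mulrDr lerD2r.
  by rewrite ler_peMl.
by rewrite lef_pV2 ?posrE // lerD2l exprMn ler_peMl.
Qed.

(* The moduli are spread slightly because [node_ext] needs distinct nodes. *)
Fixpoint even_nodes d j x : seq R[i] :=
  if j is j'.+1 then
    (0 +i* ((1 + j'%:R * d) * x)) :: (0 +i* - ((1 + j'%:R * d) * x)) ::
    even_nodes d j' x
  else [::].

Fixpoint even_weight d j x s : R :=
  if j is j'.+1 then quad ((1 + j'%:R * d) * x) s * even_weight d j' x s else 1.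

Lemma size_even_nodes d j x : size (even_nodes d j x) = j.*2.
Proof. by elim: j => //= j ->. Qed.

Lemma even_nodes_mem d j x z : z \in even_nodes d j x ->
  exists2 i, (i < j)%N & complex.Re z = 0 /\
    (complex.Im z = (1 + i%:R * d) * x \/ complex.Im z = - ((1 + i%:R * d) * x)).
Proof.
elim: j => [//|j IH]; rewrite /= !inE => /or3P[/eqP ->|/eqP ->|/IH[i ij h]].
- by exists j => //=; split => //; left.
- by exists j => //=; split => //; right.
- by exists i => //; exact: ltnW.
Qed.

Lemma even_nodes_node d j x : 0 < x -> 0 <= d -> j%:R * d <= 1 ->
  all (node x) (even_nodes d j x).
Proof.
move=> x0 d0 jd; apply/allP => z /even_nodes_mem [i ij [rz iz]].
have id : i%:R * d <= 1.
  by apply: le_trans jd; rewrite ler_wpM2r // ler_nat ltnW.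
have id0 : 0 <= i%:R * d by rewrite mulr_ge0.
have -> : node x z = (x <= (1 + i%:R * d) * x <= 2 * x).
  rewrite /node rz eqxx /=.
  have e : `|(1 + i%:R * d) * x| = (1 + i%:R * d) * x.
    by rewrite ger0_norm // mulr_ge0 ?(ltW x0) //; lra.
  by case: iz => ->; rewrite ?normrN e.
by apply/andP; split; rewrite ?ler_peMl ?ler_wpM2r ?(ltW x0) //; lra.
Qed.

Lemma even_nodes_uniq d j x : 0 < x -> 0 < d -> uniq (even_nodes d j x).
Proof.
move=> x0 d0; elim: j => [//|j IH] /=; rewrite IH andbT inE negb_or.
have p i : 0 < (1 + i%:R * d) * x.
  by rewrite mulr_gt0 // ltr_wpDr // mulr_ge0 // ltW.
have ne i : (i < j)%N -> (1 + i%:R * d) * x < (1 + j%:R * d) * x.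
  by move=> ij; rewrite ltr_pM2r // ltrD2l ltr_pM2r // ltr_nat.
have pj := p j.
apply/andP; split; [apply/andP; split|].
- by apply/eqP => -[] e; lra.
- apply/negP => /even_nodes_mem [i ij [_ /= iz]].
  by have := ne i ij; have := p i; case: iz => ->; lra.
- apply/negP => /even_nodes_mem [i ij [_ /= iz]].
  by have := ne i ij; have := p i; case: iz => e; lra.
Qed.

Lemma node_prod_even d j x s : 0 < x -> 0 <= d ->
  node_prod (even_nodes d j x) s = (even_weight d j x s)%:C.
Proof.
move=> x0 d0; rewrite /node_prod; elim: j => [|j IH]; first by rewrite big_nil.
rewrite /= !big_cons IH mulrA.
have y0 : 0 < (1 + j%:R * d) * x.
  by rewrite mulr_gt0 // ltr_wpDr // mulr_ge0.
set y := _ * x in y0 *.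
have q0 := quad_den s y0.
rewrite !pfacE //=; last by rewrite gt_eqF.
  rewrite sqrrN; apply: complex_ext; rewrite ?cReM ?cImM /= ?cReM ?cImM /= /quad.
    by field; rewrite gt_eqF.
  by field; rewrite gt_eqF.
by rewrite oppr_eq0 gt_eqF.
Qed.

Lemma bernoulli_le (u : R) n : 0 <= u <= 1 -> 1 - n%:R * u <= (1 - u) ^+ n.
Proof.
move=> /andP[u0 u1]; elim: n => [|n IH]; first by rewrite mul0r subr0 expr0.
rewrite exprS -natr1; have h : 0 <= 1 - u by lra.
have := ler_wpM2l h IH; have := mulr_ge0 (ler0n R n) (sqr_ge0 u); nra.
Qed.

Lemma even_weight_approx j w : 0 < w <= 1 -> exists d, [/\ 0 < d, j%:R * d <= 1 &
  forall x s, 0 < x ->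
    (1 - w) * quad x s ^+ j <= even_weight d j x s <= quad x s ^+ j].
Proof.
move=> /andP[w0 w1].
(* Each of the [j] factors loses at most [(1 - j%:R * d) ^+ 2]; Bernoulli's inequality leaves
   [1 - 2 * j%:R ^+ 2 * d], which is at least [1 - w]. *)
pose d := w / (2 * j.+1%:R ^+ 2).
have j1 : (0 : R) < j.+1%:R by rewrite ltr0n.
have d0 : 0 < d by rewrite divr_gt0 // mulr_gt0 // exprn_gt0.
have dE : d * (2 * j.+1%:R ^+ 2) = w by rewrite divfK // mulf_neq0 // expf_neq0 // gt_eqF.
have jn : 0 <= j%:R :> R by [].
have jd : j%:R * d <= 2^-1.
  rewrite -natr1 in dE; nra.
exists d; split => //; first by lra.
move=> x s x0; have q0 := quad_ge0 s x0.
have [u uE] : exists u, u = j%:R * d by exists (j%:R * d).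
have u0 : 0 <= u by rewrite uE mulr_ge0 // ltW.
have u2 : u <= 2^-1 by rewrite uE.
have h i : (i <= j)%N ->
    ((1 - u) ^+ 2) ^+ i * quad x s ^+ i <= even_weight d i x s <= quad x s ^+ i.
  elim: i => [_|i IH ij]; first by rewrite !expr0 mulr1 lexx.
  have /andP[h1 h2] := IH (ltnW ij).
  have c1 : 1 <= 1 + i%:R * d by rewrite lerDl mulr_ge0 // ltW.
  have /andP[h3 h4] := quad_scale s x0 c1.
  have iu : i%:R * d <= u by rewrite uE ler_wpM2r ?(ltW d0) // ler_nat ltnW.
  have e0 : 0 <= even_weight d i x s.
    by apply: le_trans h1; apply: mulr_ge0; apply: exprn_ge0 => //; exact: sqr_ge0.
  have h5 : (1 - u) ^+ 2 <= (1 + i%:R * d) ^- 2.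
    rewrite -exprVn lerXn2r ?nnegrE ?invr_ge0; try lra.
      by rewrite -[leRHS]mul1r ler_pdivlMr; [nra|lra].
  rewrite (exprS _ i) (exprS (quad x s)) [even_weight _ _ _ _]/=.
  apply/andP; split; last first.
    apply: ler_pM => //; apply: quad_ge0; rewrite mulr_gt0 //; lra.
  rewrite mulrACA; apply: ler_pM => //.
  - by apply: mulr_ge0 => //; exact: sqr_ge0.
  - by apply: mulr_ge0; apply: exprn_ge0 => //; exact: sqr_ge0.
  - by apply: le_trans h3; rewrite ler_wpM2r.
have /andP[h1 h2] := h j (leqnn j); apply/andP; split => //.
apply: le_trans h1; rewrite ler_wpM2r ?exprn_ge0 // -exprM.
have u1 : 0 <= u <= 1 by rewrite u0 /=; lra.
apply: le_trans (bernoulli_le _ u1); rewrite lerD2l lerN2 uE natrM.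
rewrite -natr1 in dE; nra.
Qed.

End Quadratic.

(** * Moments of [quad] and their comparison between [mu] and [nu] *)

Section QuadMoments.
Variables (R : realType) (m : {measure set (measurableTypeR R) -> \bar R}).
Local Notation D := (`[0%R, +oo[%classic : set R).
Hypothesis hm : integr m D (clip 1).
Implicit Types (x s : R) (j : nat).

Let mD : measurable (D : set (measurableTypeR R)). Proof. exact: measurable_itv. Qed.

Definition qmom j x := Rintegral m D (fun s => quad x s ^+ j).

Lemma integr_quad j x : (0 < j)%N -> 1 <= x -> integr m D (fun s => quad x s ^+ j).
Proof.
move=> j0 x1; have x0 : 0 < x by exact: lt_le_trans x1.
have j20 : (0 < 2 * j)%N by rewrite muln_gt0.
apply: (integr_le mD _ (integr_clip mD hm j20 x1)).
  apply: measurable_funX; apply: measurable_funM; first exact: measurable_funX.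
  by apply: measurable_quad_inv; rewrite gt_eqF.
move=> s; rewrite /= in_itv /= andbT => s0.
rewrite ger0_norm ?exprn_ge0 ?quad_ge0 // exprM.
by rewrite lerXn2r ?nnegrE ?quad_ge0 ?sqr_ge0 //; have [] := quad_clip x0 s0.
Qed.

Lemma qmom_le_mom j x : (0 < j)%N -> 1 <= x -> qmom j x <= mom m D (2 * j) x.
Proof.
move=> j0 x1; have x0 : 0 < x by exact: lt_le_trans x1.
have j20 : (0 < 2 * j)%N by rewrite muln_gt0.
apply: le_Rintegral => //; [exact: integr_quad|exact: integr_clip|].
move=> s; rewrite /= in_itv /= andbT => s0; rewrite exprM.
by rewrite lerXn2r ?nnegrE ?quad_ge0 ?sqr_ge0 //; have [] := quad_clip x0 s0.
Qed.

Lemma mom_le_qmom j x : (0 < j)%N -> 1 <= x -> mom m D (2 * j) x <= 2 ^+ j * qmom j x.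
Proof.
move=> j0 x1; have x0 : 0 < x by exact: lt_le_trans x1.
have j20 : (0 < 2 * j)%N by rewrite muln_gt0.
have iq := integr_quad j0 x1.
rewrite /qmom -RintegralZl //.
apply: le_Rintegral => //; [exact: integr_clip|exact: integrZ|].
move=> s; rewrite /= in_itv /= andbT => s0; rewrite exprM -exprMn.
have [_ h] := quad_clip x0 s0.
have q := quad_ge0 s x0.
by apply: lerXn2r => //; rewrite nnegrE; [exact: sqr_ge0|exact: mulr_ge0].
Qed.

Lemma qmom_ge0 j x : 0 < x -> 0 <= qmom j x.
Proof. by move=> x0; apply: Rintegral_ge0 => s _; rewrite exprn_ge0 ?quad_ge0. Qed.

End QuadMoments.

Section QuadComparison.
Variables (R : realType) (P : probability (measurableTypeR R) R).
Variables (nu : {measure set (measurableTypeR R) -> \bar R}) (eta : R).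
Local Notation D := (`[0%R, +oo[%classic : set R).
Hypothesis hmu : free_regular_representation P eta nu.

Let mD : measurable (D : set (measurableTypeR R)). Proof. exact: measurable_itv. Qed.
Let hnu : integr nu D (clip 1). Proof. exact: free_regular_integr hmu. Qed.

Lemma integr_clipD : integr P D (clip 1).
Proof. by apply: integrableS (integr_clip1P P). Qed.

Lemma free_regular_support : P `]-oo, 0%R[%classic = 0%E.
Proof.
have [Y Y1 [m8 nid]] := node_identity hmu.
by have [eta0 _ _ _ _] := hmu; exact: support_ge0 eta0 Y1 m8 nid.
Qed.

Lemma Rintegral_support f : integr P setT f -> Rintegral P setT f = Rintegral P D f.
Proof.
move=> hf; congr fine.
have mN : measurable (`]-oo, 0%R[%classic : set (measurableTypeR R)).
  exact: measurable_itv.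
rewrite (negligible_integral mN measurableT hf free_regular_support).
congr (integral _ _ _); rewrite setTD; apply/seteqP; split => s /=.
  by rewrite !in_itv /= andbT => /negP; rewrite -leNgt.
by rewrite !in_itv /= andbT => s0; apply/negP; rewrite -leNgt.
Qed.

Lemma momPD n x : 0 < x -> mom P setT n x = mom P D n x.
Proof. by move=> x0; apply: Rintegral_support; exact: integr_clipP. Qed.

Lemma integr_even (m : {measure set (measurableTypeR R) -> \bar R}) (E : set R) d j x :
  measurable (E : set (measurableTypeR R)) -> integr m E (clip 1) ->
  (0 < j)%N -> 0 < d -> j%:R * d <= 1 -> 1 <= x ->
  integr m E (even_weight d j x) /\
  complex.Re (cintegral m E (node_prod (even_nodes d j x))) =
    Rintegral m E (even_weight d j x).
Proof.
move=> mE hE j0 d0 jd x1; have x0 : 0 < x by exact: lt_le_trans x1.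
have Z0 : even_nodes d j x != [::].
  by rewrite -size_eq0 size_even_nodes double_eq0 -lt0n.
have nZ := even_nodes_node x0 (ltW d0) jd; have uZ := even_nodes_uniq j x0 d0.
have [i1 _] := cintegr_node_prod mE hE x1 Z0 uZ nZ.
split; first by apply: (eq_integr mE _ i1) => s _; rewrite node_prod_even // ltW.
by rewrite /=; apply: eq_Rintegral => s _; rewrite node_prod_even // ltW.
Qed.

Lemma even_sandwich (m : {measure set (measurableTypeR R) -> \bar R}) w d j x :
  integr m D (clip 1) -> (0 < j)%N -> 0 < d -> j%:R * d <= 1 -> 1 <= x ->
  (forall s, (1 - w) * quad x s ^+ j <= even_weight d j x s <= quad x s ^+ j) ->
  (1 - w) * qmom m j x <= Rintegral m D (even_weight d j x) <= qmom m j x.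
Proof.
move=> hm j0 d0 jd x1 hw; have [ie _] := integr_even mD hm j0 d0 jd x1.
have iq := integr_quad hm j0 x1.
rewrite /qmom -RintegralZl //; apply/andP; split; apply: le_Rintegral => //.
- exact: integrZ.
- by move=> s _; case/andP: (hw s).
- by move=> s _; case/andP: (hw s).
Qed.

Lemma quad_comparison j w : (0 < j)%N -> 0 < w <= 1 -> exists C X, [/\ 0 <= C, 1 <= X &
  forall x, X <= x -> `|qmom P j x - qmom nu j x| <=
    w * (mom P D (2 * j) x + mom nu D (2 * j) x) +
    C * (mom nu D 1 x + x^-1) * mom P D (2 * j).-1 x].
Proof.
(* One half of [w] pays for the spread of the nodes, the other one for [zeta] in
   [node_comparison]. *)
move=> j0 /andP[w0 w1]; pose w' := w / 2.
have w'0 : 0 < w' <= 1 by rewrite /w'; apply/andP; split; lra.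
have [d [d0 jd hd]] := even_weight_approx j w'0.
have [Y Y1 [m8 nid]] := node_identity hmu.
have eta0 : 0 <= eta by case: hmu.
have w'p : 0 < w' by case/andP: w'0.
have [C [X [C0 X1 hC]]] := node_comparison eta0 hnu nid (2 * j).-1 w'p.
exists C, X; split => // x Xx.
have x1 : 1 <= x by exact: le_trans Xx.
have x0 : 0 < x by exact: lt_le_trans x1.
have nZ := even_nodes_node x0 (ltW d0) jd; have uZ := even_nodes_uniq j x0 d0.
have j2 : (2 * j).-1.+1 = (2 * j)%N by rewrite prednK // muln_gt0.
have := hC x Xx _ uZ nZ; rewrite size_even_nodes -mul2n j2 => /(_ erefl).
rewrite momPD // => h.
have [iP eP] := integr_even measurableT (integr_clip1P P) j0 d0 jd x1.
have [iN eN] := integr_even mD hnu j0 d0 jd x1.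
have := Re_le_cmod (cintegral P setT (node_prod (even_nodes d j x)) -
  cintegral nu D (node_prod (even_nodes d j x))).
rewrite cReD cReN eP eN (Rintegral_support iP) => /le_trans/(_ h).
have hx s := hd x s x0.
have /andP[p1 p2] := even_sandwich integr_clipD j0 d0 jd x1 hx.
have /andP[n1 n2] := even_sandwich hnu j0 d0 jd x1 hx.
have q1 := qmom_le_mom integr_clipD j0 x1; have q2 := qmom_le_mom hnu j0 x1.
have g1 := qmom_ge0 P j x0; have g2 := qmom_ge0 nu j x0.
have f1 := ler_wpM2l (ltW w'p) q1; have f2 := ler_wpM2l (ltW w'p) q2.
have f3 := mulr_ge0 (ltW w'p) g1; have f4 := mulr_ge0 (ltW w'p) g2.
have -> : w = w' + w' by rewrite /w'; field.
set E := C * _ * _; rewrite ler_norml => /andP[l1 l2].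
rewrite ler_norml; apply/andP; split; lra.
Qed.

End QuadComparison.

(** * From high powers of [quad] to tails *)

Section Tauberian.
Variables (R : realType).
Variables (m1 m2 : {measure set (measurableTypeR R) -> \bar R}).
Local Notation D := (`[0%R, +oo[%classic : set R).
Hypothesis h1 : integr m1 D (clip 1).
Hypothesis h2 : integr m2 D (clip 1).
Implicit Types (x s w e : R) (j k n : nat).

Let mD : measurable (D : set (measurableTypeR R)). Proof. exact: measurable_itv. Qed.

Local Notation T := (tail m1).

(** [d] is o(T). Here [m1] stands for the measure whose tail is known to vary regularly, be it [mu]
    or [nu]. *)
Definition near_small (d : R -> R) := forall w, 0 < w ->
  exists2 X, 1 <= X & forall x, X <= x -> `|d x| <= w * T x.

Definition qpoly (f : R -> R) :=
  (forall x, 1 <= x -> integr m1 D (fun s => f (quad x s)) /\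
     integr m2 D (fun s => f (quad x s))) /\
  near_small (fun x => Rintegral m1 D (fun s => f (quad x s)) -
    Rintegral m2 D (fun s => f (quad x s))).

Lemma qpolyB f g : qpoly f -> qpoly g -> qpoly (fun u => f u - g u).
Proof.
move=> [if_ sf] [ig sg]; split.
  move=> x x1; have [a b] := if_ x x1; have [c d] := ig x x1.
  by split; exact: integrB.
move=> w w0; have w20 : 0 < w / 2 by rewrite divr_gt0.
have [X X1 hX] := sf _ w20; have [Y Y1 hY] := sg _ w20.
exists (Num.max X Y); first by rewrite le_max X1.
move=> x; rewrite ge_max => /andP[Xx Yx].
have x1 : 1 <= x by exact: le_trans Xx.
have [a b] := if_ x x1; have [c d] := ig x x1.
rewrite !RintegralB // opprB addrACA [X in _ + X]addrC.
move: (hX x Xx) (hY x Yx).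
set A := Rintegral m1 _ _; set B := Rintegral m2 _ _.
set A' := Rintegral m1 _ _; set B' := Rintegral m2 _ _.
rewrite !ler_norml => /andP[? ?] /andP[? ?]; apply/andP; split; lra.
Qed.

Lemma qpolyD f g : qpoly f -> qpoly g -> qpoly (fun u => f u + g u).
Proof.
move=> hf hg.
have hz : qpoly (fun=> 0).
  split; first by move=> x _; split; exact: integrable0.
  move=> w w0; exists 1 => // x _.
  rewrite /Rintegral !integral0 subr0 normr0 mulr_ge0 ?(ltW w0) //; exact: tail_ge0.
have := qpolyB hf (qpolyB hz hg).
by congr qpoly; apply/funext => u; rewrite sub0r opprK.
Qed.

(* Stone's polynomials, which converge to the indicator function of the
   interval from 1/2 to 1; [quad x s >= 1/2] means [s >= x]. *)
Definition stone n (u : R) : R := 1 - (1 - u ^+ n) ^+ (2 ^ n).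

Lemma stone_range n u : 0 <= u <= 1 -> 0 <= stone n u <= 1.
Proof.
move=> /andP[u0 u1]; have v0 : 0 <= 1 - u ^+ n by rewrite subr_ge0 exprn_ile1.
have v1 : 1 - u ^+ n <= 1 by rewrite lerBlDr lerDl exprn_ge0.
rewrite /stone subr_ge0 exprn_ile1 //=.
by rewrite lerBlDr lerDl exprn_ge0.
Qed.

Lemma stone_le n u : 0 <= u <= 1 -> stone n u <= (2 * u) ^+ n.
Proof.
move=> /andP[u0 u1]; have hu : 0 <= u ^+ n <= 1 by rewrite exprn_ge0 // exprn_ile1.
have := bernoulli_le (2 ^ n) hu; rewrite natrX exprMn /stone; lra.
Qed.

(** With [v = u ^+ n] and [N = 2 ^ n]: as [(1 - v) ^+ N * (1 + v) ^+ N <= 1] and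
    [(1 + v) ^+ N >= N * v], the power [(1 - v) ^+ N] is at most the inverse of
    [N * v = (2 * u) ^+ n]. *)
Lemma stone_ge n u : 0 < u <= 1 -> 1 - (2 * u) ^- n <= stone n u.
Proof.
move=> /andP[u0 u1]; rewrite /stone lerD2l lerN2.
have v0 : 0 <= u ^+ n by rewrite exprn_ge0 // ltW.
have v1 : u ^+ n <= 1 by rewrite exprn_ile1 // ltW.
set v := u ^+ n in v0 v1 *.
have p0 : 0 < (2 * u) ^+ n by rewrite exprn_gt0 // mulr_gt0.
rewrite -[leRHS]mul1r ler_pdivlMr //.
have b : (2 * u) ^+ n <= (1 + v) ^+ (2 ^ n).
  rewrite exprMn -natrX -/v.
  elim: (2 ^ n)%N => [|k IH]; first by rewrite mul0r expr0.
  rewrite exprS -natr1 mulrDl mul1r.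
  have p : 1 <= (1 + v) ^+ k by rewrite exprn_ege1 // lerDl.
  nra.
apply: (@le_trans _ _ ((1 - v) ^+ (2 ^ n) * (1 + v) ^+ (2 ^ n))).
  by rewrite ler_wpM2l // exprn_ge0 // subr_ge0.
rewrite -exprMn exprn_ile1 //; first by rewrite mulr_ge0 ?subr_ge0 // addr_ge0.
nra.
Qed.

Variable k0 : nat.
Hypothesis k00 : (0 < k0)%N.
Hypothesis mono : forall j, (k0 <= j)%N ->
  near_small (fun x => qmom m1 j x - qmom m2 j x).

Lemma qpoly_mono j : (k0 <= j)%N -> qpoly (fun u => u ^+ j).
Proof.
move=> kj; split; last exact: mono.
move=> x x1; have j0 : (0 < j)%N by exact: leq_trans kj.
by split; exact: integr_quad.
Qed.

Lemma qpoly0 : qpoly (fun=> 0).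
Proof.
have := qpolyB (qpoly_mono (leqnn k0)) (qpoly_mono (leqnn k0)).
by congr qpoly; apply/funext => u; rewrite subrr.
Qed.

(** Only exponents from [k0] on can be compared; the factor [u ^+ (n * a.+1)] keeps every monomial
    of the expansion in that range. *)
Lemma qpoly_bernstein n a i : (k0 <= n)%N ->
  qpoly (fun u => u ^+ (n * a.+1) * (1 - u ^+ n) ^+ i).
Proof.
move=> kn; elim: i a => [|i IH] a.
  have := @qpoly_mono (n * a.+1) _; rewrite mulnS (leq_trans kn (leq_addr _ _)).
  move=> /(_ isT); congr qpoly; apply/funext => u.
  by rewrite expr0 mulr1 ?mulnS.
have := qpolyB (IH a) (IH a.+1); congr qpoly; apply/funext => u.
by rewrite [in X in _ - X]mulnS (addnC n) exprD exprSr; ring.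
Qed.

(** For [v = u ^+ n], the polynomial [1 - (1 - v) ^+ N] telescopes into the sum of
    [v * (1 - v) ^+ i] over [i < N], whose terms are all divisible by [v]. *)
Lemma qpoly_stone n : (k0 <= n)%N -> qpoly (stone n).
Proof.
move=> kn; rewrite /stone; elim: (2 ^ n)%N => [|N IH].
  by have := qpoly0; congr qpoly; apply/funext => u; rewrite expr0 subrr.
have := qpolyD IH (qpoly_bernstein 0 N kn); congr qpoly; apply/funext => u.
by rewrite muln1 exprS; ring.
Qed.

Variable K : R.
Hypothesis K0 : 0 <= K.
Hypothesis bdd : exists2 X, 1 <= X &
  forall x, X <= x -> qmom m1 k0 x <= K * T x /\ qmom m2 k0 x <= K * T x.

Lemma expr_small (r : R) w : 0 <= r < 1 -> 0 < w ->
  exists n, forall k, (n <= k)%N -> r ^+ k <= w.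
Proof.
move=> /andP[r0 r1] w0.
have /cvgrPdist_le/(_ _ w0) [n _ hn] : r ^+ n @[n --> \oo] --> (0 : R).
  by apply: cvg_expr; rewrite ger0_norm.
exists n => k nk; have := hn k nk; rewrite /= sub0r normrN.
by rewrite ger0_norm // exprn_ge0.
Qed.

Lemma quad_lower (lam x s : R) : 0 < x -> 0 < lam -> 0 <= s -> s <= x / lam ->
  2 * quad x s <= 2 / (1 + lam ^+ 2).
Proof.
move=> x0 l0 s0; rewrite ler_pdivlMr // => h.
have q := quad_den s x0; have l2 : 0 < lam ^+ 2 by rewrite exprn_gt0.
have hh : (s * lam) ^+ 2 <= x ^+ 2.
  by rewrite lerXn2r ?nnegrE ?mulr_ge0 // ltW.
rewrite exprMn in hh.
rewrite /quad mulrA ler_pdivrMr // mulrAC ler_pdivlMr; last by lra.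
have := sqr_ge0 s; lra.
Qed.

Lemma quad_upper (lam x s : R) : 0 < x -> 0 < lam -> lam * x < s ->
  (2 * quad x s)^-1 <= (1 + lam ^- 2) / 2 /\ 0 < quad x s.
Proof.
move=> x0 l0 h; have s0 : 0 < s by apply: lt_trans h; rewrite mulr_gt0.
have q := quad_den s x0; have l2 : 0 < lam ^+ 2 by rewrite exprn_gt0.
have s2 : 0 < s ^+ 2 by rewrite exprn_gt0.
have hh : (lam * x) ^+ 2 <= s ^+ 2.
  by rewrite lerXn2r ?nnegrE ?mulr_ge0 // ltW.
split; last by rewrite divr_gt0.
have -> : (2 * quad x s)^-1 = (1 + x ^+ 2 / s ^+ 2) / 2.
  by rewrite /quad; field; rewrite !gt_eqF //; lra.
rewrite ler_wpM2r ?invr_ge0 // lerD2l ler_pdivrMr // mulrC ler_pdivlMr //.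
by rewrite mulrC -exprMn.
Qed.

(** Below [x / lam], [k0] of the [n] factors [2 * quad x s] are kept to remain integrable, since [m]
    may have infinite mass near 0; the others supply the geometrically small coefficient. *)
Lemma stone_upper_int n (r lam x : R) (m : {measure set (measurableTypeR R) -> \bar R}) :
  integr m D (clip 1) -> integr m D (fun s => stone n (quad x s)) ->
  1 <= x -> 1 < lam -> (k0 <= n)%N -> 2 / (1 + lam ^+ 2) <= r ->
  Rintegral m D (fun s => stone n (quad x s)) <=
    tail m (x / lam) + r ^+ (n - k0) * 2 ^+ k0 * qmom m k0 x.
Proof.
move=> hm im x1 l1 kn lr; have x0 : 0 < x by exact: lt_le_trans x1.
have l0 : 0 < lam by exact: lt_trans l1.
have xl0 : 0 < x / lam by rewrite divr_gt0.
have l2 : 0 < lam ^+ 2 by rewrite exprn_gt0.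
have r0 : 0 <= r by apply: le_trans lr; rewrite divr_ge0 //; lra.
have iq := integr_quad hm k00 x1; have ir := integr_ray hm xl0.
rewrite (tailE m xl0) /qmom -RintegralZl // -RintegralD //; last exact: integrZ.
apply: le_Rintegral => //; first by apply: integrD => //; exact: integrZ.
move=> s; rewrite /= in_itv /= andbT => s0.
rewrite -[X in _ <= X + _]/(ray (x / lam) s) rayE.
have q0 := quad_ge0 s x0.
have qr : 0 <= quad x s <= 1 by rewrite q0 quad_le1.
have t0 : 0 <= r ^+ (n - k0) * 2 ^+ k0 * quad x s ^+ k0.
  by rewrite !mulr_ge0 ?exprn_ge0.
case: ltP => h.
  rewrite (_ : (true%:R : R) = 1) //.
  by have /andP[_ ?] := stone_range n qr; lra.
rewrite add0r; apply: (le_trans (stone_le n qr)).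
have -> : (2 * quad x s) ^+ n = (2 * quad x s) ^+ (n - k0) * (2 * quad x s) ^+ k0.
  by rewrite -exprD subnK.
rewrite -mulrA -(exprMn _ 2); apply: ler_wpM2r; first by rewrite exprn_ge0 // mulr_ge0.
apply: lerXn2r; rewrite ?nnegrE //; first exact: mulr_ge0.
by apply: (le_trans _ lr); exact: quad_lower.
Qed.

Lemma stone_lower_int n (w lam x : R) (m : {measure set (measurableTypeR R) -> \bar R}) :
  integr m D (clip 1) -> integr m D (fun s => stone n (quad x s)) ->
  1 <= x -> 1 < lam -> ((1 + lam ^- 2) / 2) ^+ n <= w ->
  (1 - w) * tail m (lam * x) <= Rintegral m D (fun s => stone n (quad x s)).
Proof.
move=> hm im x1 l1 lw; have x0 : 0 < x by exact: lt_le_trans x1.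
have l0 : 0 < lam by exact: lt_trans l1.
have xl0 : 0 < lam * x by rewrite mulr_gt0.
have ir := integr_ray hm xl0.
rewrite (tailE m xl0) -RintegralZl //; apply: le_Rintegral => //; first exact: integrZ.
move=> s; rewrite /= in_itv /= andbT => s0.
rewrite -[X in _ * X]/(ray (lam * x) s) rayE.
have q0 := quad_ge0 s x0.
have qr : 0 <= quad x s <= 1 by rewrite q0 quad_le1.
case: ltP => h; last by rewrite mulr0; case/andP: (stone_range n qr).
rewrite (_ : (true%:R : R) = 1) // mulr1.
have [h3 h4] := quad_upper x0 l0 h.
have qp : 0 < quad x s <= 1 by rewrite h4 quad_le1.
apply: le_trans (stone_ge n qp); rewrite lerD2l lerN2; apply: le_trans lw.
have q2 : 0 <= (2 * quad x s)^-1 by rewrite invr_ge0; exact: mulr_ge0.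
by rewrite -exprVn; apply: lerXn2r; rewrite ?nnegrE //; exact: le_trans h3.
Qed.

(** Up to small errors, [stone n (quad x s)] lies between the indicators of [s > lam * x] and
    [s > x / lam]. As its integrals against [m1] and [m2] differ by o(T), the tail of each measure
    is bounded by that of the other at a rescaled argument. *)
Lemma tauberian_ineq (lam w : R) : 1 < lam -> 0 < w ->
  exists2 X, 1 <= X & forall x, X <= x ->
  (1 - w) * tail m2 (lam * x) <= T (x / lam) + w * T x /\
  (1 - w) * T (lam * x) <= tail m2 (x / lam) + w * T x.
Proof.
(* [w' * K] pays for the part below [x / lam], and one more [w'] for the difference of the two
   integrals. *)
move=> l1 w0; pose w' := w / (K + 1).
have w'0 : 0 < w' by rewrite divr_gt0 //; move: (K0) => ?; lra.
have w'w : w' * K + w' = w by rewrite /w'; field; rewrite gt_eqF //; move: (K0) => ?; lra.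
have ww : w' <= w by have := mulr_ge0 (ltW w'0) K0; lra.
have l2 : 1 < lam ^+ 2 by rewrite exprn_egt1.
pose r := 2 / (1 + lam ^+ 2).
have r01 : 0 <= r < 1.
  rewrite /r divr_ge0 //=; last by lra.
  by rewrite ltr_pdivrMr; lra.
have s01 : 0 <= (1 + lam ^- 2) / 2 < 1.
  have v : lam ^- 2 < 1 by rewrite invf_lt1 //; lra.
  have v0 : 0 < lam ^- 2 by rewrite invr_gt0; lra.
  by apply/andP; split; lra.
have w2 : 0 < w' / 2 ^+ k0 by rewrite divr_gt0 // exprn_gt0.
have [N1 hN1] := expr_small r01 w2; have [N2 hN2] := expr_small s01 w'0.
pose n := (N1 + N2 + k0)%N.
have kn : (k0 <= n)%N by rewrite leq_addl.
have e1 : r ^+ (n - k0) * 2 ^+ k0 <= w'.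
  by rewrite -ler_pdivlMr ?exprn_gt0 //; apply: hN1; rewrite addnK leq_addr.
have e2 : ((1 + lam ^- 2) / 2) ^+ n <= w'.
  by apply: hN2; rewrite /n -addnA addnCA leq_addr.
have [iS sS] := qpoly_stone kn; have [X X1 hX] := sS _ w'0.
have [Y Y1 hY] := bdd.
exists (Num.max X Y); first by rewrite le_max X1.
move=> x; rewrite ge_max => /andP[Xx Yx].
have x1 : 1 <= x by exact: le_trans Xx.
have x0 : 0 < x by exact: lt_le_trans x1.
have [i1 i2] := iS x x1; have [b1 b2] := hY x Yx.
have u1 := stone_upper_int h1 i1 x1 l1 kn (lexx r).
have u2 := stone_upper_int h2 i2 x1 l1 kn (lexx r).
have v1 := stone_lower_int h1 i1 x1 l1 e2.
have v2 := stone_lower_int h2 i2 x1 l1 e2.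
have {}q1 : r ^+ (n - k0) * 2 ^+ k0 * qmom m1 k0 x <= w' * (K * T x).
  apply: ler_pM => //; last exact: qmom_ge0.
  by rewrite mulr_ge0 ?exprn_ge0 //; case/andP: r01.
have {}q2 : r ^+ (n - k0) * 2 ^+ k0 * qmom m2 k0 x <= w' * (K * T x).
  apply: ler_pM => //; last exact: qmom_ge0.
  by rewrite mulr_ge0 ?exprn_ge0 //; case/andP: r01.
have := hX x Xx; rewrite ler_norml => /andP[d1 d2].
have wT : w' * (K * T x) + w' * T x = w * T x by rewrite -w'w; ring.
have g1 : (1 - w) * tail m2 (lam * x) <= (1 - w') * tail m2 (lam * x).
  by rewrite ler_wpM2r ?tail_ge0 //; lra.
have g2 : (1 - w) * T (lam * x) <= (1 - w') * T (lam * x).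
  by rewrite ler_wpM2r ?tail_ge0 //; lra.
split; lra.
Qed.

End Tauberian.

(** * Consequences of regular variation and the limit of the ratio of tails *)

Section RegularVariation.
Variables (R : realType) (m1 m2 : {measure set (measurableTypeR R) -> \bar R}).
Variable alpha : R.
Local Notation D := (`[0%R, +oo[%classic : set R).
Local Notation T := (tail m1).
Hypothesis h1 : integr m1 D (clip 1).
Hypothesis h2 : integr m2 D (clip 1).
Hypothesis alpha0 : 0 <= alpha.
Hypothesis rv : regularly_varying T (- alpha).

Lemma near_pinfty (A : R -> Prop) : (\forall x \near +oo, A x) ->
  exists2 X, 1 <= X & forall x, X <= x -> A x.
Proof.
case=> M [_ hM]; exists (Num.max 1 (M + 1)); first by rewrite le_max lexx.
by move=> x; rewrite ge_max => /andP[_ h]; apply: hM; lra.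
Qed.

Lemma rv_pos : exists2 X, 1 <= X & forall x, X <= x -> 0 < T x.
Proof. by case: rv => _ h _; exact: near_pinfty h. Qed.

Lemma rv_lim t e : 0 < t -> 0 < e -> exists2 X, 1 <= X & forall x, X <= x ->
  0 < T x /\ `|T (t * x) / T x - t `^ (- alpha)| <= e.
Proof.
move=> t0 e0; case: rv => _ hp /(_ t t0) /cvgrPdist_le /(_ e e0) hl.
have [X X1 hX] := near_pinfty hl; have [Y Y1 hY] := rv_pos.
exists (Num.max X Y); first by rewrite le_max X1.
move=> x; rewrite ge_max => /andP[Xx Yx]; split; first exact: hY.
by rewrite distrC; exact: hX.
Qed.

Lemma powR_lower (t : R) : 0 < t <= 1 ->
  t ^+ Num.bound alpha <= t `^ alpha.
Proof.
move=> /andP[t0 t1]; rewrite -powR_mulrn ?(ltW t0) //.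
by apply: ger_powR; rewrite ?t0 // ltW // archi_boundP.
Qed.

(** Continuity of the limit function at 1. The scale [lam] is removed twice because the sandwich of
    [tauberian_ineq] rescales on both sides. *)
Lemma rv_slow e : 0 < e -> exists2 lam, 1 < lam & exists2 X, 1 <= X &
  forall x, X <= x -> T (x / lam / lam) <= (1 + e) * T x.
Proof.
move=> e0; pose a := Num.bound alpha.
have a0 : 0 <= a%:R :> R by [].
have e1 : 0 < 1 + e by lra.
(* For [t = (1 - v) ^+ 2], Bernoulli's inequality bounds the power alpha of [t] below by
   [1 - 2 * a%:R * v]; with [v = e / c] this exceeds [(1 + e)^-1]. *)
pose c : R := (1 + e) * (2 * a%:R + 1).
have c0 : 0 < c by rewrite mulr_gt0 //; lra.
have [v vE] : exists v, v = e / c by exists (e / c).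
have v0 : 0 < v by rewrite vE divr_gt0.
have vc : v * c = e by rewrite vE divfK // gt_eqF.
have v1 : v < 1.
  have p := mulr_ge0 a0 (ltW e1).
  rewrite vE ltr_pdivrMr // mul1r /c mulrDr mulr1 mulrCA; lra.
have u0 : 0 < 1 - v by lra.
exists (1 - v)^-1; first by rewrite invf_gt1 //; lra.
pose t := (1 - v) * (1 - v).
have t0 : 0 < t by rewrite mulr_gt0.
have t1 : 0 < t <= 1 by rewrite t0 /=; rewrite mulr_ile1 //; lra.
have tl : (1 + e)^-1 < t `^ alpha.
  apply: lt_le_trans (powR_lower t1).
  have -> : t ^+ Num.bound alpha = (1 - v) ^+ (2 * a).
    by rewrite exprM expr2.
  have v01 : 0 <= v <= 1 by rewrite !ltW.
  apply: lt_le_trans (bernoulli_le (2 * a) v01).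
  rewrite -[ltLHS]mul1r ltr_pdivrMr // natrM.
  have : v * (2 * a%:R) * (1 + e) < e.
    by have p := mulr_gt0 v0 e1; move: vc; rewrite /c => vc'; lra.
  lra.
have pt : t `^ (- alpha) < 1 + e.
  by rewrite powRN -[ltRHS]invrK ltf_pV2 ?posrE ?invr_gt0 ?powR_gt0.
have d0 : 0 < 1 + e - t `^ (- alpha) by lra.
have [X X1 hX] := rv_lim t0 d0; exists X => // x Xx.
have [Tx] := hX x Xx; rewrite ler_norml => /andP[_ h].
have -> : x / (1 - v)^-1 / (1 - v)^-1 = t * x by rewrite !invrK /t; ring.
rewrite -ler_pdivrMr //; lra.
Qed.

Lemma rv_double : exists a X, [/\ 1 <= X, forall x, X <= x -> 0 < T x &
  forall x, X <= x -> T x <= 2 ^+ a * T (2 * x)].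
Proof.
pose a := (Num.bound alpha).+1; exists a.
have h : 2 ^- a < (2 : R) `^ (- alpha).
  rewrite powRN ltf_pV2 ?posrE ?exprn_gt0 ?powR_gt0 //.
  apply: (@le_lt_trans _ _ (2 `^ (Num.bound alpha)%:R)).
    by apply: ler_powR; rewrite ?ler1n // ltW // archi_boundP.
  by rewrite powR_mulrn // /a exprS ltr_pMl ?exprn_gt0 // ltr1n.
have d0 : 0 < (2 : R) `^ (- alpha) - 2 ^- a by lra.
have [X X1 hX] := rv_lim (ltr0n _ 2) d0; exists X; split => // x Xx.
  by case: (hX x Xx).
have [Tx] := hX x Xx; rewrite ler_norml => /andP[hh _].
have p0 : 0 < 2 ^+ a :> R by rewrite exprn_gt0.
rewrite mulrC -ler_pdivrMr // mulrC -ler_pdivlMr //.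
by lra.
Qed.

Lemma rv_mom_le : exists a X C, [/\ 1 <= X, 0 < C &
  forall n x, (a < n)%N -> X <= x -> mom m1 D n x <= C * T x].
Proof.
have [a [X [X1 Tp Td]]] := rv_double.
by have [C C0 hC] := mom_le_tail h1 X1 Tp Td; exists a, X, C.
Qed.

(** The sandwich is applied at [x / lam] for the upper and at [lam * x] for the lower bound, so that
    [m2] is always evaluated at [x]; [rv_slow] then brings the arguments of T back to [x]. *)
Lemma tail_ratio k0 (K : R) : (0 < k0)%N ->
  (forall j, (k0 <= j)%N -> near_small m1 (fun x => qmom m1 j x - qmom m2 j x)) ->
  0 <= K ->
  (exists2 X, 1 <= X &
    forall x, X <= x -> qmom m1 k0 x <= K * T x /\ qmom m2 k0 x <= K * T x) ->
  tail m2 x / T x @[x --> +oo] --> (1 : R).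
Proof.
move=> k00 hmono K0 bdd; apply/cvgrPdist_le => e e0.
(* For [w <= 2^-1], [(1 + w) ^+ 2 <= (1 - w) * (1 + 8 * w)]. *)
pose w := Num.min 2^-1 (e / 8).
have [w0 w2 w8] : [/\ 0 < w, w <= 2^-1 & w <= e / 8].
  by split; rewrite /w ?lt_min ?ge_min ?lexx ?orbT // invr_gt0 divr_gt0 // ltr0n.
have [lam l1 [X X1 hX]] := rv_slow w0.
have l0 : 0 < lam by exact: lt_trans l1.
have [Y Y1 hY] := tauberian_ineq h1 h2 k00 hmono K0 bdd l1 w0.
have [V V1 hV] := rv_pos.
near=> x.
have x0 : 0 < x by near: x; apply: nbhs_pinfty_gt; exact: num_real.
have xX : X <= x by near: x; apply: nbhs_pinfty_ge; exact: num_real.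
have xV : V <= x by near: x; apply: nbhs_pinfty_ge; exact: num_real.
have xY : Y <= x / lam.
  by rewrite ler_pdivlMr //; near: x; apply: nbhs_pinfty_ge; exact: num_real.
have T0 := hV x xV.
have lx : x <= lam * x by rewrite ler_peMl ?(ltW x0) ?(ltW l1).
have llx : lam * x <= lam * (lam * x).
  by rewrite ler_wpM2l ?(ltW l0).
have [A _] := hY _ xY.
have xY2 : Y <= lam * x.
  apply: (le_trans xY); apply: (le_trans _ lx).
  by rewrite ler_pdivrMr // ler_peMr ?(ltW x0) ?(ltW l1).
have [_ B] := hY _ xY2.
have e1 : lam * (x / lam) = x by field; rewrite gt_eqF.
have e2 : lam * x / lam = x by field; rewrite gt_eqF.
rewrite e1 in A; rewrite e2 in B.
have C := hX x xX.
have C2 := hX (lam * (lam * x)) (le_trans xX (le_trans lx llx)).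
have e3 : lam * (lam * x) / lam / lam = x by field; rewrite gt_eqF.
rewrite e3 in C2.
have xl0 : 0 < x / lam / lam by rewrite !divr_gt0.
have M1 : T (x / lam) <= T (x / lam / lam).
  apply: tail_anti => //; rewrite ler_pdivrMr // ler_peMr ?(ltW l1) //.
  by rewrite divr_ge0 ?ltW.
have M2 : T (lam * x) <= T x by apply: tail_anti.
have T2 := tail_ge0 m2 x.
have TT : 0 <= T (lam * (lam * x)) by exact: tail_ge0.
rewrite distrC ler_norml lerBrDr lerBlDr; apply/andP; split.
  rewrite ler_pdivlMr //.
  have q : T x <= (1 + w) * T (lam * (lam * x)) by [].
  have q2 : (1 - w) * T x <= (1 + w) * (tail m2 x + w * T x).
    have r1 : w * T (lam * x) <= w * T x by rewrite ler_wpM2l // ltW.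
    have r2 := ler_wpM2l (_ : 0 <= 1 + w) B.
    nra.
  nra.
rewrite ler_pdivrMr //.
have r1 : w * T (x / lam) <= w * T (x / lam / lam) by rewrite ler_wpM2l // ltW.
have r2 : (1 - w) * tail m2 x <= (1 + w) * ((1 + w) * T x).
  have : 0 <= 1 + w by lra.
  nra.
have wT : 0 <= w * T x by rewrite mulr_ge0 ?ltW.
have r3 : (1 + w) * ((1 + w) * T x) <= (1 - w) * ((1 + 8 * w) * T x).
  have : 0 <= (5 - 9 * w) * (w * T x) by apply: mulr_ge0 => //; lra.
  lra.
have w1 : 0 < 1 - w by lra.
have := le_trans r2 r3; rewrite ler_pM2l // => /le_trans; apply.
by rewrite ler_wpM2r ?(ltW T0) //; lra.
Unshelve. all: by end_near.
Qed.

End RegularVariation.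

(** * Transfer of regular variation along equivalent tails *)

Section Transfer.
Variables (R : realType) (m1 m2 : {measure set (measurableTypeR R) -> \bar R}).
Variable alpha : R.
Local Notation D := (`[0%R, +oo[%classic : set R).
Hypothesis h2 : integr m2 D (clip 1).
Hypothesis rv : regularly_varying (tail m1) (- alpha).
Hypothesis r12 : tail m2 x / tail m1 x @[x --> +oo] --> (1 : R).

Lemma tail_pos_near : \forall x \near +oo, 0 < tail m2 x.
Proof.
have [_ p1 _] := rv; near=> x.
have T1 : 0 < tail m1 x by near: x.
have : `|1 - tail m2 x / tail m1 x| <= 2^-1.
  by near: x; move/cvgrPdist_le : r12; apply; rewrite invr_gt0.
rewrite ler_norml => /andP[_ h]; rewrite -(pmulr_lgt0 _ (_ : 0 < (tail m1 x)^-1)) ?invr_gt0 //.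
lra.
Unshelve. all: by end_near.
Qed.

Lemma regularly_varying_transfer : regularly_varying_tail m2 (- alpha).
Proof.
split; first by move=> x x0; exact: (tail_finite h2 x0).
split; [exact: measurable_tail|exact: tail_pos_near|move=> t t0].
have [_ p1 /(_ t t0) lim1] := rv.
have tx : t * x @[x --> +oo] --> +oo.
  apply/cvgryPge => A; exists (t^-1 * A); split; first exact: num_real.
  by move=> x /= h; rewrite -ler_pdivrMl // ltW.
have lim2 : tail m2 (t * x) / tail m1 (t * x) @[x --> +oo] --> (1 : R).
  exact: (cvg_comp _ _ tx r12).
have : (tail m2 (t * x) / tail m1 (t * x)) * (tail m1 (t * x) / tail m1 x) *
    (tail m2 x / tail m1 x)^-1 @[x --> +oo] --> 1 * t `^ (- alpha) * 1^-1.
  apply: cvgM; first exact: cvgM.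
  by apply: cvgV => //; exact: oner_neq0.
rewrite invr1 mulr1 mul1r; apply: cvg_trans; apply: near_eq_cvg; near=> x.
have T1 : 0 < tail m1 x by near: x.
have T2 : 0 < tail m2 x by near: x; exact: tail_pos_near.
have Tt : 0 < tail m1 (t * x) by near: x; exact: (tx _ p1).
by rewrite /=; field; rewrite !gt_eqF.
Unshelve. all: by end_near.
Qed.

End Transfer.

(** * The two implications *)

Section Cases.
Variables (R : realType) (P : probability (measurableTypeR R) R).
Variables (nu : {measure set (measurableTypeR R) -> \bar R}) (eta alpha : R).
Local Notation D := (`[0%R, +oo[%classic : set R).
Hypothesis hmu : free_regular_representation P eta nu.
Hypothesis alpha0 : 0 <= alpha.

Let mD : measurable (D : set (measurableTypeR R)). Proof. exact: measurable_itv. Qed.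
Let hnu : integr nu D (clip 1). Proof. exact: free_regular_integr hmu. Qed.
Let hP : integr P D (clip 1). Proof. exact: integr_clipD. Qed.

Lemma near_merge (A B : R -> Prop) :
  (exists2 X, 1 <= X & forall x, X <= x -> A x) ->
  (exists2 X, 1 <= X & forall x, X <= x -> B x) ->
  exists2 X, 1 <= X & forall x, X <= x -> A x /\ B x.
Proof.
move=> [X X1 hX] [Y Y1 hY]; exists (Num.max X Y); first by rewrite le_max X1.
by move=> x; rewrite ge_max => /andP[/hX ? /hY ?].
Qed.

Lemma small_prefix w : 0 < w -> exists2 X, 1 <= X &
  forall x, X <= x -> mom nu D 1 x + x^-1 <= w.
Proof.
move=> w0; have w20 : 0 < w / 2 by rewrite divr_gt0.
have [X X1 hX] := mom1_cvg0 mD hnu w20.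
exists (Num.max X (w / 2)^-1); first by rewrite le_max X1.
move=> x; rewrite ge_max => /andP[Xx wx].
have x0 : 0 < x by apply: lt_le_trans wx; rewrite invr_gt0.
have : x^-1 <= w / 2 by rewrite -[leRHS]invrK lef_pV2 ?posrE ?invr_gt0.
by have := hX x Xx; lra.
Qed.

Lemma tail_ratio_nu_mu : regularly_varying (tail P) (- alpha) ->
  tail nu x / tail P x @[x --> +oo] --> (1 : R).
Proof.
move=> rv; have [a [X [C [X1 C0 hC]]]] := rv_mom_le hP alpha0 rv.
have [Y Y1 hY] := rv_pos rv.
(* Moments of [nu] are not controlled beforehand. The comparison with coefficient [2 ^- j.+1],
   multiplied by the [2 ^+ j] of [mom_le_qmom], returns one half of the unknown moment, which is
   absorbed. *)
have bnu j : (a < j)%N -> exists2 K, 0 <= K & exists2 Z, 1 <= Z & forall x, Z <= x ->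
    mom nu D (2 * j) x <= K * tail P x.
  move=> aj; have j0 : (0 < j)%N by apply: leq_ltn_trans aj.
  have p0 : 0 < 2 ^+ j.+1 :> R by rewrite exprn_gt0.
  have w01 : 0 < ((2 : R) ^+ j.+1)^-1 <= 1.
    by rewrite invr_gt0 p0 invf_le1 // exprn_ege1 // ler1n.
  have [C' [Z [C'0 Z1 hZ]]] := quad_comparison hmu j0 w01.
  have w0 : 0 < (C' + 1)^-1 by rewrite invr_gt0; lra.
  have [V V1 hV] := small_prefix w0.
  exists (2 ^+ j.+1 * (3 * C)); first by rewrite !mulr_ge0 // ltW.
  have [N N1 hN] := near_merge (near_merge (ex_intro2 _ _ X X1 (fun x h => h))
    (ex_intro2 _ _ Y Y1 (fun x h => h)))
    (near_merge (ex_intro2 _ _ Z Z1 (fun x h => h)) (ex_intro2 _ _ V V1 (fun x h => h))).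
  exists N => // x /hN [[Xx Yx] [Zx Vx]].
  have x1 : 1 <= x by exact: le_trans Xx.
  have x0 : 0 < x by exact: lt_le_trans x1.
  have T0 := hY x Yx; have q := hV x Vx; have := hZ x Zx.
  have j2 : (j <= (2 * j).-1)%N by case: (j) j0 => // i _; rewrite mul2n -addnn addSn /= leq_addl.
  have pa := hC _ x (leq_trans aj j2) Xx.
  have pb := hC _ x (leq_trans aj (leq_pmull j (isT : (0 < 2)%N))) Xx.
  have g1 := mom_ge0 P D (2 * j).-1 x0.
  have g2 := mom_ge0 nu D (2 * j) x0.
  have s1 : C' * (mom nu D 1 x + x^-1) <= 1.
    apply: (@le_trans _ _ (C' * (C' + 1)^-1)); first by rewrite ler_wpM2l.
    by rewrite ler_pdivrMr; lra.
  have s2 : C' * (mom nu D 1 x + x^-1) * mom P D (2 * j).-1 x <= C * tail P x.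
    by apply: (le_trans _ pa); rewrite ler_piMl.
  have b1 := mom_le_qmom hnu j0 x1; have b2 := qmom_le_mom hP j0 x1.
  set w := (2 ^+ j.+1)^-1 in w01 *; have /andP[wp w1] := w01.
  rewrite ler_norml => /andP[l1 _].
  have w2 : 2 ^+ j * w = 2^-1 by rewrite /w exprS; field; rewrite expf_neq0.
  have c1 : qmom nu j x <= C * tail P x * 3 + w * mom nu D (2 * j) x.
    have : w * mom P D (2 * j) x <= 1 * mom P D (2 * j) x.
      by rewrite ler_wpM2r // mom_ge0.
    lra.
  have p2 : 0 <= 2 ^+ j :> R by rewrite exprn_ge0.
  have c2 := ler_wpM2l p2 c1.
  have e : 2 ^+ j * (C * tail P x * 3 + w * mom nu D (2 * j) x) =
    2 ^+ j * (C * tail P x * 3) + 2^-1 * mom nu D (2 * j) x by rewrite -w2; ring.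
  by rewrite e in c2; rewrite exprS; lra.
pose k0 := a.+1.
have [K K0 [Z Z1 hZ]] := bnu k0 (leqnn _).
apply: (tail_ratio hP hnu alpha0 rv (k0 := k0) (K := C + K)) => //.
- move=> j kj w w0.
  have aj : (a < j)%N by [].
  have j0 : (0 < j)%N by apply: leq_ltn_trans aj.
  have [K' K'0 [Z' Z'1 hZ']] := bnu j aj.
  pose w' := Num.min 1 (w / (2 * (C + K' + 1))).
  have d0 : 0 < 2 * (C + K' + 1) by lra.
  have w'0 : 0 < w' <= 1 by rewrite lt_min ge_min lexx ltr01 divr_gt0.
  have w'w : w' * (2 * (C + K' + 1)) <= w.
    by rewrite -ler_pdivlMr // ge_min lexx orbT.
  have /andP[w'p _] := w'0.
  have [C' [V [C'0 V1 hV]]] := quad_comparison hmu j0 w'0.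
  have d1 : 0 < (C' + 1) * (2 * (C + 1)) by rewrite !mulr_gt0 //; lra.
  have w20 : 0 < w / ((C' + 1) * (2 * (C + 1))) by rewrite divr_gt0.
  have [U U1 hU] := small_prefix w20.
  have [N N1 hN] := near_merge (near_merge (ex_intro2 _ _ X X1 (fun x h => h))
    (ex_intro2 _ _ Y Y1 (fun x h => h))) (near_merge (near_merge
    (ex_intro2 _ _ Z' Z'1 (fun x h => h)) (ex_intro2 _ _ V V1 (fun x h => h)))
    (ex_intro2 _ _ U U1 (fun x h => h))).
  exists N => // x /hN [[Xx Yx] [[Zx Vx] Ux]].
  have x1 : 1 <= x by exact: le_trans Xx.
  have x0 : 0 < x by exact: lt_le_trans x1.
  have T0 := hY x Yx; have q := hU x Ux; apply: (le_trans (hV x Vx)).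
  have j2 : (j <= (2 * j).-1)%N by case: (j) j0 => // i _; rewrite mul2n -addnn addSn /= leq_addl.
  have pa := hC _ x (leq_trans aj j2) Xx.
  have pb := hC _ x (leq_trans aj (leq_pmull j (isT : (0 < 2)%N))) Xx.
  have pc := hZ' x Zx.
  have g1 := mom_ge0 P D (2 * j).-1 x0.
  have s1 : C' * (mom nu D 1 x + x^-1) * (2 * (C + 1)) <= w.
    rewrite ler_pdivlMr // in q.
    have sp : 0 <= mom nu D 1 x + x^-1.
      by rewrite addr_ge0 ?invr_ge0 ?(ltW x0) // mom_ge0.
    have : 0 <= (mom nu D 1 x + x^-1) * (2 * (C + 1)) by rewrite mulr_ge0 //; lra.
    lra.
  set S := C' * _ in s1 *.
  have S0 : 0 <= S.
    by rewrite mulr_ge0 // addr_ge0 ?invr_ge0 ?(ltW x0) // mom_ge0.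
  have u1 : S * mom P D (2 * j).-1 x <= S * (C * tail P x) by rewrite ler_wpM2l.
  have u2 : w' * (mom P D (2 * j) x + mom nu D (2 * j) x) <=
      w' * (C * tail P x + K' * tail P x).
    by rewrite ler_wpM2l ?(ltW w'p) // lerD.
  have u3 := ler_wpM2r (ltW T0) s1; have u4 := ler_wpM2r (ltW T0) w'w.
  have u5 := mulr_ge0 S0 (ltW T0); have u6 := mulr_ge0 (ltW w'p) (ltW T0).
  lra.
- by lra.
- have [N N1 hN] := near_merge (near_merge (ex_intro2 _ _ X X1 (fun x h => h))
    (ex_intro2 _ _ Y Y1 (fun x h => h))) (ex_intro2 _ _ Z Z1 (fun x h => h)).
  exists N => // x /hN [[Xx Yx] Zx].
  have x1 : 1 <= x by exact: le_trans Xx.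
  have T0 := hY x Yx.
  have b1 := qmom_le_mom hP (ltn0Sn a : (0 < k0)%N) x1.
  have b2 := qmom_le_mom hnu (ltn0Sn a : (0 < k0)%N) x1.
  have pb := hC _ x (leq_pmull k0 (isT : (0 < 2)%N)) Xx.
  have pc := hZ x Zx; have u1 := mulr_ge0 (ltW C0) (ltW T0).
  have u2 := mulr_ge0 K0 (ltW T0).
  by split; lra.
Qed.

Lemma momP_clip_mul x a z q : 0 < x -> 0 <= a <= 1 -> 0 < z <= 1 ->
  a * mom P D q x <= z ^- q * a ^+ q.+1 + z * mom P D q.+1 x.
Proof.
move=> x0 ha hz; rewrite -!(momPD hmu) //.
have iq := integr_clipP P q x0; have iq1 := integr_clipP P q.+1 x0.
have i2 := integrZ measurableT a iq; have i3 := integrZ measurableT z iq1.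
rewrite /mom -!RintegralZl // -[X in X + _](Rintegral_cstP P).
rewrite -RintegralD //; last exact: integr_cst.
apply: le_Rintegral => //; first by apply: integrD => //; exact: integr_cst.
move=> s _; have hs : 0 <= clip x s <= 1 by rewrite clip_ge0 ?clip_le1.
by have := young_pt (k := 1) (j := q) (K := q.+1) hs ha hz isT (leqnn _).
Qed.

(** When only the tail of [nu] is known, the moment of [mu] in the error has an order one too low,
    and Young's inequality spends the prefix on raising it. This is done under the integral for
    [s > 1] only, where [nu] has finite mass; for [s <= 1], [clip x s <= s / x] leads back to the
    prefix [x^-1], whose powers are controlled by the mass of [nu] beyond [th], as
    [clip x s >= x^-1] there. *)
Lemma mixed_bound zeta n : 0 < zeta -> (exists2 th, 1 <= th & 0 < tail nu th) ->
  exists C X, [/\ 0 <= C, 1 <= X & forall x, X <= x ->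
    (mom nu D 1 x + x^-1) * mom P D n.+1 x <=
    zeta * mom P D n.+2 x + C * mom nu D n.+2 x].
Proof.
move=> z0 [th th1 Tth]; have th0 : 0 < th by exact: lt_le_trans th1.
pose c0 := mom nu D 1 1; have c00 : 0 <= c0 by exact: mom_ge0.
have T10 := tail_ge0 nu 1.
pose B := 1 + c0 + tail nu 1; have B0 : 0 < B by rewrite /B; lra.
pose z := Num.min 1 (zeta / B).
have z01 : 0 < z <= 1 by rewrite lt_min ge_min lexx ltr01 divr_gt0.
have zp : 0 < z by case/andP: z01.
have zB : z * B <= zeta by rewrite -ler_pdivlMr // ge_min lexx orbT.
pose w := z ^- n.+1; have w0 : 0 <= w by rewrite invr_ge0 exprn_ge0 // ltW.
exists ((1 + c0) * w / tail nu th + w), th; split => //.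
  by rewrite addr_ge0 // divr_ge0 ?(ltW Tth) // mulr_ge0 //; lra.
move=> x thx; have x1 : 1 <= x by exact: le_trans thx.
have x0 : 0 < x by exact: lt_le_trans x1.
have xv : 0 <= x^-1 <= 1 by rewrite invr_ge0 (ltW x0) /= invf_le1.
set p' := mom P D n.+1 x; set p := mom P D n.+2 x; set v := mom nu D n.+2 x.
have p'0 : 0 <= p' by exact: mom_ge0.
have p0 : 0 <= p by exact: mom_ge0.
have i1 := integr_clip mD hnu (isT : (0 < 1)%N) x1.
have iv := integr_clip mD hnu (isT : (0 < n.+2)%N) x1.
have ir := integr_ray hnu ltr01.
have irt := integr_ray hnu th0.
have ic : integr nu D (fun s => clip 1 s ^+ 1).
  exact: (integr_clip mD hnu (isT : (0 < 1)%N) (lexx 1)).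
have e1 : x^-1 * p' <= w * x ^- n.+2 + z * p.
  by have := momP_clip_mul n.+1 x0 xv z01; rewrite exprVn.
have e2 : x ^- n.+2 <= v / tail nu th.
  rewrite ler_pdivlMr // (tailE nu th0) -RintegralZl //; apply: le_Rintegral => //.
    exact: integrZ.
  move=> s; rewrite /= in_itv /= andbT => s0.
  rewrite -[X in _ * X]/(ray th s) rayE; case: ltP => hs; last first.
    by rewrite mulr0 exprn_ge0 // clip_ge0.
  rewrite (_ : (true%:R : R) = 1) // mulr1 -exprVn.
  apply: lerXn2r; rewrite ?nnegrE ?clip_ge0 ?invr_ge0 ?(ltW x0) //.
  rewrite le_min; apply/andP; split; first by case/andP: xv.
  rewrite (ger0_norm s0) -[leLHS]mul1r ler_wpM2r ?invr_ge0 ?(ltW x0) //.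
  by apply: ltW; exact: le_lt_trans hs.
have e3 : mom nu D 1 x * p' <= x^-1 * p' * c0 + w * v + z * p * tail nu 1.
  have j1 := integrZ mD (x^-1 * p') ic; have j2 := integrZ mD w iv.
  have j3 := integrZ mD (z * p) ir.
  have j12 := integrD mD j1 j2.
  rewrite [mom nu D 1 x]/mom -(RintegralZr p' mD i1) (tailE nu ltr01) /c0 /v.
  rewrite -(RintegralZl (x^-1 * p') mD ic) -(RintegralZl w mD iv).
  rewrite -(RintegralZl (z * p) mD ir).
  rewrite -(RintegralD mD j1 j2) -(RintegralD mD j12 j3).
  apply: le_Rintegral => //.
  - apply: (eq_integr mD _ (integrZ mD p' i1)) => s _; exact: mulrC.
  - exact: (integrD mD j12 j3).
  - move=> s; rewrite /= in_itv /= andbT => s0.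
    rewrite -[X in _ <= _ + _ * X]/(ray 1 s) rayE !expr1.
    have hc : 0 <= clip x s <= 1 by rewrite clip_ge0 ?clip_le1.
    have k1 : 0 <= w * clip x s ^+ n.+2 by rewrite mulr_ge0 // exprn_ge0 // clip_ge0.
    have k2 : 0 <= x^-1 * p' * clip 1 s.
      by rewrite !mulr_ge0 ?clip_ge0 //; case/andP: xv.
    case: ltP => hs; last first.
      rewrite mulr0 addr0; have -> : clip 1 s = s.
        by rewrite clip1 (ger0_norm s0); apply/min_idPr.
      have : clip x s * p' <= x^-1 * p' * s.
        rewrite mulrAC ler_wpM2r // mulrC; apply: (le_trans (clip_le _ _)).
        by rewrite (ger0_norm s0).
      lra.
    rewrite (_ : (true%:R : R) = 1) // mulr1.
    have := momP_clip_mul n.+1 x0 hc z01; rewrite -/p -/p' -/w; lra.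
have g1 := ler_wpM2l w0 e2.
have g2 : (1 + c0) * (x^-1 * p') <= (1 + c0) * (w * (v / tail nu th) + z * p).
  by apply: ler_wpM2l; lra.
have g3 := ler_wpM2r p0 zB.
have -> : ((1 + c0) * w / tail nu th + w) * v =
  (1 + c0) * (w * (v / tail nu th)) + w * v by ring.
rewrite /B in g3; lra.
Qed.

Lemma tail_ratio_mu_nu : regularly_varying (tail nu) (- alpha) ->
  tail P x / tail nu x @[x --> +oo] --> (1 : R).
Proof.
move=> rv; have [a [X [C [X1 C0 hC]]]] := rv_mom_le hnu alpha0 rv.
have [Y Y1 hY] := rv_pos rv.
have Tth : exists2 th, 1 <= th & 0 < tail nu th by exists Y => //; exact: hY.
pose k := a.+1; have ak : (a < k)%N by [].
have k2E : (2 * k)%N = (2 * a).+2 by rewrite mulnS.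
have [K K0 hK] : exists2 K, 0 <= K & exists2 Z, 1 <= Z & forall x, Z <= x ->
    mom P D (2 * k) x <= K * tail nu x.
  have p0 : 0 < 2 ^+ k :> R by rewrite exprn_gt0.
  (* The moment of [mu] comes back twice with coefficient [w], and [mom_le_qmom] multiplies by
     [2 ^+ k]: one half of it is absorbed. *)
  pose w : R := (4 * 2 ^+ k)^-1.
  have w4 : w * (4 * 2 ^+ k) = 1 by rewrite mulVf // mulf_neq0 // gt_eqF.
  have p1 : 1 <= 2 ^+ k :> R by rewrite exprn_ege1 // ler1n.
  have wp : 0 < w by rewrite invr_gt0 mulr_gt0.
  have w01 : 0 < w <= 1 by rewrite wp /= invf_le1; lra.
  have [C' [Z [C'0 Z1 hZ]]] := quad_comparison hmu (isT : (0 < k)%N) w01.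
  have z0 : 0 < w / (C' + 1) by rewrite divr_gt0 //; lra.
  have [C2 [V [C20 V1 hV]]] := mixed_bound (2 * a) z0 Tth.
  exists (2 * 2 ^+ k * (2 + C' * C2) * C).
    by rewrite !mulr_ge0 ?(ltW C0) ?(ltW p0) // addr_ge0 // mulr_ge0.
  have [N N1 hN] := near_merge (near_merge (ex_intro2 _ _ X X1 (fun x h => h))
    (ex_intro2 _ _ Y Y1 (fun x h => h)))
    (near_merge (ex_intro2 _ _ Z Z1 (fun x h => h)) (ex_intro2 _ _ V V1 (fun x h => h))).
  exists N => // x /hN [[Xx Yx] [Zx Vx]].
  have x1 : 1 <= x by exact: le_trans Xx.
  have x0 : 0 < x by exact: lt_le_trans x1.
  have T0 := hY x Yx; have := hZ x Zx; have := hV x Vx.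
  have vb := hC _ x (leq_trans ak (leq_pmull k (isT : (0 < 2)%N))) Xx.
  have b1 := mom_le_qmom hP (isT : (0 < k)%N) x1.
  have b2 := qmom_le_mom hnu (isT : (0 < k)%N) x1.
  have g1 := mom_ge0 nu D (2 * k) x0; have g2 := mom_ge0 P D (2 * k) x0.
  rewrite k2E /= -k2E; set E := (_ + _) * _ => hE.
  set p := mom P D _ x in b1 g2 hE *; set v := mom nu D _ x in vb b2 g1 hE *.
  rewrite ler_norml => /andP[_ l2].
  have hE2 : C' * E <= w * p + C' * C2 * v.
    have h := ler_wpM2l C'0 hE.
    have : C' * (w / (C' + 1) * p) <= w * p.
      have -> : C' * (w / (C' + 1) * p) = (C' / (C' + 1)) * (w * p) by ring.
      apply: ler_piMl; first by rewrite mulr_ge0 // ltW.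
      by rewrite ler_pdivrMr; lra.
    lra.
  have l3 : qmom P k x <= 2 * w * p + (2 + C' * C2) * v.
    have : w * v <= 1 * v by rewrite ler_wpM2r //; case/andP: w01.
    rewrite -mulrA -/E in l2; lra.
  have l4 := ler_wpM2l (ltW p0) l3.
  have l5 : 2 ^+ k * (2 * w * p + (2 + C' * C2) * v) =
    2^-1 * p + 2 ^+ k * (2 + C' * C2) * v.
    have -> : 2^-1 * p = 2^-1 * (w * (4 * 2 ^+ k)) * p by rewrite w4 mulr1.
    by field.
  rewrite l5 in l4.
  have l6 : 2 ^+ k * (2 + C' * C2) * v <= 2 ^+ k * (2 + C' * C2) * (C * tail nu x).
    rewrite ler_wpM2l // mulr_ge0 ?(ltW p0) // addr_ge0 // mulr_ge0 //.
  lra.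
have [Z Z1 hZ] := hK.
(* For [j > k] the order [(2 * j).-1] of the moment in the error is also covered by the bound at
   order [2 * k]; hence the choice of [k.+1] as the first exponent. *)
have k0p j : (k < j)%N -> (2 * k <= (2 * j).-1)%N.
  by case: j => // j kj; rewrite mulnS /= leqW // leq_mul2l -ltnS kj.
apply: (tail_ratio hnu hP alpha0 rv (k0 := k.+1) (K := C + K)) => //.
- move=> j kj w w0.
  have j0 : (0 < j)%N by apply: leq_ltn_trans kj.
  pose w' := Num.min 1 (w / (2 * (C + K + 1))).
  have d0 : 0 < 2 * (C + K + 1) by lra.
  have w'0 : 0 < w' <= 1 by rewrite lt_min ge_min lexx ltr01 divr_gt0.
  have w'w : w' * (2 * (C + K + 1)) <= w.
    by rewrite -ler_pdivlMr // ge_min lexx orbT.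
  have /andP[w'p _] := w'0.
  have [C' [V [C'0 V1 hV]]] := quad_comparison hmu j0 w'0.
  have d1 : 0 < (C' + 1) * (2 * (K + 1)) by rewrite !mulr_gt0 //; lra.
  have w20 : 0 < w / ((C' + 1) * (2 * (K + 1))) by rewrite divr_gt0.
  have [U U1 hU] := small_prefix w20.
  have [N N1 hN] := near_merge (near_merge (ex_intro2 _ _ X X1 (fun x h => h))
    (ex_intro2 _ _ Y Y1 (fun x h => h))) (near_merge (near_merge
    (ex_intro2 _ _ Z Z1 (fun x h => h)) (ex_intro2 _ _ V V1 (fun x h => h)))
    (ex_intro2 _ _ U U1 (fun x h => h))).
  exists N => // x /hN [[Xx Yx] [[Zx Vx] Ux]].
  have x1 : 1 <= x by exact: le_trans Xx.
  have x0 : 0 < x by exact: lt_le_trans x1.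
  have T0 := hY x Yx; have q := hU x Ux.
  rewrite distrC; apply: (le_trans (hV x Vx)).
  have k20 : (0 < 2 * k)%N by [].
  have pa : mom P D (2 * j).-1 x <= K * tail nu x.
    by apply: le_trans (hZ x Zx); apply: mom_le => //; exact: k0p.
  have pb : mom P D (2 * j) x <= K * tail nu x.
    apply: le_trans (hZ x Zx); apply: mom_le => //.
    by rewrite leq_mul2l /=; exact: ltnW.
  have aj : (a < 2 * j)%N.
    by apply: (leq_trans (leq_trans ak (ltnW kj))); exact: leq_pmull.
  have pc := hC _ x aj Xx.
  have g1 := mom_ge0 P D (2 * j).-1 x0.
  have sp : 0 <= mom nu D 1 x + x^-1.
    by rewrite addr_ge0 ?invr_ge0 ?(ltW x0) // mom_ge0.
  have s1 : C' * (mom nu D 1 x + x^-1) * (2 * (K + 1)) <= w.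
    rewrite ler_pdivlMr // in q.
    have : 0 <= (mom nu D 1 x + x^-1) * (2 * (K + 1)) by rewrite mulr_ge0 //; lra.
    lra.
  set S := C' * _ in s1 *.
  have S0 : 0 <= S by rewrite mulr_ge0.
  have u1 : S * mom P D (2 * j).-1 x <= S * (K * tail nu x) by rewrite ler_wpM2l.
  have u2 : w' * (mom P D (2 * j) x + mom nu D (2 * j) x) <=
      w' * (K * tail nu x + C * tail nu x).
    by rewrite ler_wpM2l ?(ltW w'p) // lerD.
  have u3 := ler_wpM2r (ltW T0) s1; have u4 := ler_wpM2r (ltW T0) w'w.
  have u5 := mulr_ge0 S0 (ltW T0); have u6 := mulr_ge0 (ltW w'p) (ltW T0).
  lra.
- by lra.
- have [N N1 hN] := near_merge (near_merge (ex_intro2 _ _ X X1 (fun x h => h))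
    (ex_intro2 _ _ Y Y1 (fun x h => h))) (ex_intro2 _ _ Z Z1 (fun x h => h)).
  exists N => // x /hN [[Xx Yx] Zx].
  have x1 : 1 <= x by exact: le_trans Xx.
  have T0 := hY x Yx.
  have b1 := qmom_le_mom hP (ltn0Sn k) x1.
  have b2 := qmom_le_mom hnu (ltn0Sn k) x1.
  have ak1 : (a < 2 * k.+1)%N by apply: (leq_trans ak); rewrite mulnS leqW // leqW // leq_pmull.
  have pb := hC _ x ak1 Xx.
  have pc : mom P D (2 * k.+1) x <= K * tail nu x.
    by apply: le_trans (hZ x Zx); apply: mom_le => //; rewrite leq_mul2l /=.
  have u1 := mulr_ge0 (ltW C0) (ltW T0); have u2 := mulr_ge0 K0 (ltW T0).
  by split; lra.
Qed.

End Cases.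

Theorem corollary3p1 (R : realType) (mu : probability (measurableTypeR R) R)
    (eta' : R) (nu : {measure set (measurableTypeR R) -> \bar R}) (alpha : R)
    (hmu : free_regular_representation mu eta' nu) (halpha : 0 <= alpha) :
  (regularly_varying_tail mu (- alpha) <->
   regularly_varying_tail nu (- alpha)) /\
  (regularly_varying_tail mu (- alpha) \/
   regularly_varying_tail nu (- alpha) ->
   asymp_equiv (tail mu) (tail nu)).
Proof.
have hnu := free_regular_integr hmu.
have hmuD : integr mu `[0%R, +oo[%classic (clip 1) := integr_clipD mu.
split; [split=> -[_ rv]|case=> -[_ rv]].
- exact: (regularly_varying_transfer hnu rv (tail_ratio_nu_mu hmu halpha rv)).
- exact: (regularly_varying_transfer hmuD rv (tail_ratio_mu_nu hmu halpha rv)).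
- rewrite /asymp_equiv -[X in _ --> X]invr1.
  have -> : (fun x => tail mu x / tail nu x) =
      (fun x => (tail nu x / tail mu x)^-1).
    by apply/funext => x; rewrite invf_div.
  exact: (cvgV (oner_neq0 R) (tail_ratio_nu_mu hmu halpha rv)).
- exact: (tail_ratio_mu_nu hmu halpha rv).
Qed.
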